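(* For any field $K$, there exists a unital exchange $K$-algebra $R_K$ that satisfies the following properties: (i) $R_K$ has index of nilpotence $2$ (thus stable rank $1$). (ii) For every C*-algebra $B$ of real rank $0$ and for every (von Neumann) regular ring $B$, there is no surjective pre-V-homomorphism from $\mathrm{V}(B)$ onto $\mathrm{V}(R_K)$. In particular, there is no ring $B$ which is either a C*-algebra of real rank $0$ or a regular ring such that $\mathrm{V}(R_K)\cong\mathrm{V}(B)$. Furthermore, $R_K$ can be constructed as the (unital) direct limit of a system of $\aleph_3$ finite products of members of $\mathcal{R}_K$. In particular, if $K$ is countable (or, more generally, has at most $\aleph_3$ elements), then $\operatorname{card}R_K\leq\aleph_3$.
   Context: For a field $K$, $K(t)$ and $K[t]$ are the rational function field and polynomial ring in one indeterminate $t$; $K(t)_{(0)}=\{p/q\mid p,q\in K[t],\ q(0)\neq0\}$; $C_K=\begin{pmatrix}K(t)_{(0)}&tK(t)_{(0)}\\ tK(t)_{(0)}&K(t)_{(0)}\end{pmatrix}$, a unital subalgebra of $\mathrm{M}_2(K(t))$; and $\mathcal{R}_K=\{K,\;C_K,\;\mathrm{M}_2(K(t))\}$. Direct limits are taken in the category of unital $K$-algebras with unital homomorphisms. Rings and C*-algebras $B$ in (ii) are not assumed unital. A ring $R$ is an exchange ring if for every $x\in R$ there are an idempotent $e\in R$ and $r,s\in R$ with $e=rx=x+s-sx$. A ring $R$ is regular if for every $x\in R$ there is $y\in R$ with $xyx=x$. A ring $R$ has index of nilpotence at most $n$ if $x^{n+1}=0$ implies $x^n=0$ for all $x\in R$;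 its index of nilpotence is the least such $n$ (if it exists). For a ring $R$, $\mathrm{V}(R)$ is the commutative monoid of equivalence classes $[a]_R$ of idempotents $a$ of $\mathrm{M}_\infty(R)=\bigcup_n\mathrm{M}_n(R)$ (embedding $\mathrm{M}_n(R)$ into $\mathrm{M}_{n+1}(R)$ by adding a zero row and column), where $a\sim b$ if $a=xy$, $b=yx$ for some $x,y\in\mathrm{M}_\infty(R)$, with addition determined by $[a]_R+[b]_R=[a+b]_R$ whenever $ab=ba=0$. It is conical ($x+y=0$ implies $x=y=0$). For conical commutative monoids $M,N$, a monoid homomorphism $f\colon M\to N$ is a pre-V-homomorphism if whenever $a,b\in N$ and $c\in M$ with $f(c)=a+b$, there are $x,y\in M$ such that $c=x+y$, $f(x)=a$, and $f(y)=b$. *)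

(* Defs.v *)
From HB Require Import structures.
From mathcomp Require Import all_boot all_order all_algebra generic_quotient.
From mathcomp Require Import all_classical all_reals all_analysis.
From mathcomp Require Import complex zify.

Set Implicit Arguments.
Unset Strict Implicit.
Unset Printing Implicit Defensive.

Import Order.TTheory GRing.Theory Num.Theory.
Import numFieldNormedType.Exports.

Local Open Scope classical_set_scope.
Local Open Scope ring_scope.

Reserved Notation "x ** y" (at level 40, left associativity).

HB.mixin Record isRng (B : Type) of GRing.Zmodule B := {
  rmul : B -> B -> B;
  rmulA : associative rmul;
  rmulDl : left_distributive rmul +%R;
  rmulDr : right_distributive rmul +%R
}.

#[short(type="rngType")]
HB.structure Definition Rng := {B of isRng B & GRing.Zmodule B}.

Notation "x ** y" := (rmul x y) : ring_scope.

(* Alias of a unital ring, carrying the structure that forgets the unit. *)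
Definition rng_of (R : pzRingType) : Type := R.

Section RngOf.
Variable R : pzRingType.
HB.instance Definition _ := GRing.Zmodule.on (rng_of R).
HB.instance Definition _ :=
  isRng.Build (rng_of R) (@mulrA R) (@mulrDl R) (@mulrDr R).
End RngOf.

Section RngTheory.
Variable B : rngType.
Implicit Types x y a b : B.

Lemma rmul0l x : 0 ** x = 0.
Proof. by apply: (addIr (0 ** x)); rewrite -rmulDl !add0r. Qed.

Lemma rmul0r x : x ** 0 = 0.
Proof. by apply: (addIr (x ** 0)); rewrite -rmulDr !add0r. Qed.

Lemma rmul_suml I (r : seq I) (P : pred I) (F : I -> B) x :
  (\sum_(i <- r | P i) F i) ** x = \sum_(i <- r | P i) (F i ** x).
Proof.
by apply: (big_morph (fun z => z ** x)); [move=> u v; exact: rmulDl|exact: rmul0l].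
Qed.

Lemma rmul_sumr I (r : seq I) (P : pred I) (F : I -> B) x :
  x ** (\sum_(i <- r | P i) F i) = \sum_(i <- r | P i) (x ** F i).
Proof.
by apply: (big_morph (fun z => x ** z)); [move=> u v; exact: rmulDr|exact: rmul0r].
Qed.

Definition idempotent_elt (a : B) : Prop := a ** a = a.

Definition idem_equiv (a b : B) : Prop :=
  exists x y, a = x ** y /\ b = y ** x.

Lemma idem_equiv_refl a : idempotent_elt a -> idem_equiv a a.
Proof. by move=> aa; exists a, a; rewrite aa. Qed.

Lemma idem_equiv_sym a b : idem_equiv a b -> idem_equiv b a.
Proof. by case=> x [y [-> ->]]; exists y, x. Qed.

Lemma idem_equiv_trans a b c : idempotent_elt a -> idempotent_elt c ->
  idem_equiv a b -> idem_equiv b c -> idem_equiv a c.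
Proof.
move=> aa cc [x [y [ea eb]]] [z [w [eb' ec]]]; exists (x ** z), (w ** y).
split.
- by rewrite -aa {1 2}ea -(rmulA x z) (rmulA z w) -eb' eb !rmulA.
- by rewrite -cc {1 2}ec -(rmulA w y) (rmulA y x) -eb eb' !rmulA.
Qed.

(* The witnesses can be taken in a B b and b B a. *)
Lemma idem_equiv_norm a b : idempotent_elt a -> idempotent_elt b ->
  idem_equiv a b -> exists x y,
    [/\ a = x ** y, b = y ** x & [/\ a ** x = x, x ** b = x,
        b ** y = y & y ** a = y]].
Proof.
move=> aa bb [x [y [ea eb]]]; exists (a ** x ** b), (b ** y ** a).
have axb : x ** b = a ** x by rewrite ea eb rmulA.
have bya : y ** a = b ** y by rewrite ea eb rmulA.
have E1 : x ** b = a ** x ** b by rewrite -axb -rmulA bb.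
have E2 : y ** a = b ** y ** a by rewrite -bya -rmulA aa.
rewrite -E1 -E2; split.
- by rewrite axb bya -rmulA (rmulA x) axb -rmulA -ea !aa.
- by rewrite axb bya -rmulA (rmulA y) bya -rmulA -eb !bb.
- by split; rewrite ?rmulA -?E1 -?E2 -?rmulA ?aa ?bb.
Qed.

Lemma idem_add a b : idempotent_elt a -> idempotent_elt b ->
  a ** b = 0 -> b ** a = 0 -> idempotent_elt (a + b).
Proof.
move=> aa bb ab ba.
by rewrite /idempotent_elt rmulDl !rmulDr aa bb ab ba addr0 add0r.
Qed.

Lemma idem_equiv_add a b a' b' :
  idempotent_elt a -> idempotent_elt b ->
  idempotent_elt a' -> idempotent_elt b' ->
  a ** b = 0 -> b ** a = 0 -> a' ** b' = 0 -> b' ** a' = 0 ->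
  idem_equiv a a' -> idem_equiv b b' -> idem_equiv (a + b) (a' + b').
Proof.
move=> aa bb aa' bb' ab ba ab' ba'.
move=> /(idem_equiv_norm aa aa') [x [y [ea ea' [ax xa' a'y ya]]]].
move=> /(idem_equiv_norm bb bb') [u [v [eb eb' [bu ub' b'v vb]]]].
exists (x + u), (y + v).
have xv : x ** v = 0 by rewrite -xa' -b'v -rmulA (rmulA a') ab' rmul0l rmul0r.
have uy : u ** y = 0 by rewrite -ub' -a'y -rmulA (rmulA b') ba' rmul0l rmul0r.
have yu : y ** u = 0 by rewrite -ya -bu -rmulA (rmulA a) ab rmul0l rmul0r.
have vx : v ** x = 0 by rewrite -vb -ax -rmulA (rmulA b) ba rmul0l rmul0r.
by rewrite !(rmulDl, rmulDr) xv uy yu vx !addr0 !add0r -ea -eb -ea' -eb'.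
Qed.

End RngTheory.

Section Minf.
Variable B : rngType.

Definition fin_mx : {pred nat -> nat -> B} :=
  fun x => `[< exists n, forall i j, (n <= i)%N || (n <= j)%N -> x i j = 0 >].

Lemma fin_mx_zmod : zmod_closed fin_mx.
Proof.
split; first by apply/asboolP; exists 0%N.
move=> x y /asboolP[n nx] /asboolP[m my]; apply/asboolP; exists (maxn n m).
move=> i j; rewrite !geq_max => H.
have {}H : ((n <= i) || (n <= j))%N /\ ((m <= i) || (m <= j))%N.
  by case/orP: H => /andP[-> ->]; rewrite ?orbT.
by rewrite !fctE nx ?my ?subr0; case: H.
Qed.
HB.instance Definition _ := GRing.isZmodClosed.Build _ fin_mx fin_mx_zmod.

Record Minf := MkMinf { Minf_val :> nat -> nat -> B; _ : Minf_val \in fin_mx }.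
HB.instance Definition _ := [isSub for Minf_val].
HB.instance Definition _ := [Choice of Minf by <:].
HB.instance Definition _ := [SubChoice_isSubZmodule of Minf by <:].

Implicit Types x y z : Minf.

Lemma Minf_ext x y : (forall i j, x i j = y i j) -> x = y.
Proof. by move=> xy; apply/val_inj/funext => i; apply/funext => j; exact: xy. Qed.

Lemma Minf_bound x :
  exists n, forall i j, (n <= i)%N || (n <= j)%N -> x i j = 0.
Proof. by have /asboolP := valP x. Qed.

Lemma Minf_addE x y i j : (x + y) i j = x i j + y i j. Proof. by []. Qed.

Lemma Minf_0E i j : (0 : Minf) i j = 0. Proof. by []. Qed.

(* The support of the summand is finite when x and y are in fin_mx. *)
Definition mulm_fun (x y : nat -> nat -> B) (i k : nat) : B :=
  \sum_(j \in [set: nat]) x i j ** y j k.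

Lemma mulm_funE (x y : nat -> nat -> B) i k n :
  (forall j, (n <= j)%N -> x i j ** y j k = 0) ->
  mulm_fun x y i k = \sum_(j < n) x i j ** y j k.
Proof.
move=> nxy; rewrite /mulm_fun (fsbig_ord _ n (fun j => x i j ** y j k)).
apply/esym/fsbig_widen => // j [_ /negP]; rewrite -leqNgt; exact: nxy.
Qed.

Lemma mulm_proof x y : mulm_fun x y \in fin_mx.
Proof.
have [n nx] := Minf_bound x; have [m my] := Minf_bound y.
apply/asboolP; exists (maxn n m) => i k H.
rewrite (mulm_funE (n := 0%N)) ?big_ord0// => j _.
move: H; rewrite !geq_max => /orP[] /andP[Hn Hm].
  by rewrite nx ?Hn// rmul0l.
by rewrite (my j k) ?Hm ?orbT// rmul0r.
Qed.

Definition mulm x y : Minf := MkMinf (mulm_proof x y).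

Lemma mulmE x y i k n :
  (forall j, (n <= j)%N -> x i j ** y j k = 0) ->
  mulm x y i k = \sum_(j < n) x i j ** y j k.
Proof. exact: mulm_funE. Qed.

Lemma mulmDl : left_distributive mulm +%R.
Proof.
move=> x y z; apply: Minf_ext => i k; have [n nz] := Minf_bound z.
rewrite Minf_addE !(mulmE (n := n)).
- by rewrite -big_split; apply: eq_bigr => j _; rewrite Minf_addE rmulDl.
- by move=> j nj; rewrite nz ?nj// rmul0r.
- by move=> j nj; rewrite nz ?nj// rmul0r.
- by move=> j nj; rewrite nz ?nj// rmul0r.
Qed.

Lemma mulmDr : right_distributive mulm +%R.
Proof.
move=> z x y; apply: Minf_ext => i k; have [n nz] := Minf_bound z.
rewrite Minf_addE !(mulmE (n := n)).
- by rewrite -big_split; apply: eq_bigr => j _; rewrite Minf_addE rmulDr.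
- by move=> j nj; rewrite nz ?nj ?orbT// rmul0l.
- by move=> j nj; rewrite nz ?nj ?orbT// rmul0l.
- by move=> j nj; rewrite nz ?nj ?orbT// rmul0l.
Qed.

Lemma mulmA : associative mulm.
Proof.
move=> x y z; apply: Minf_ext => i l.
have [n nx] := Minf_bound x; have [m mz] := Minf_bound z.
rewrite (mulmE (n := n)); last by move=> j nj; rewrite nx ?nj ?orbT// rmul0l.
rewrite [RHS](mulmE (n := m)); last by move=> j nj; rewrite mz ?nj// rmul0r.
under eq_bigr => j _.
  rewrite (mulmE (n := m)); last by move=> k nk; rewrite mz ?nk// rmul0r.
  rewrite rmul_sumr; over.
rewrite exchange_big; apply: eq_bigr => k _ /=.
rewrite (mulm_funE (n := n)); last by move=> j nj; rewrite nx ?nj ?orbT// rmul0l.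
by rewrite rmul_suml; apply: eq_bigr => j _; rewrite rmulA.
Qed.

HB.instance Definition _ := isRng.Build Minf mulmA mulmDl mulmDr.

Lemma rmulmE x y i k n :
  (forall j, (n <= j)%N -> x i j ** y j k = 0) ->
  (x ** y) i k = \sum_(j < n) x i j ** y j k.
Proof. exact: mulmE. Qed.

(* Spreading rows, columns, or both over the indices of parity c. *)
Lemma rspread_proof (c : bool) x :
  (fun i j => if odd i == c then x i./2 j else 0) \in fin_mx.
Proof.
have [n nx] := Minf_bound x; apply/asboolP; exists n.*2.+1 => i j nij.
by case: ifP => // _; rewrite nx //; move: nij; lia.
Qed.
Definition rspread c x : Minf := MkMinf (rspread_proof c x).

Lemma cspread_proof (c : bool) x :
  (fun i j => if odd j == c then x i j./2 else 0) \in fin_mx.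
Proof.
have [n nx] := Minf_bound x; apply/asboolP; exists n.*2.+1 => i j nij.
by case: ifP => // _; rewrite nx //; move: nij; lia.
Qed.
Definition cspread c x : Minf := MkMinf (cspread_proof c x).

Definition spread c x : Minf := rspread c (cspread c x).

Lemma spreadC c d x : rspread c (cspread d x) = cspread d (rspread c x).
Proof. by apply: Minf_ext => i j /=; case: ifP; case: ifP. Qed.

Lemma rspreadE c x i j :
  rspread c x i j = if odd i == c then x i./2 j else 0.
Proof. by []. Qed.

Lemma cspreadE c x i j :
  cspread c x i j = if odd j == c then x i j./2 else 0.
Proof. by []. Qed.

Lemma rspread_mul c x y : rspread c x ** y = rspread c (x ** y).
Proof.
apply: Minf_ext => i k; have [n ny] := Minf_bound y.
have H (u : Minf) l j : (n <= j)%N -> u l j ** y j k = 0.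
  by move=> nj; rewrite ny ?nj// rmul0r.
rewrite rspreadE !(rmulmE (n := n)); do ?exact: H.
by under eq_bigr do rewrite rspreadE; case: ifP => // _; rewrite big1// => j _; rewrite rmul0l.
Qed.

Lemma cspread_mul c x y : x ** cspread c y = cspread c (x ** y).
Proof.
apply: Minf_ext => i k; have [n nx] := Minf_bound x.
have H (u : Minf) l j : (n <= j)%N -> x i j ** u j l = 0.
  by move=> nj; rewrite nx ?nj ?orbT// rmul0l.
rewrite cspreadE !(rmulmE (n := n)); do ?exact: H.
by under eq_bigr do rewrite cspreadE; case: ifP => // _; rewrite big1// => j _; rewrite rmul0r.
Qed.

Lemma sum_double (F : nat -> B) n :
  \sum_(m < n.*2) F m = \sum_(m < n) (F m.*2 + F m.*2.+1).
Proof.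
elim: n => [|n IH]; first by rewrite !big_ord0.
by rewrite doubleS !big_ord_recr /= IH addrA.
Qed.

Lemma spread_cancel c d x y :
  cspread c x ** rspread d y = if c == d then x ** y else 0.
Proof.
apply: Minf_ext => i k; have [n nx] := Minf_bound x.
rewrite (rmulmE (n := n.*2)) /=; last first.
  move=> j nj; case: ifP => _; last by rewrite rmul0l.
  by rewrite nx ?rmul0l//; apply/orP; right; move: nj; lia.
rewrite (sum_double (fun m => (if odd m == c then x i m./2 else 0) **
                              (if odd m == d then y m./2 k else 0))).
case: ifP => [/eqP <-|cd]; last first.
  rewrite Minf_0E big1// => j _; rewrite /= odd_double /=.
  by case: c d cd => [] []//= _; rewrite ?rmul0l ?rmul0r addr0.
rewrite (rmulmE (n := n)); last by move=> j nj; rewrite nx ?nj ?orbT// rmul0l.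
apply: eq_bigr => j _; rewrite /= odd_double uphalf_double doubleK /=.
by case: c => /=; rewrite rmul0l ?addr0 ?add0r.
Qed.

Lemma spread_mul c d x y :
  spread c x ** spread d y = if c == d then spread c (x ** y) else 0.
Proof.
rewrite /spread rspread_mul (spreadC d) cspread_mul spread_cancel.
have [<- //|_] := eqVneq c d.
by apply: Minf_ext => i j /=; rewrite !if_same.
Qed.

Lemma spreadD c x y : spread c (x + y) = spread c x + spread c y.
Proof.
apply: Minf_ext => i j; rewrite Minf_addE /=.
by case: (odd i == c); case: (odd j == c); rewrite ?addr0.
Qed.

Lemma spread0 c : spread c 0 = 0.
Proof. by apply: Minf_ext => i j /=; rewrite !if_same. Qed.

Lemma spread_idem c x : idempotent_elt x -> idempotent_elt (spread c x).
Proof. by move=> xx; rewrite /idempotent_elt spread_mul eqxx xx. Qed.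

Lemma spread_equiv c x : idempotent_elt x -> idem_equiv x (spread c x).
Proof.
move=> xx; exists (cspread c x), (rspread c x).
by rewrite spread_cancel eqxx rspread_mul cspread_mul xx.
Qed.

Record idem := MkIdem { idem_val :> Minf; _ : idem_val ** idem_val == idem_val }.
HB.instance Definition _ := [isSub for idem_val].
HB.instance Definition _ := [Choice of idem by <:].

Lemma idemP (a : idem) : idempotent_elt (a : Minf).
Proof. exact/eqP/(valP a). Qed.

Definition vequiv (a b : idem) : bool := `[< idem_equiv (a : Minf) b >].

Lemma vequiv_refl : reflexive vequiv.
Proof. by move=> a; apply/asboolP/idem_equiv_refl/idemP. Qed.

Lemma vequiv_sym : symmetric vequiv.
Proof. by move=> a b; apply/asboolP/asboolP; exact: idem_equiv_sym. Qed.

Lemma vequiv_trans : transitive vequiv.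
Proof.
move=> b a c /asboolP ab /asboolP bc; apply/asboolP.
exact: idem_equiv_trans (idemP a) (idemP c) ab bc.
Qed.

Canonical vequiv_equiv := EquivRel vequiv vequiv_refl vequiv_sym vequiv_trans.

(* The monoid V(B). Its zero is vclass idem0 and its addition, induced by osum,
   satisfies [a] + [b] = [a + b] for orthogonal a and b: see vadd_orth. *)
Definition V := {eq_quot vequiv}%qT.
HB.instance Definition _ := Choice.on V.
HB.instance Definition _ : EqQuotient idem vequiv V := EqQuotient.on V.

Definition vclass (a : idem) : V := (\pi_V a)%qT.

Lemma vclass_eq (a b : idem) :
  vclass a = vclass b <-> idem_equiv (a : Minf) b.
Proof.
split; first by move=> /eqP; rewrite /vclass piE => /asboolP.
by move=> ab; apply/eqP; rewrite /vclass piE; apply/asboolP.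
Qed.

Lemma vclass_surj (u : V) : exists a, u = vclass a.
Proof. by exists (repr u); rewrite /vclass reprK. Qed.

Lemma idem0_proof : (0 : Minf) ** 0 == 0. Proof. by rewrite rmul0l. Qed.
Definition idem0 : idem := MkIdem idem0_proof.

Lemma osum_proof (a b : idem) :
  (spread false a + spread true b) ** (spread false a + spread true b)
  == spread false a + spread true b.
Proof.
by apply/eqP/idem_add; rewrite ?spread_mul//; apply/spread_idem/idemP.
Qed.

(* The orthogonal sum of a copy of a supported on the even indices and a copy
   of b supported on the odd ones. *)
Definition osum (a b : idem) : idem := MkIdem (osum_proof a b).

Definition vadd (u v : V) : V := vclass (osum (repr u) (repr v)).

Lemma vclassK a : idem_equiv (repr (vclass a) : Minf) a.
Proof. by apply/vclass_eq; rewrite /vclass reprK. Qed.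

Lemma vadd_osum a b : vadd (vclass a) (vclass b) = vclass (osum a b).
Proof.
apply/vclass_eq => /=.
have E c (a' : idem) :
    idem_equiv (spread c (repr (vclass a'))) (spread c a').
  apply: (@idem_equiv_trans _ _ (repr (vclass a') : Minf));
    try exact/spread_idem/idemP.
    exact/idem_equiv_sym/spread_equiv/idemP.
  apply: (@idem_equiv_trans _ _ (a' : Minf)).
  - exact: idemP.
  - exact/spread_idem/idemP.
  - exact: vclassK.
  - exact/spread_equiv/idemP.
by apply: idem_equiv_add; rewrite ?spread_mul//; try exact/spread_idem/idemP.
Qed.

Lemma vadd_orth (a b c : idem) :
  (a : Minf) ** b = 0 -> (b : Minf) ** a = 0 -> (c : Minf) = (a : Minf) + b ->
  vadd (vclass a) (vclass b) = vclass c.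
Proof.
move=> ab ba cE; rewrite vadd_osum; apply/vclass_eq; rewrite cE /=.
apply: idem_equiv_add; rewrite ?spread_mul//;
  try exact: idemP; try exact/spread_idem/idemP;
  exact/idem_equiv_sym/spread_equiv/idemP.
Qed.

Lemma spread_equivC c d (a : idem) : idem_equiv (spread c a) (spread d a).
Proof.
apply: (@idem_equiv_trans _ _ (a : Minf)); try exact/spread_idem/idemP.
  exact/idem_equiv_sym/spread_equiv/idemP.
exact/spread_equiv/idemP.
Qed.

Lemma spread2_equiv c d c' d' x : idempotent_elt x ->
  idem_equiv (spread c (spread d x)) (spread c' (spread d' x)).
Proof.
have H e f : idempotent_elt x -> idem_equiv x (spread e (spread f x)).
  move=> xx; apply: (@idem_equiv_trans _ _ (spread f x)) => //.
  - exact/spread_idem/spread_idem.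
  - exact/spread_equiv.
  - exact/spread_equiv/spread_idem.
move=> xx; apply: (@idem_equiv_trans _ _ x);
  try exact/spread_idem/spread_idem.
  exact/idem_equiv_sym/H.
exact: H.
Qed.

Lemma vaddC : commutative vadd.
Proof.
move=> u v; have [[a ->] [b ->]] := (vclass_surj u, vclass_surj v).
rewrite !vadd_osum; apply/vclass_eq => /=; rewrite [X in idem_equiv _ X]addrC.
apply: idem_equiv_add; rewrite ?spread_mul//; try exact/spread_idem/idemP;
  exact: spread_equivC.
Qed.

Lemma vadd0 : left_id (vclass idem0) vadd.
Proof.
move=> u; have [a ->] := vclass_surj u.
by apply: vadd_orth; rewrite /= ?rmul0l ?rmul0r ?add0r.
Qed.

Lemma vaddA : associative vadd.
Proof.
move=> u v w.
have [[[a ->] [b ->]] [c ->]] := (vclass_surj u, vclass_surj v, vclass_surj w).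
rewrite !vadd_osum; apply/vclass_eq => /=; rewrite !spreadD.
rewrite addrA.
have ss d e (x : idem) : idempotent_elt (spread d (spread e x)).
  exact/spread_idem/spread_idem/idemP.
have s e (x : idem) : idempotent_elt (spread e x) by exact/spread_idem/idemP.
have E e f g (x : idem) : idem_equiv (spread e x) (spread f (spread g x)).
  apply: (@idem_equiv_trans _ _ (x : Minf)) => //.
    exact/idem_equiv_sym/spread_equiv/idemP.
  apply: (@idem_equiv_trans _ _ (spread g x)) => //; first exact: idemP.
    exact/spread_equiv/idemP.
  exact/spread_equiv.
apply: idem_equiv_add.
- by apply: idem_add => //; rewrite spread_mul.
- by [].
- by apply: idem_add => //; rewrite !spread_mul /= ?spread_mul ?spread0.
- by [].
- by rewrite rmulDl ?spread_mul /= ?spread_mul /= ?spread0 addr0.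
- by rewrite rmulDr ?spread_mul /= ?spread_mul /= ?spread0 addr0.
- by rewrite rmulDl ?spread_mul /= ?spread_mul /= ?spread0 addr0.
- by rewrite rmulDr ?spread_mul /= ?spread_mul /= ?spread0 addr0.
- apply: idem_equiv_add => //; rewrite ?spread_mul /= ?spread_mul ?spread0 //.
  exact/spread2_equiv/idemP.
- by apply: idem_equiv_sym; exact: E.
Qed.

HB.instance Definition _ := GRing.isNmodule.Build V vaddA vaddC vadd0.

Lemma V_conical (u v : V) : u + v = 0 -> u = 0 /\ v = 0.
Proof.
have [[a ->] [b ->]] := (vclass_surj u, vclass_surj v).
rewrite [X in X = _]vadd_osum => /vclass_eq [x [y [e0 e1]]].
have z0 : (osum a b : Minf) = 0.
  by rewrite -(idemP (osum a b)) e0 -rmulA (rmulA y) -e1 rmul0l rmul0r.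
have za : spread false a = 0.
  have := congr1 (fun z => spread false a ** z) z0.
  by rewrite /= rmulDr !spread_mul /= addr0 rmul0r idemP.
have zb : spread true b = 0 by move: z0; rewrite /= za add0r.
split; apply/vclass_eq.
  by have := spread_equiv false (idemP a); rewrite za.
by have := spread_equiv true (idemP b); rewrite zb.
Qed.

End Minf.

Arguments vclass {B} a.

Definition pre_V_hom (M N : nmodType) (f : {additive M -> N}) : Prop :=
  forall (a b : N) (c : M), f c = a + b ->
    exists x y : M, [/\ c = x + y, f x = a & f y = b].

Definition exchange_ring (B : rngType) : Prop :=
  forall x : B, exists e r s : B,
    [/\ idempotent_elt e, e = r ** x & e = x + s - s ** x].

Definition regular_ring (B : rngType) : Prop :=
  forall x : B, exists y : B, x ** y ** x = x.

Definition nilpotence_index_le (R : pzRingType) (n : nat) : Prop :=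
  forall x : R, x ^+ n.+1 = 0 -> x ^+ n = 0.

Definition has_nilpotence_index (R : pzRingType) (n : nat) : Prop :=
  nilpotence_index_le R n /\
  forall m, nilpotence_index_le R m -> (n <= m)%N.

Definition stable_rank_1 (R : pzRingType) : Prop :=
  forall a b : R, (exists x y, a * x + b * y = 1) ->
    exists c u, (a + b * c) * u = 1 /\ u * (a + b * c) = 1.

Local Open Scope complex_scope.

HB.mixin Record isCStar (R : realType) (B : Type)
    of Rng B & CompleteNormedModule R[i] B := {
  star : B -> B;
  rmulZl : forall (l : R[i]) (a b : B), (l *: a) ** b = l *: (a ** b);
  rmulZr : forall (l : R[i]) (a b : B), a ** (l *: b) = l *: (a ** b);
  norm_rmul : forall a b : B, `|a ** b| <= `|a| * `|b|;
  starK : involutive star;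
  starD : {morph star : a b / a + b};
  starZ : forall (l : R[i]) (a : B), star (l *: a) = (Num.conj l) *: star a;
  starM : forall a b : B, star (a ** b) = star b ** star a;
  cstar_identity : forall a : B, `|star a ** a| = `|a| ^+ 2
}.

#[short(type="cstarType")]
HB.structure Definition CStar (R : realType) :=
  {B of isCStar R B & Rng B & CompleteNormedModule R[i] B}.

Section RealRank.
Variables (R : realType) (B : cstarType R).

Definition is_unit (u : B) : Prop := forall a, u ** a = a /\ a ** u = a.

Definition unitization : Type := B * R[i].

Definition unitz_mul (x y : unitization) : unitization :=
  (x.1 ** y.1 + y.2 *: x.1 + x.2 *: y.1, x.2 * y.2).

Definition unitz_star (x : unitization) : unitization :=
  (star x.1, Num.conj x.2).

(* If B has no unit, the C*-norm of the unitization is the operator norm of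
   left multiplication on B. *)
Definition unitz_norm_le (x : unitization) (e : R[i]) : Prop :=
  forall b : B, `|x.1 ** b + x.2 *: b| <= e * `|b|.

(* The real rank of a C*-algebra without a unit is that of its unitization. *)
Definition real_rank_0 : Prop :=
  (forall u : B, is_unit u ->
     forall a : B, star a = a -> forall e : R[i], 0 < e ->
     exists b c : B, [/\ star b = b, b ** c = u, c ** b = u & `|a - b| <= e])
  /\
  ((~ exists u : B, is_unit u) ->
     forall x : unitization, unitz_star x = x -> forall e : R[i], 0 < e ->
     exists y z : unitization,
       [/\ unitz_star y = y, unitz_mul y z = (0, 1), unitz_mul z y = (0, 1)
         & unitz_norm_le (x.1 - y.1, x.2 - y.2) e]).

End RealRank.

Section RK.
Variable K : fieldType.

Definition ratfun : Type := {fraction {poly K}}.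
HB.instance Definition _ := GRing.Field.on ratfun.

Definition ratfun_of_poly (p : {poly K}) : ratfun := tofrac p.
HB.instance Definition _ := GRing.RMorphism.copy ratfun_of_poly
  (@tofrac {poly K}).

Definition ratfun_scale (a : K) (x : ratfun) : ratfun :=
  ratfun_of_poly a%:P * x.

Lemma ratfun_scaleA a b x :
  ratfun_scale a (ratfun_scale b x) = ratfun_scale (a * b) x.
Proof. by rewrite /ratfun_scale polyCM rmorphM mulrA. Qed.

Lemma ratfun_scale1 : left_id 1 ratfun_scale.
Proof. by move=> x; rewrite /ratfun_scale polyC1 rmorph1 mul1r. Qed.

Lemma ratfun_scaleDr : right_distributive ratfun_scale +%R.
Proof. by move=> a x y; rewrite /ratfun_scale mulrDr. Qed.

Lemma ratfun_scaleDl x : {morph ratfun_scale^~ x : a b / a + b}.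
Proof. by move=> a b; rewrite /ratfun_scale polyCD rmorphD mulrDl. Qed.

HB.instance Definition _ := GRing.Zmodule_isLmodule.Build K ratfun
  ratfun_scaleA ratfun_scale1 ratfun_scaleDr ratfun_scaleDl.

Lemma ratfun_scaleAl (a : K) (x y : ratfun) : a *: (x * y) = a *: x * y.
Proof. exact: mulrA. Qed.
HB.instance Definition _ := GRing.Lmodule_isLalgebra.Build K ratfun
  ratfun_scaleAl.

Lemma ratfun_scaleAr (a : K) (x y : ratfun) : a *: (x * y) = x * (a *: y).
Proof. exact: mulrCA. Qed.
HB.instance Definition _ := GRing.Lalgebra_isAlgebra.Build K ratfun
  ratfun_scaleAr.

(* The ring written K(t)_(0). *)
Definition ratfun_loc0 : set ratfun :=
  [set x | exists p q : {poly K},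
     q.[0] != 0 /\ x = ratfun_of_poly p / ratfun_of_poly q].

Definition t_ratfun : ratfun := ratfun_of_poly 'X.

(* Alias of 'M[ratfun]_2, whose library algebra structure is over K(t). *)
Definition M2ratfun : Type := 'M[ratfun]_2.
HB.instance Definition _ := GRing.NzRing.on M2ratfun.

Definition M2_scale (a : K) (A : M2ratfun) : M2ratfun :=
  (a%:A : ratfun) *: (A : 'M[ratfun]_2).

Lemma M2_scaleA a b A : M2_scale a (M2_scale b A) = M2_scale (a * b) A.
Proof. by rewrite /M2_scale scalerA -scalerAl mul1r scalerA. Qed.

Lemma M2_scale1 : left_id 1 M2_scale.
Proof. by move=> A; rewrite /M2_scale !scale1r. Qed.

Lemma M2_scaleDr : right_distributive M2_scale +%R.
Proof. by move=> a A A'; rewrite /M2_scale scalerDr. Qed.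

Lemma M2_scaleDl A : {morph M2_scale^~ A : a b / a + b}.
Proof. by move=> a b; rewrite /M2_scale !scalerDl. Qed.

HB.instance Definition _ := GRing.Zmodule_isLmodule.Build K M2ratfun
  M2_scaleA M2_scale1 M2_scaleDr M2_scaleDl.

Lemma M2_scaleAl (a : K) (A A' : M2ratfun) : a *: (A * A') = a *: A * A'.
Proof. exact: scalerAl. Qed.
HB.instance Definition _ := GRing.Lmodule_isLalgebra.Build K M2ratfun
  M2_scaleAl.

Lemma M2_scaleAr (a : K) (A A' : M2ratfun) : a *: (A * A') = A * (a *: A').
Proof. exact: scalerAr. Qed.
HB.instance Definition _ := GRing.Lalgebra_isAlgebra.Build K M2ratfun
  M2_scaleAr.

Definition CK_pred : {pred M2ratfun} := fun A =>
  `[< forall i j : 'I_2,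
        if i == j then ratfun_loc0 (A i j)
        else exists2 x, ratfun_loc0 x & A i j = t_ratfun * x >].

Lemma loc0_poly p : ratfun_loc0 (ratfun_of_poly p).
Proof.
by exists p, 1; rewrite hornerE oner_neq0 rmorph1 divr1.
Qed.

Lemma ratfun_of_poly_neq0 (q : {poly K}) : q.[0] != 0 -> ratfun_of_poly q != 0.
Proof.
move=> q0; rewrite /ratfun_of_poly tofrac_eq0.
by apply: contra_neq q0 => ->; rewrite horner0.
Qed.

Lemma loc0D x y : ratfun_loc0 x -> ratfun_loc0 y -> ratfun_loc0 (x + y).
Proof.
move=> [p [q [q0 ->]]] [p' [q' [q0' ->]]].
exists (p * q' + p' * q), (q * q').
rewrite hornerM mulf_neq0//; split=> //.
by rewrite rmorphD !rmorphM addf_div//; exact: ratfun_of_poly_neq0.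
Qed.

Lemma loc0M x y : ratfun_loc0 x -> ratfun_loc0 y -> ratfun_loc0 (x * y).
Proof.
move=> [p [q [q0 ->]]] [p' [q' [q0' ->]]].
exists (p * p'), (q * q').
by rewrite hornerM mulf_neq0// !rmorphM mulf_div.
Qed.

Lemma CK_subalg : subalg_closed CK_pred.
Proof.
have l0 : ratfun_loc0 0 by rewrite -(rmorph0 ratfun_of_poly); exact: loc0_poly.
have l1 : ratfun_loc0 1 by rewrite -(rmorph1 ratfun_of_poly); exact: loc0_poly.
have lX : ratfun_loc0 t_ratfun by exact: loc0_poly.
have lt x : (exists2 y, ratfun_loc0 y & x = t_ratfun * y) -> ratfun_loc0 x.
  by move=> [y ly ->]; exact: loc0M.
have tD x y : (exists2 z, ratfun_loc0 z & x = t_ratfun * z) ->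
    (exists2 z, ratfun_loc0 z & y = t_ratfun * z) ->
    exists2 z, ratfun_loc0 z & x + y = t_ratfun * z.
  move=> [z lz ->] [z' lz' ->]; exists (z + z'); first exact: loc0D.
  by rewrite mulrDr.
have tM x y : ratfun_loc0 x ->
    (exists2 z, ratfun_loc0 z & y = t_ratfun * z) ->
    exists2 z, ratfun_loc0 z & x * y = t_ratfun * z.
  move=> lx [z lz ->]; exists (x * z); first exact: loc0M.
  by rewrite mulrCA.
split.
- apply/asboolP => i j; rewrite mxE; case: eqP => // _.
  by exists 0; rewrite ?mulr0.
- move=> a A A' /asboolP AP /asboolP AP'; apply/asboolP => i j.
  have aE : (a *: A + A') i j = ratfun_of_poly a%:P * A i j + A' i j.
    by rewrite !mxE; congr (_ * _ + _); exact: mulr1.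
  rewrite aE; move: (AP i j) (AP' i j); case: ifP => _ h h'.
    by apply: loc0D => //; apply: loc0M => //; exact: loc0_poly.
  by apply: tD => //; apply: tM => //; exact: loc0_poly.
- move=> A A' /asboolP AP /asboolP AP'; apply/asboolP => i j.
  have H k l : ratfun_loc0 (A k l) /\ ratfun_loc0 (A' k l).
    by move: (AP k l) (AP' k l); case: ifP => // _ /lt h /lt h'.
  rewrite mxE; case: ifP => [_|ij].
    elim/big_ind: _ => // [x y|k _]; first exact: loc0D.
    by apply: loc0M; apply H.
  elim/big_ind: _ => // [|k _]; first by exists 0; rewrite ?mulr0.
  have [ik|ik] := eqVneq i k.
    by apply: tM; [apply H|move: (AP' k j); rewrite -ik ij].
  by rewrite mulrC; apply: tM; [apply H|move: (AP i k); rewrite (negbTE ik)].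
Qed.

Record CK := MkCK { CK_val :> M2ratfun; _ : CK_val \in CK_pred }.
HB.instance Definition _ := [isSub for CK_val].
HB.instance Definition _ := [Choice of CK by <:].
HB.instance Definition _ := GRing.isSubalgClosed.Build K M2ratfun CK_pred
  (GRing.subalg_closed_semi CK_subalg).
HB.instance Definition _ := [SubChoice_isSubAlgebra of CK by <:].

Inductive RK_index := RK_field | RK_C | RK_M2.

Definition RK_member (k : RK_index) : algType K :=
  match k with
  | RK_field => K^o
  | RK_C => CK
  | RK_M2 => M2ratfun
  end.

(* The joint map x |-> (p i x)_i is an isomorphism of A onto the product.
   algType only contains nonzero algebras, so n = 0 does not occur; this loses
   nothing, as the zero algebra has no unital map to a nonzero one. *)
Definition finite_product_of_RK (A : algType K) : Prop :=
  exists (n : nat) (k : 'I_n -> RK_index)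
         (p : forall i, {lrmorphism A -> RK_member (k i)}),
    forall y : (forall i, RK_member (k i)),
      exists! x : A, forall i, p i x = y i.

End RK.

Section DirectLimit.
Variables (K : fieldType) (d : Order.disp_t) (I : porderType d).
Variables (A : I -> algType K)
  (f : forall i j : I, (i <= j)%O -> {lrmorphism A i -> A j}).

Definition direct_system : Prop :=
  [/\ inhabited I,
      forall i j : I, exists k : I, (i <= k)%O /\ (j <= k)%O,
      forall (i : I) (h : (i <= i)%O) (x : A i), f h x = x
    & forall (i j k : I) (ij : (i <= j)%O) (jk : (j <= k)%O) (ik : (i <= k)%O)
             (x : A i), f jk (f ij x) = f ik x].

Definition cocone (S : algType K) (g : forall i, {lrmorphism A i -> S}) : Prop :=
  forall (i j : I) (ij : (i <= j)%O) (x : A i), g j (f ij x) = g i x.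

Definition is_direct_limit (R : algType K)
    (c : forall i, {lrmorphism A i -> R}) : Prop :=
  cocone c /\
  forall (S : algType K) (g : forall i, {lrmorphism A i -> S}), cocone g ->
    exists h : {lrmorphism R -> S},
      (forall i x, h (c i x) = g i x) /\
      forall h' : {lrmorphism R -> S},
        (forall i x, h' (c i x) = g i x) -> h' =1 h.

End DirectLimit.

Local Open Scope card_scope.

(* aleph_(n+1) is the successor cardinal of aleph_n. *)
Fixpoint has_card_aleph (n : nat) (T : Type) : Prop :=
  if n is m.+1 then
    exists U : Type,
      [/\ has_card_aleph m U,
          [set: U] #<= [set: T],
          ~ ([set: T] #<= [set: U])
        & forall C : set T, C #<= [set: U] \/ [set: T] #<= C]
  else [set: T] #= [set: nat].

Definition card_le_aleph (n : nat) (T : Type) : Prop :=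
  exists U : Type, has_card_aleph n U /\ [set: T] #<= [set: U].

(* Main.v *)
(* Take a set W of cardinality aleph_3. The elements of R_K are functions on the partial
   functions w from {1, 2, 3} to W, depending on w only through its values in a finite subset
   of W, with r(w) in a subalgebra D(dom w) of M_2(K(t)): the scalars for the empty domain, the
   span of an idempotent a_i and 1 - a_i for {i}, a conjugate of C_K for a pair, and M_2(K(t))
   for the whole of {1, 2, 3}. The conjugate D({i, j}) has two residue fields at t = 0, and in each
   of them one of a_1, 1 - a_2 vanishes for D({1, 2}), one of a_2, 1 - a_3 for D({2, 3}), and
   one of a_1, a_3 for D({1, 3}).

   Let f : V(B) -> V(R_K) be a surjective pre-V-homomorphism. Some idempotent e of B is sent to
   the indicator of the w avoiding a finite set, and for i in {1, 2, 3} and x in W the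
   decomposition of this indicator given by a_i, 1 - a_i at the w with w(i) = x lifts to
   idempotents p_i(x), q_i(x) below e. The product p_1(x) q_2(y) is controlled by countably
   many idempotents of the ideal it generates. Their images are idempotent matrices whose
   entries at (x, y, -) reduce to 0 in both residue fields at t = 0, so they vanish at (x, y, -),
   hence at (x, y, z) for all z outside a countable set. The same holds for p_2(y) q_3(z) and
   p_1(x) p_3(z). Kuratowski's free set theorem in aleph_3 gives x, y, z outside all
   three exceptional sets; modulo the ideal of B that is null at (x, y, z), p_1 <= p_2 <= p_3
   and p_1 p_3 = 0, so that p_1 is null there, although a_1 is not zero in M_2(K(t)). *)

From Stdlib Require Import Wellfounded Relation_Operators.
From Stdlib Require Ncring Ncring_tac.
Require Import Defs.
From HB Require Import structures.
From mathcomp Require Import finmap generic_quotient.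
From mathcomp Require Import all_boot all_order all_algebra.
From mathcomp Require Import all_classical all_reals all_analysis.
From mathcomp Require Import wochoice complex ring lra.

Set Implicit Arguments.
Unset Strict Implicit.
Unset Printing Implicit Defensive.

Import Order.TTheory GRing.Theory Num.Theory.

Local Open Scope classical_set_scope.
Local Open Scope ring_scope.

(** * Free sets in aleph_3 *)

(** The obstacle in one pair: a_1 (1 - a_2) is a nonzero element of the Jacobson radical of D({1,
    2}), since a_1 and a_2 agree modulo t there. The ideal it generates has no nonzero idempotent,
    which an exchange ring tolerates; in a regular ring or a C*-algebra of real rank 0 an element is
    recovered, exactly or in the limit, from idempotents of the ideal it generates. Likewise a_2
    agrees with a_3, and a_1 with 1 - a_3. Together the three congruences would give a_1 = 1 - a_1;
    in R_K they do not clash, as they hold in different conjugates of C_K. The cardinal: the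
    elements p_i(x) of B are chosen separately for each i and x, and a free set is what brings the
    three relations to one triple. A C*-algebra gives a sequence of idempotents for each product,
    each image with finite support, so the set mappings on pairs have countable values; for these a
    free triple exists two successors above aleph_1. In the C* part, square roots and inverses are
    fixed points of contractions, and positivity of h is expressed as: M - h has norm at most M. *)

Definition inj_into (T U : Type) : Prop := exists f : T -> U, injective f.

Lemma inj_into_trans T U W : inj_into T U -> inj_into U W -> inj_into T W.
Proof. by move=> [f fi] [g gi]; exists (g \o f); exact: inj_comp. Qed.

Lemma inj_into_refl T : inj_into T T.
Proof. by exists id. Qed.

Lemma card_le_injP T U (A : set T) (B : set U) :
  (A #<= B)%card <-> inj_into {x | A x} {x | B x}.
Proof.
have memE (X : Type) (Y : set X) (x : {x | Y x}) : sval x \in Y.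
  by rewrite inE; exact: svalP.
split.
  move=> /card_leP[f].
  exists (fun x => exist _ (\val (f (exist _ (sval x) (memE _ _ x)))) (set_mem (valP _))).
  move=> x y /(congr1 sval) /= /val_inj xy.
  have /(congr1 sval) /= := injT xy.
  by case: x y {xy} => [x px] [y py] /= sxy; exact/eq_exist.
move=> [f fi]; apply/card_leP.
pose g (x : A) : B := exist _ (sval (f (exist _ (\val x) (set_mem (valP x))))) (memE _ _ _).
apply/injfunPex; exists g => // x y _ _ /(congr1 sval) /= sxy.
have fxy : f (exist _ (\val x) (set_mem (valP x))) = f (exist _ (\val y) (set_mem (valP y))).
  by apply: eq_sig_hprop => // z; exact: Prop_irrelevance.
by have /(congr1 sval) /= := fi _ _ fxy; exact: val_inj.
Qed.

Lemma inj_into_setT T : inj_into T {x : T | [set: T] x} /\ inj_into {x : T | [set: T] x} T.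
Proof.
split; first by exists (fun x => exist _ x Logic.I) => x y /(congr1 sval).
by exists sval => -[x px] [y py] /= xy; exact/eq_exist.
Qed.

Lemma card_leTP T U : ([set: T] #<= [set: U])%card <-> inj_into T U.
Proof.
have [T1 T2] := inj_into_setT T; have [U1 U2] := inj_into_setT U.
split=> [/card_le_injP TU|TU]; last apply/card_le_injP.
  exact: inj_into_trans T1 (inj_into_trans TU U2).
exact: inj_into_trans T2 (inj_into_trans TU U1).
Qed.

Lemma card_le_sigl T U (A : set T) : (A #<= [set: U])%card <-> inj_into {x | A x} U.
Proof.
have [U1 U2] := inj_into_setT U; split=> [/card_le_injP AU|AU].
  exact: inj_into_trans AU U2.
by apply/card_le_injP; exact: inj_into_trans AU U1.
Qed.

Lemma card_le_sigr T U (A : set T) : ([set: U] #<= A)%card <-> inj_into U {x | A x}.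
Proof.
have [U1 U2] := inj_into_setT U; split=> [/card_le_injP AU|AU].
  exact: inj_into_trans U1 AU.
by apply/card_le_injP; exact: inj_into_trans U2 AU.
Qed.

(** If every [i c] were some [h w], choosing such a [w] for each [c] would inject [C] into [W],
    hence into [U]. *)
Lemma exists_missed C U W X (i : C -> X) (h : W -> X) :
  injective i -> inj_into W U -> ~ inj_into C U -> exists c, forall w, h w <> i c.
Proof.
move=> ii WU CU; apply: contrapT => H; apply: CU; apply: inj_into_trans WU.
have {}H c : {w | h w = i c}.
  apply: cid; apply: contrapT => Hc; apply: H; exists c => w hw.
  by apply: Hc; exists w.
by exists (fun c => sval (H c)) => c d cd; apply: ii; rewrite -(svalP (H c)) cd (svalP (H d)).
Qed.

Definition segment W (lt : W -> W -> Prop) x := {y | lt y x}.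

Definition wo_rel W (lt : W -> W -> Prop) : Prop :=
  well_founded lt /\ (forall x y, x <> y -> lt x y \/ lt y x).

(** Transfinite recursion: the values taken below [x] are indexed by a segment that injects into
    [U], so they do not exhaust [C] and a fresh one can be chosen. Most comparisons of cardinals
    below come from this. *)
Lemma wo_rel_inj W C U (lt : W -> W -> Prop) : wo_rel lt ->
  (forall x, inj_into (segment lt x) U) -> ~ inj_into C U -> inj_into W C.
Proof.
move=> [wf tot] seg CU.
have fresh x (r : forall y, lt y x -> C) : {c | forall y (yx : lt y x), r y yx <> c}.
  apply: cid.
  have [c Hc] := @exists_missed C U _ C id (fun y : segment lt x => r _ (proj2_sig y))
    (@inj_id _) (seg x) CU.
  by exists c => y yx; exact: (Hc (exist _ y yx)).
pose f := Fix wf (fun=> C) (fun x r => sval (fresh x r)).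
have fE x : f x = sval (fresh x (fun y _ => f y)).
  rewrite /f Fix_eq // => y r s rs; congr (sval (fresh _ _)).
  by apply: functional_extensionality_dep => z; apply: functional_extensionality_dep.
exists f => x y fxy; apply: contrapT => /tot[] lt_xy.
  by move: fxy; rewrite (fE y); exact: (svalP (fresh y (fun z _ => f z)) x lt_xy).
by move: fxy => /esym; rewrite (fE x); exact: (svalP (fresh x (fun z _ => f z)) y lt_xy).
Qed.

Lemma wo_rel_exists (T : Type) : exists lt : T -> T -> Prop, wo_rel lt.
Proof.
have [R woR] := well_ordering_principle {classic T}.
have min (P : T -> Prop) : (exists x, P x) ->
    exists x, P x /\ forall y, P y -> R x y.
  move=> [x Px].
  have [|z [[Pz zP] _]] := woR (fun y => `[< P y >]); first by exists x; exact/asboolP.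
  exists z; split; first exact/asboolP.
  by move=> y Py; apply: zP; exact/asboolP.
have refl x : R x x.
  by have [|y [-> xy]] := min (eq^~ x); [exists x|exact: xy].
have tot x y : R x y \/ R y x.
  have [|z [[]-> Hz]] := min (fun z => z = x \/ z = y); first by exists x; left.
    by left; apply: Hz; right.
  by right; apply: Hz; left.
have anti x y : R x y -> R y x -> x = y.
  move=> xy yx; have [|z [_ zu]] := woR (fun z : {classic T} => `[< z = x \/ z = y >]).
    by exists x; apply/asboolP; left.
  rewrite -(zu x) ?(zu y) //; split; try (by apply/asboolP; [left|right]);
    try (by apply/asboolP; right); try (by apply/asboolP; left);
    by move=> u /asboolP[]->.
exists (fun x y => R x y /\ x <> y); split; last first.
  move=> x y xy; case: (tot x y) => h; [by left|right; split=> //].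
  by move=> yx; exact: xy.
move=> x; apply: contrapT => nx.
have [|z [nz zmin]] := min (fun x => ~ Acc (fun x y => R x y /\ x <> y) x); first by exists x.
apply: nz; constructor => y [yz ne]; apply: contrapT => /zmin zy.
by apply: ne; exact: anti.
Qed.

(** The successor cardinal, encoded by a well-order of [T] whose proper initial segments are no
    larger than [U] while [T] itself is. *)
Definition succ_wo (U T : Type) : Prop :=
  (exists lt : T -> T -> Prop, wo_rel lt /\ forall x, inj_into (segment lt x) U)
  /\ ~ inj_into T U.

Lemma not_inj_into_set U : ~ inj_into (set U) U.
Proof.
move=> [f fi]; pose D := [set x | exists2 A, x = f A & ~ A x].
have [DfD|DfD] := pselect (D (f D)); last by apply: (DfD); exists D.
by case: (DfD) => A /fi <-; exact.
Qed.

(** Hartogs' construction inside a well-order of the power set of [U]. The good points are either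
    all of the power set, too large by Cantor, or they include the segment below the least point
    whose segment does not inject into [U]. *)
Lemma succ_wo_exists U : exists T, succ_wo U T.
Proof.
have [lt [wf tot]] := wo_rel_exists (set U).
pose good y := forall z, lt z y \/ z = y -> inj_into (segment lt z) U.
pose T := {y | good y}; exists T; split.
  exists (fun x y : T => lt (sval x) (sval y)); split; last first.
    move=> [x gx]; apply: inj_into_trans (gx x (or_intror erefl)).
    exists (fun y : segment (fun x y : T => lt (sval x) (sval y)) (exist _ x gx) =>
    exist (lt^~ x) (sval (sval y)) (proj2_sig y)).
    move=> [[y gy] yx] [[z gz] zx] /(congr1 sval) /= yz.
    by apply: eq_exist; exact: eq_exist.
  split; first exact: (wf_inverse_image T _ lt sval).
  move=> [x gx] [y gy] /= xy; apply: tot => xy'; apply: xy; exact: eq_exist.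
have [all|] := pselect (forall y, good y).
  move=> TU; apply: (@not_inj_into_set U); apply: inj_into_trans TU.
  by exists (fun y => exist _ y (all y)) => x y /(congr1 sval).
move=> /existsNP[y0 bad0].
have [x0 [bx0 gx0]] : exists x0, ~ inj_into (segment lt x0) U /\
    forall y, lt y x0 -> inj_into (segment lt y) U.
  have {bad0} [z nz] : exists z, ~ inj_into (segment lt z) U.
    by move: bad0 => /existsNP[z] /not_implyP[_ nz]; exists z.
  elim/(well_founded_ind wf): z nz => z IH nz.
  have [H|] := pselect (forall y, lt y z -> inj_into (segment lt y) U); first by exists z.
  by move=> /existsNP[y] /not_implyP[yz ny]; exact: (IH y).
move=> TU; apply: bx0; apply: inj_into_trans TU.
have ltT x y z : lt x y -> lt y z -> lt x z.
  move=> xy yz.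
  have acy (a b : set U) : lt a b -> lt b a -> False.
    move=> ab; elim/(well_founded_ind wf): a b ab => a IH b ab ba; exact: (IH b ba a ba ab).
  have [xz|ne] := pselect (x = z); first by subst z; case: (acy _ _ xy yz).
  have [//|zx] := tot x z ne; exfalso.
  elim/(well_founded_ind wf): x y z xy yz zx {ne} => x IH y z xy yz zx.
  exact: (IH z zx x y zx xy yz).
have gseg (y : segment lt x0) : good (sval y).
  by case: y => y yx /= z [zy|->]; apply: gx0 => //; exact: ltT yx.
by exists (fun y => exist _ (sval y) (gseg y)) => -[x xx] [y yx] /(congr1 sval) /= xy;
  exact: eq_exist.
Qed.

Lemma succ_wo_inj U T : succ_wo U T -> inj_into U T.
Proof.
move=> [_ TU]; have [lt wo] := wo_rel_exists U.
apply: wo_rel_inj wo _ TU => x; exists sval => -[y yx] [z zx] /= yz; exact: eq_exist.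
Qed.

Definition squarable U := inj_into (U * U) U /\ inj_into nat U.

Lemma squarable_prod U W X : squarable U -> inj_into W U -> inj_into X U -> inj_into (W * X) U.
Proof.
move=> [UU _] [f fi] [g gi]; apply: inj_into_trans UU.
by exists (fun p => (f p.1, g p.2)) => -[a b] [c d] /= [/fi -> /gi ->].
Qed.

Lemma squarable_option U W : squarable U -> inj_into W U -> inj_into (option W) U.
Proof.
move=> sqU [f fi]; have [_ natU] := sqU.
have := squarable_prod sqU (inj_into_refl U) natU; apply: inj_into_trans.
have [g gi] := natU.
exists (fun w => if w is Some w then (f w, 0%N) else (g 0%N, 1%N)).
by move=> [x|] [y|] //= [/fi ->].
Qed.

(** Hessenberg's theorem at a successor, with pairs ordered by maximum and then lexicographically:
    the pairs below [p] have both coordinates at most the maximum [m] of [p], so they lie in the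
    square of a set that injects into [U]. *)
Lemma succ_wo_squarable U T : squarable U -> succ_wo U T -> squarable T.
Proof.
move=> sqU sT; have UT := succ_wo_inj sT; case: sT => -[lt [wo seg]] TU.
split; last by case: sqU => _ natU; exact: inj_into_trans natU UT.
have [wf tot] := wo.
pose mx x y := if pselect (lt x y) then y else x.
pose key (p : T * T) := (mx p.1 p.2, p).
pose lt2 := slexprod T T lt lt.
pose lt3 := slexprod T (T * T) lt lt2.
have tot2 x y : x <> y -> lt2 x y \/ lt2 y x.
  case: x y => [x1 x2] [y1 y2] ne.
  have [e1|/tot[h|h]] := pselect (x1 = y1); [subst y1| |].
  - have [e2|/tot[h|h]] := pselect (x2 = y2); first by subst y2.
      by left; apply: right_slex.
    by right; apply: right_slex.
  - by left; apply: left_slex.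
  - by right; apply: left_slex.
apply: (@wo_rel_inj _ _ U (fun p q => lt3 (key p) (key q))) TU; first split.
- have wf3 : well_founded lt3.
    exact: (wf_slexprod _ _ _ _ wf (wf_slexprod _ _ _ _ wf wf)).
  exact: (wf_inverse_image _ _ lt3 key wf3).
- move=> x y xy; rewrite /lt3.
  have [e|/tot[h|h]] := pselect ((key x).1 = (key y).1).
  + by rewrite /key /= in e *; rewrite e; case: (tot2 _ _ xy) => h; [left|right]; exact: right_slex.
  + by left; rewrite /key; exact: left_slex.
  + by right; rewrite /key; exact: left_slex.
move=> p; pose m := (key p).1.
pose le x := lt x m \/ x = m.
have leU : inj_into {x | le x} U.
  apply: inj_into_trans (squarable_option sqU (seg m)).
  exists (fun x => if pselect (lt (sval x) m) is left h
    then Some (exist (lt^~ m) (sval x) h) else None).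
  move=> [x hx] [y hy] /=; case: pselect => // h1; case: pselect => // h2.
    by move=> [xy]; exact: eq_exist.
  by move=> _; case: hx => // ex; case: hy => // ey; apply: eq_exist; rewrite ex ey.
apply: inj_into_trans (squarable_prod sqU leU leU).
have lem x y : lt3 (key (x, y)) (key p) -> le x /\ le y.
  move=> h; have lm : le (mx x y).
    rewrite /le /m; move: h; rewrite /key /=; set a := mx x y; set b := mx _ _.
    by inversion 1; subst; [left|right].
  have acy (a b : T) : lt a b -> lt b a -> False.
    move=> ab; elim/(well_founded_ind wf): a b ab => a IH b ab ba; exact: (IH b ba a ba ab).
  have ltT a b c : lt a b -> lt b c -> lt a c.
    move=> ab bc.
    have [ac|ne] := pselect (a = c); first by subst c; case: (acy _ _ ab bc).
    have [//|ca] := tot a c ne; exfalso.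
    elim/(well_founded_ind wf): a b c ab bc ca {ne} => a IH b c ab bc ca.
    exact: (IH c ca a b ca ab bc).
  have leT a b : lt a b -> le b -> le a.
    by move=> ab [bm|bm]; left; [exact: ltT bm|rewrite -bm].
  move: lm; rewrite /mx; case: pselect => xy lm /=; split=> //.
    exact: leT xy lm.
  have [<-//|/tot[//|yx]] := pselect (x = y); exact: leT yx lm.
have lem' (q : segment (fun p q => lt3 (key p) (key q)) p) :
    le (sval q).1 /\ le (sval q).2.
  by case: q => -[x y] h /=; exact: lem.
exists (fun q => (exist _ _ (lem' q).1, exist _ _ (lem' q).2)).
move=> [[x1 x2] hx] [[y1 y2] hy] /= [e1 e2]; apply: eq_exist.
by rewrite e1 e2.
Qed.

Lemma squarable_nat : squarable nat.
Proof.
by split; [exists (pickle : nat * nat -> nat); exact: (pcan_inj pickleK)|exact: inj_into_refl].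
Qed.

Lemma squarable_seq U W : squarable U -> inj_into W U -> inj_into (seq W) U.
Proof.
move=> sqU WU; have [UU natU] := sqU; have [p pi] := UU; have [f fi] := WU.
have := squarable_prod sqU natU (inj_into_refl U); apply: inj_into_trans.
have [g _] := natU.
pose e := foldr (fun x u => p (f x, u)) (g 0%N).
exists (fun s => (size s, e s)) => s; elim: s => [|x s IH] [|y t] //= [st].
by move=> /pi[/fi -> est]; rewrite (IH t) // st est.
Qed.

Lemma has_card_aleph_bij n T T' : inj_into T T' -> inj_into T' T ->
  has_card_aleph n T -> has_card_aleph n T'.
Proof.
case: n => [|n] TT' T'T /=.
  move=> /card_eqPle[/card_leTP h1 /card_leTP h2].
  apply/card_eqPle; split; first exact/card_leTP/(inj_into_trans T'T).
  exact/card_leTP/(inj_into_trans h2).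
move=> [U [cU /card_leTP UT nTU H]]; exists U; split=> //.
- by apply/card_leTP; exact: inj_into_trans TT'.
- by move=> /card_leTP h; apply: nTU; apply/card_leTP; exact: inj_into_trans h.
have [f fi] := T'T; move=> C.
have CC : inj_into {x | C x} {x | (f @` C) x} /\ inj_into {x | (f @` C) x} {x | C x}.
  have fC x : C x -> (f @` C) (f x) by move=> Cx; exists x.
  split.
    exists (fun x => exist _ (f (sval x)) (fC _ (svalP x))).
    by move=> [x hx] [y hy] /(congr1 sval) /= /fi; exact: eq_exist.
  have g (y : {x | (f @` C) x}) : {x | C x /\ f x = sval y}.
    by apply: cid; case: y => y [x Cx] /= xy; exists x.
  exists (fun y => exist _ (sval (g y)) (svalP (g y)).1) => y z /(congr1 sval) /= yz.
  apply: eq_sig_hprop; first by move=> ? ? ?; exact: Prop_irrelevance.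
  by rewrite -(svalP (g y)).2 -(svalP (g z)).2 yz.
case: (H (f @` C)) => [/card_le_sigl|/card_le_sigr] h; [left|right].
  by apply/card_le_sigl; exact: inj_into_trans CC.1 h.
by apply/card_le_sigr; exact: inj_into_trans T'T (inj_into_trans h CC.2).
Qed.

Lemma succ_wo_aleph n U T : has_card_aleph n U -> succ_wo U T -> has_card_aleph n.+1 T.
Proof.
move=> cU sT; exists U; split=> //.
- by apply/card_leTP; exact: succ_wo_inj.
- by case: sT => _ nTU /card_leTP.
move=> C; have [CU|CU] := pselect (inj_into {x | C x} U); first by left; exact/card_le_sigl.
right; apply/card_le_sigr; case: sT => -[lt [wo seg]] _.
exact: wo_rel_inj wo seg CU.
Qed.

Definition aleph_unique n U :=
  forall U', has_card_aleph n U' -> inj_into U' U /\ inj_into U U'.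

Lemma aleph_unique_nat : aleph_unique 0 nat.
Proof.
by move=> U' /= /card_eqPle[/card_leTP h1 /card_leTP h2].
Qed.

(** The dichotomy in [has_card_aleph] is applied to the range of an injection of [T] into [T']: it
    is too large to inject into [U'], so [T'] injects into it. *)
Lemma aleph_unique_succ n U T : aleph_unique n U -> succ_wo U T -> aleph_unique n.+1 T.
Proof.
move=> unU [[lt [wo seg]] nTU] T' [U' [/unU[U'U UU'] _ nT'U' H]].
have TT' : inj_into T T'.
  apply: wo_rel_inj wo seg _ => T'U; apply: nT'U'; apply/card_leTP.
  exact: inj_into_trans UU'.
split=> //; have [f fi] := TT'.
have rT : inj_into T {x | range f x}.
  by exists (fun x => exist _ (f x) (ex_intro2 _ _ x Logic.I erefl)) => x y /(congr1 sval) /= /fi.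
have Tr : inj_into {x | range f x} T.
  have g (y : {x | range f x}) : {x | f x = sval y}.
    by apply: cid; case: y => y [x _] /= xy; exists x.
  exists (fun y => sval (g y)) => y z yz.
  apply: eq_sig_hprop; first by move=> ? ? ?; exact: Prop_irrelevance.
  by rewrite -(svalP (g y)) -(svalP (g z)) yz.
case: (H (range f)) => [/card_le_sigl|/card_le_sigr] h; last exact: inj_into_trans Tr.
case: nTU; apply: inj_into_trans rT _; exact: inj_into_trans U'U.
Qed.

(* Kuratowski's free set theorem for countable-valued set mappings on pairs,
   in the three-coloured form needed here. *)
Lemma free_triple (T1 T2 : Type) (T : eqType) :
  succ_wo nat T1 -> succ_wo T1 T2 -> succ_wo T2 T ->
  forall F G H : T -> T -> nat -> seq T, exists a b c,
    [/\ forall n, a \notin F b c n, forall n, b \notin G a c n & forall n, c \notin H a b n].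
Proof.
move=> s1 s2 s3 F G H.
have sq1 := succ_wo_squarable squarable_nat s1.
have sq2 := succ_wo_squarable sq1 s2.
have [i ii] := succ_wo_inj s3; have [j ji] := succ_wo_inj s2.
have nat1 : inj_into nat T1 by case: sq1.
have nat2 : inj_into nat T2 by case: sq2.
have miss X C U (s : X -> seq T) (k : C -> T) : injective k -> inj_into (X * nat) U ->
    ~ inj_into C U -> exists c, forall x, k c \notin s x.
  move=> ki XU CU.
  have [c Hc] := @exists_missed C U _ (option T) (fun c => Some (k c))
    (fun p => onth (s p.1) p.2) (inj_comp (@Some_inj _) ki) XU CU.
  exists c => x; apply/negP => /onthP[m kcE].
  exact: (Hc (x, m)).
(* [a] is chosen first, against all pairs from the copy of [T2], which are too few for their values
   to cover [T]. Then [b] is sought in that copy, against the pairs of [a] with an element of the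
   copy of [T1], and finally [c] in the latter, against one countable set. *)
have [a aF] : exists a, forall p : T2 * T2 * nat, a \notin F (i p.1.1) (i p.1.2) p.2.
  apply: (miss _ _ T2 (fun p : T2 * T2 * nat => F (i p.1.1) (i p.1.2) p.2) id) => //.
    by do !apply: squarable_prod => //; exact: inj_into_refl.
  by case: s3.
have [b bG] : exists b, forall p : T1 * nat, i b \notin G a (i (j p.1)) p.2.
  apply: (miss _ _ T1 (fun p : T1 * nat => G a (i (j p.1)) p.2) i) => //.
    by do !apply: squarable_prod => //; exact: inj_into_refl.
  by case: s2.
have [c cH] : exists c, forall n, i (j c) \notin H a (i b) n.
  apply: (miss _ _ nat (H a (i b)) (i \o j)); first exact: inj_comp.
    by apply: (squarable_prod squarable_nat); exact: inj_into_refl.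
  by case: s1.
by exists a, (i b), (i (j c)); split=> [n|n|n]; [exact: (aF (_, _, n))|exact: (bG (c, n))|].
Qed.

Lemma aleph3_exists : exists (T1 T2 : Type) (T : choiceType),
  [/\ succ_wo nat T1, succ_wo T1 T2 & succ_wo T2 T].
Proof.
have [T1 s1] := succ_wo_exists nat; have [T2 s2] := succ_wo_exists T1.
by have [T s3] := succ_wo_exists T2; exists T1, T2, {classic T}.
Qed.

(** * Ideals of a ring and of its monoid V *)

Section RngExtra.
Variable B : rngType.
Implicit Types x y : B.

Lemma rmulNl x y : (- x) ** y = - (x ** y).
Proof. by apply/eqP; rewrite -subr_eq0 opprK -rmulDl addNr rmul0l. Qed.

Lemma rmulNr x y : x ** (- y) = - (x ** y).
Proof. by apply/eqP; rewrite -subr_eq0 opprK -rmulDr addNr rmul0r. Qed.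

Lemma rmulBl x y z : (x - y) ** z = x ** z - y ** z.
Proof. by rewrite rmulDl rmulNl. Qed.

Lemma rmulBr x y z : z ** (x - y) = z ** x - z ** y.
Proof. by rewrite rmulDr rmulNr. Qed.

Lemma idem_sub x y : idempotent_elt x -> idempotent_elt y -> x ** y = y -> y ** x = y ->
  [/\ idempotent_elt (x - y), y ** (x - y) = 0 & (x - y) ** y = 0].
Proof.
move=> xx yy xy yx; rewrite /idempotent_elt !(rmulBl, rmulBr) xx yy xy yx.
by rewrite !subrr subr0.
Qed.

End RngExtra.

Section Class.
Variable B : rngType.
Implicit Types (a b e g : Minf B) (u v : V B).

(** Total on matrices, so that no proof of idempotency occurs inside a class; a matrix that is not
    idempotent gets the class 0. *)
Definition cl a : V B := vclass (insubd (idem0 B) a).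

Lemma insubd_idem a : idempotent_elt a -> (insubd (idem0 B) a : Minf B) = a.
Proof. by move=> aa; rewrite /insubd; case: insubP => [? _ ->//|/negP[]]; exact/eqP. Qed.

Lemma cl_surj v : exists2 a, idempotent_elt a & v = cl a.
Proof.
have [a ->] := vclass_surj v; exists (a : Minf B); first exact: idemP.
by rewrite /cl valKd.
Qed.

Lemma cl_eq a b : idempotent_elt a -> idempotent_elt b ->
  cl a = cl b <-> idem_equiv a b.
Proof. by move=> aa bb; rewrite /cl vclass_eq !insubd_idem. Qed.

Lemma cl0 : cl 0 = 0.
Proof.
rewrite /cl (_ : insubd _ _ = idem0 B) //; apply/val_inj.
exact: (insubd_idem (rmul0l _)).
Qed.

Lemma clD a b : idempotent_elt a -> idempotent_elt b -> a ** b = 0 -> b ** a = 0 ->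
  cl (a + b) = cl a + cl b.
Proof.
move=> aa bb ab ba; apply/esym; rewrite [LHS](_ : _ = vadd (cl a) (cl b))//.
by apply: vadd_orth; rewrite !insubd_idem//; exact: idem_add.
Qed.

(** [e] is equivalent to an orthogonal sum [s + t] of idempotents of classes [u] and [v]; the
    witnesses [X] and [Y] of the equivalence carry this decomposition back to [e]. *)
Lemma cl_split e u v : idempotent_elt e -> cl e = u + v -> exists a b,
  [/\ e = a + b, idempotent_elt a /\ idempotent_elt b,
      a ** b = 0 /\ b ** a = 0 & cl a = u /\ cl b = v].
Proof.
move=> ee; have [x xx ->] := cl_surj u; have [y yy ->] := cl_surj v.
have sxx c : idempotent_elt (spread c x) by exact: spread_idem.
have syy c : idempotent_elt (spread c y) by exact: spread_idem.
pose s := spread false x; pose t := spread true y.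
have st : s ** t = 0 by rewrite spread_mul.
have ts : t ** s = 0 by rewrite spread_mul.
have ist : idempotent_elt (s + t) by exact: (idem_add (sxx _) (syy _)).
rewrite (_ : cl x = cl s); last by apply/(cl_eq xx (sxx _)); exact: spread_equiv.
rewrite (_ : cl y = cl t); last by apply/(cl_eq yy (syy _)); exact: spread_equiv.
rewrite -(clD (sxx false) (syy true) st ts) => /(cl_eq ee ist) /(idem_equiv_norm ee ist).
move=> [X [Y [eXY sYX _]]].
have YXs : s ** (Y ** X) = s by rewrite -sYX rmulDr sxx st addr0.
have YXt : t ** (Y ** X) = t by rewrite -sYX rmulDr syy ts add0r.
have ii w w' : w ** (Y ** X) = w -> (X ** w ** Y) ** (X ** w' ** Y) = X ** (w ** w') ** Y.
  by move=> ww; rewrite -{2}ww !rmulA.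
have eq w : idempotent_elt w -> w ** (Y ** X) = w -> idem_equiv (X ** w ** Y) w.
  move=> iw ww; exists (X ** w), (w ** Y).
  by rewrite !rmulA -(rmulA X w w) iw -(rmulA w Y X) ww iw.
have iX w : idempotent_elt w -> w ** (Y ** X) = w -> idempotent_elt (X ** w ** Y).
  by move=> iw ww; rewrite /idempotent_elt ii // iw.
exists (X ** s ** Y), (X ** t ** Y); split.
- by rewrite -rmulDl -rmulDr sYX !rmulA -eXY -rmulA -eXY ee.
- by split; [exact: iX (sxx _) YXs|exact: iX (syy _) YXt].
- by rewrite (ii _ _ YXs) (ii _ _ YXt) st ts !(rmul0l, rmul0r).
- by split; [apply/(cl_eq (iX _ (sxx _) YXs) (sxx _))/eq
            |apply/(cl_eq (iX _ (syy _) YXt) (syy _))/eq].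
Qed.

(** After cutting [x] and [y] down to [X] and [Y], the product [Y ** X] is an idempotent below [e]
    equivalent to [g]. *)
Lemma cl_factor e g x y : idempotent_elt e -> idempotent_elt g -> g = x ** e ** y ->
  exists w, cl e = cl g + w.
Proof.
move=> ee gg gE; pose X := g ** x ** e; pose Y := e ** y ** g.
have XY : X ** Y = g.
  rewrite /X /Y !rmulA -(rmulA (g ** x) e e) ee -!rmulA (rmulA e y) (rmulA x).
  by rewrite (rmulA x e y) -gE (rmulA g g) gg gg.
pose h := Y ** X.
have hh : idempotent_elt h by rewrite /idempotent_elt /h rmulA -(rmulA Y X) XY /Y -!rmulA (rmulA g g) gg.
have eh : e ** h = h by rewrite /h /Y !rmulA ee.
have he : h ** e = h by rewrite /h /X -!rmulA ee.
have [ieh h1 h2] := idem_sub ee hh eh he.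
exists (cl (e - h)); rewrite (_ : cl g = cl h); last by apply/cl_eq => //; exists X, Y.
by rewrite -clD // addrC subrK.
Qed.

(** An order ideal: a submonoid that is hereditary for the algebraic preorder. *)
Definition oideal (Z : V B -> Prop) : Prop := Z 0 /\ forall u v, Z (u + v) <-> Z u /\ Z v.

Lemma oideal_factor Z e g x y : oideal Z -> idempotent_elt e -> idempotent_elt g ->
  g = x ** e ** y -> Z (cl e) -> Z (cl g).
Proof.
move=> [_ Zadd] ee gg gE; have [w ->] := cl_factor ee gg gE.
by move=> /Zadd[].
Qed.

Lemma emb_proof (b : B) : (fun i j : nat => if (i == 0)%N && (j == 0)%N then b else 0) \in @fin_mx B.
Proof. by apply/asboolP; exists 1%N => -[|i] [|j]. Qed.
Definition emb (b : B) : Minf B := MkMinf (emb_proof b).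

Lemma embM (x y : B) : emb (x ** y) = emb x ** emb y.
Proof.
apply: Minf_ext => i k; rewrite (rmulmE (n := 1%N)).
  by rewrite big_ord1 /=; case: i => [|i]; case: k => [|k] /=; rewrite ?rmul0l ?rmul0r.
by case=> // j _; rewrite /= andbF rmul0l.
Qed.

Lemma embD (x y : B) : emb (x + y) = emb x + emb y.
Proof. by apply: Minf_ext => -[|i] [|k]; rewrite Minf_addE /= ?addr0. Qed.

Lemma emb0 : emb 0 = 0.
Proof. by apply: Minf_ext => -[|i] [|k]. Qed.

Lemma emb_inj : injective emb.
Proof. by move=> x y /(congr1 (fun m : Minf B => m 0%N 0%N)). Qed.

Lemma emb_idem (x : B) : idempotent_elt x -> idempotent_elt (emb x).
Proof. by move=> xx; rewrite /idempotent_elt -embM xx. Qed.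

Lemma emb_mulr (x : B) (m : Minf B) i k :
  (emb x ** m) i k = if i == 0%N then x ** m 0%N k else 0.
Proof.
rewrite (rmulmE (n := 1%N)); last by case=> // j _; rewrite /= andbF rmul0l.
by rewrite big_ord1 /=; case: i => //= i; rewrite rmul0l.
Qed.

Lemma emb_mull (x : B) (m : Minf B) i k :
  (m ** emb x) i k = if k == 0%N then m i 0%N ** x else 0.
Proof.
rewrite (rmulmE (n := 1%N)); last by case=> // j _; rewrite /= rmul0r.
by rewrite big_ord1 /=; case: k => //= k; rewrite rmul0r.
Qed.

Lemma emb_corner (e : B) (m : Minf B) : emb e ** m = m -> m ** emb e = m ->
  m = emb (m 0%N 0%N).
Proof.
move=> em me; apply: Minf_ext => i j /=.
case: i => [|i]; last by rewrite -em emb_mulr.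
case: j => [|j] //=; by rewrite -me emb_mull.
Qed.

(** The summands of [emb e] lie in the corner it cuts out, so they come from [B]: decompositions
    lift to [B] itself and not only to matrices over it. *)
Lemma cl_split_emb (e : B) u v : idempotent_elt e -> cl (emb e) = u + v -> exists a b : B,
  [/\ e = a + b, idempotent_elt a /\ idempotent_elt b,
      a ** b = 0 /\ b ** a = 0 & cl (emb a) = u /\ cl (emb b) = v].
Proof.
move=> ee /(cl_split (emb_idem ee))[a [b [eab [aa bb] [ab ba] [au bv]]]].
have aE : a = emb (a 0%N 0%N).
  by apply: (@emb_corner e); rewrite eab !(rmulDl, rmulDr) ?ab ?ba ?addr0.
have bE : b = emb (b 0%N 0%N).
  by apply: (@emb_corner e); rewrite eab !(rmulDl, rmulDr) ?ab ?ba ?add0r.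
exists (a 0%N 0%N), (b 0%N 0%N); rewrite -aE -bE; split=> //.
- by apply: emb_inj; rewrite embD -aE -bE.
- by split; apply: emb_inj; rewrite embM -?aE -?bE.
- by split; apply: emb_inj; rewrite embM -aE -bE emb0.
Qed.

End Class.

Section NullIdeal.
Variables (R : rngType) (N : R -> Prop).

Definition ideal_pred : Prop :=
  [/\ N 0, forall x y, N x -> N y -> N (x + y),
      forall x y, N x -> N (y ** x) & forall x y, N x -> N (x ** y)].
Hypothesis idN : ideal_pred.

Definition null_mx (g : Minf R) : Prop := forall i j, N (g i j).

Lemma ideal_sum I (r : seq I) (P : pred I) (F : I -> R) :
  (forall i, P i -> N (F i)) -> N (\sum_(i <- r | P i) F i).
Proof. by case: idN => N0 ND _ _ NF; elim/big_ind: _. Qed.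

Lemma null_mx_mull (x g : Minf R) : null_mx g -> null_mx (x ** g).
Proof.
move=> Ng i k; have [n xn] := Minf_bound x.
rewrite (rmulmE (n := n)); last by move=> j nj; rewrite xn ?nj ?orbT// rmul0l.
by apply: ideal_sum => j _; case: idN => _ _ + _; apply.
Qed.

Lemma null_mx_mulr (x g : Minf R) : null_mx g -> null_mx (g ** x).
Proof.
move=> Ng i k; have [n xn] := Minf_bound x.
rewrite (rmulmE (n := n)); last by move=> j nj; rewrite xn ?nj// rmul0r.
by apply: ideal_sum => j _; case: idN => _ _ _; apply.
Qed.

Lemma null_mxD (x y : Minf R) : null_mx x -> null_mx y -> null_mx (x + y).
Proof. by move=> Nx Ny i j; rewrite Minf_addE; case: idN => _ ND _ _; exact: ND. Qed.

(** The order ideal of V(R) attached to [N]. Equivalent idempotents generate the same ideal, so one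
    representative decides: see [nullV_cl]. *)
Definition nullV (v : V R) : Prop := forall g, idempotent_elt g -> v = cl g -> null_mx g.

Lemma nullV_cl g : idempotent_elt g -> nullV (cl g) <-> null_mx g.
Proof.
move=> gg; split=> [|Ng h hh]; first exact.
move=> /(cl_eq gg hh)[x [y [gE hE]]].
rewrite -hh [X in X ** _]hE [X in _ ** X]hE rmulA -(rmulA y x) -gE.
by apply: null_mx_mulr; exact: null_mx_mull.
Qed.

Lemma nullV_oideal : oideal nullV.
Proof.
split.
  rewrite -cl0; apply/nullV_cl; first exact: rmul0l.
  by move=> i j; case: idN.
move=> u v; have [a aa ->] := cl_surj u; have [b bb ->] := cl_surj v.
have saa c : idempotent_elt (spread c a) by exact: spread_idem.
have sbb c : idempotent_elt (spread c b) by exact: spread_idem.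
rewrite (_ : cl a = cl (spread false a)); last by apply/cl_eq => //; exact: spread_equiv.
rewrite (_ : cl b = cl (spread true b)); last by apply/cl_eq => //; exact: spread_equiv.
have st : spread false a ** spread true b = 0 by rewrite spread_mul.
have ts : spread true b ** spread false a = 0 by rewrite spread_mul.
rewrite -clD // !nullV_cl//; last exact: idem_add.
split=> [H|[]]; last exact: null_mxD.
split.
  by have := null_mx_mulr (spread false a) H; rewrite rmulDl ts saa addr0.
by have := null_mx_mulr (spread true b) H; rewrite rmulDl st sbb add0r.
Qed.

End NullIdeal.

Lemma oideal_comp (B R : rngType) (f : {additive V B -> V R}) (Z : V R -> Prop) :
  oideal Z -> oideal (fun v => Z (f v)).
Proof.
move=> [Z0 ZD]; split; first by rewrite raddf0.
by move=> u v; rewrite raddfD; exact: ZD.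
Qed.

(* The common abstraction of regular rings and C*-algebras of real rank 0: J Z is
   the ideal (closed, in the C* case) generated by the idempotents with class in Z. *)
Definition approximable (B : rngType) : Prop :=
  exists J : (V B -> Prop) -> B -> Prop,
  (forall x, exists g : nat -> B,
    (forall n, idempotent_elt (g n) /\ exists u v, g n = u ** x ** v) /\
    forall Z, oideal Z -> (forall n, Z (cl (emb (g n)))) -> J Z x) /\
  forall Z, oideal Z ->
  [/\ forall x y, J Z x -> J Z y -> J Z (x - y),
      forall x y, J Z x -> J Z (y ** x) /\ J Z (x ** y),
      forall e, idempotent_elt e -> J Z e <-> Z (cl (emb e)) &
      (forall e : B, idempotent_elt e -> Z (cl (emb e))) -> forall v, Z v].

(** * Regular rings *)

Section GenIdeal.
Variables (B : rngType) (Z : V B -> Prop).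
Hypothesis oZ : oideal Z.

(** The factors are matrices of arbitrary size, so that one product with one idempotent already
    covers sums of such products. *)
Definition gen_ideal (m : Minf B) : Prop :=
  exists g u v, [/\ idempotent_elt g, Z (cl g) & m = u ** g ** v].

Lemma gen_ideal_idem p : idempotent_elt p -> gen_ideal p <-> Z (cl p).
Proof.
move=> pp; split=> [[g [u [v [gg Zg pE]]]]|Zp]; first exact: oideal_factor pE Zg.
by exists p, p, p; rewrite !pp.
Qed.

Lemma gen_idealMl m x : gen_ideal m -> gen_ideal (x ** m).
Proof.
by move=> [g [u [v [gg Zg ->]]]]; exists g, (x ** u), v; rewrite !rmulA.
Qed.

Lemma gen_idealMr m x : gen_ideal m -> gen_ideal (m ** x).
Proof.
by move=> [g [u [v [gg Zg ->]]]]; exists g, u, (v ** x); rewrite !rmulA.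
Qed.

Lemma gen_idealN m : gen_ideal m -> gen_ideal (- m).
Proof.
by move=> [g [u [v [gg Zg ->]]]]; exists g, (- u), v; rewrite !rmulNl.
Qed.

Lemma gen_ideal0 : gen_ideal 0.
Proof.
exists 0, 0, 0; rewrite !rmul0l cl0; split=> //; [exact: rmul0l|by case: oZ].
Qed.

(** A sum of two products is a row times a block diagonal matrix times a column, the blocks being
    placed on the even and the odd indices. *)
Lemma gen_idealD m m' : gen_ideal m -> gen_ideal m' -> gen_ideal (m + m').
Proof.
move=> [g [u [v [gg Zg ->]]]] [g' [u' [v' [gg' Zg' ->]]]].
have s c : idempotent_elt (spread c g) by exact: spread_idem.
have s' c : idempotent_elt (spread c g') by exact: spread_idem.
have st : spread false g ** spread true g' = 0 by rewrite spread_mul.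
have ts : spread true g' ** spread false g = 0 by rewrite spread_mul.
exists (spread false g + spread true g'), (cspread false u + cspread true u'),
  (rspread false v + rspread true v'); split.
- exact: idem_add.
- rewrite clD //; apply oZ.2; split.
    by rewrite (_ : cl _ = cl g) //; apply/esym/cl_eq => //; exact: spread_equiv.
  by rewrite (_ : cl _ = cl g') //; apply/esym/cl_eq => //; exact: spread_equiv.
have T c d e x y z : cspread c x ** spread d y ** rspread e z
    = if (c == d) && (d == e) then x ** y ** z else 0 :> Minf B.
  rewrite /spread spread_cancel; case: eqP => _; last by rewrite rmul0l.
  by rewrite cspread_mul spread_cancel.
by rewrite !(rmulDl, rmulDr) !T /= !(addr0, add0r).
Qed.

Lemma rshift_proof i (m : Minf B) : (fun k l => if k == i then m 0%N l else 0) \in @fin_mx B.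
Proof.
have [n mn] := Minf_bound m; apply/asboolP; exists (maxn n i.+1) => k l.
rewrite !geq_max => H; case: eqP => // ki; apply: mn.
by move: H; rewrite ki ltnn andbF orFb => /andP[-> _]; rewrite orbT.
Qed.
Definition row_to i m : Minf B := MkMinf (rshift_proof i m).

Lemma cshift_proof j (m : Minf B) : (fun k l => if l == j then m k 0%N else 0) \in @fin_mx B.
Proof.
have [n mn] := Minf_bound m; apply/asboolP; exists (maxn n j.+1) => k l.
rewrite !geq_max => H; case: eqP => // lj; apply: mn.
by move: H; rewrite lj ltnn andbF orbF => /andP[-> _].
Qed.
Definition col_to j m : Minf B := MkMinf (cshift_proof j m).

Lemma row_toE i m k l : row_to i m k l = if k == i then m 0%N l else 0.
Proof. by []. Qed.

Lemma col_toE j m k l : col_to j m k l = if l == j then m k 0%N else 0.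
Proof. by []. Qed.

Lemma row_toM i x y : row_to i (x ** y) = row_to i x ** y.
Proof.
apply: Minf_ext => k l; have [n yn] := Minf_bound y.
have H (u : Minf B) r j : (n <= j)%N -> u r j ** y j l = 0.
  by move=> nj; rewrite yn ?nj// rmul0r.
rewrite row_toE !(rmulmE (n := n)); do ?exact: H.
under [RHS]eq_bigr do rewrite row_toE.
by case: eqP => // _; rewrite big1// => j _; rewrite rmul0l.
Qed.

Lemma col_toM j x y : col_to j (x ** y) = x ** col_to j y.
Proof.
apply: Minf_ext => k l; have [n xn] := Minf_bound x.
have H (u : Minf B) r i : (n <= i)%N -> x k i ** u i r = 0.
  by move=> ni; rewrite xn ?ni ?orbT// rmul0l.
rewrite col_toE !(rmulmE (n := n)); do ?exact: H.
under [RHS]eq_bigr do rewrite col_toE.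
by case: eqP => // _; rewrite big1// => i _; rewrite rmul0r.
Qed.

Definition entry i j (b : B) : Minf B := row_to i (col_to j (emb b)).

Lemma entryE i j b k l : entry i j b k l = if (k == i) && (l == j) then b else 0.
Proof. by rewrite /=; case: eqP => //= _; case: eqP. Qed.

(** [m] is a finite sum of matrices with one entry, and moving the entry out of the corner only
    changes the outer factors [u] and [v]. *)
Lemma gen_ideal_entries (m : Minf B) : (forall i j, gen_ideal (emb (m i j))) -> gen_ideal m.
Proof.
move=> mI; have [n mn] := Minf_bound m.
have sumE (r : seq nat) (F : nat -> Minf B) k l :
    (\sum_(i <- r) F i) k l = \sum_(i <- r) F i k l.
  by elim: r => [|a r IH]; rewrite ?big_nil// !big_cons Minf_addE IH.
have -> : m = \sum_(i <- iota 0 n) \sum_(j <- iota 0 n) entry i j (m i j).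
  apply: Minf_ext => k l; rewrite sumE.
  under eq_bigr do rewrite sumE.
  have [kn|nk] := ltnP k n; last first.
    rewrite mn ?nk// big_seq big1 // => i; rewrite mem_iota add0n => /andP[_ iln].
    by rewrite big1// => j _; rewrite entryE; case: eqP nk => // ->; rewrite leqNgt iln.
  have [ln|nl] := ltnP l n; last first.
    rewrite mn ?nl ?orbT// big1// => i _; rewrite big_seq big1 // => j.
    rewrite mem_iota add0n => /andP[_ jln].
    by rewrite entryE; case: (l =P j) nl => [->|_ _]; rewrite ?andbF// leqNgt jln.
  rewrite (bigD1_seq k) ?iota_uniq ?mem_iota//= (bigD1_seq l) ?iota_uniq ?mem_iota//=.
  rewrite !eqxx /= !big1 ?addr0// => [i|j] ik.
    by rewrite big1// => j _; rewrite eq_sym (negbTE ik).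
  by rewrite eq_sym (negbTE ik).
elim/big_ind: _ => [|x y|i _]; [exact: gen_ideal0|exact: gen_idealD|].
elim/big_ind: _ => [|x y|j _]; [exact: gen_ideal0|exact: gen_idealD|].
have [g [u [v [gg Zg mE]]]] := mI i j.
exists g, (row_to i u), (col_to j v); split=> //.
by rewrite /entry mE col_toM !row_toM.
Qed.

End GenIdeal.

(** If [x ** y ** x = x], the idempotent [x ** y] generates the same ideal as [x], so a constant
    sequence will do. Applied to the entries of an idempotent matrix, this also gives the last
    clause. *)
Lemma regular_approximable (B : rngType) : regular_ring B -> approximable B.
Proof.
move=> regB; exists (fun Z x => gen_ideal Z (emb x)); split.
  move=> x; have [y xyx] := regB x.
  have gg : idempotent_elt (x ** y) by rewrite /idempotent_elt rmulA xyx.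
  exists (fun=> x ** y); split=> [n|Z oZ /(_ 0%N) Zg].
    by split=> //; exists (x ** y), y; rewrite xyx.
  by rewrite -xyx embM; apply/gen_idealMr/(gen_ideal_idem oZ _) => //; exact: emb_idem.
move=> Z oZ; split.
- move=> x y Jx Jy; rewrite (_ : emb (x - y) = emb x - emb y).
    by apply: gen_idealD => //; exact: gen_idealN.
  by apply/esym/eqP; rewrite subr_eq -embD subrK.
- by move=> x y Jx; rewrite !embM; split; [exact: gen_idealMl|exact: gen_idealMr].
- by move=> e ee; apply: gen_ideal_idem => //; exact: emb_idem.
move=> allZ v; have [a aa ->] := cl_surj v.
apply/(gen_ideal_idem oZ aa)/gen_ideal_entries => // i j.
have [y xyx] := regB (a i j); rewrite -xyx embM; apply: gen_idealMr.
have gg : idempotent_elt (a i j ** y) by rewrite /idempotent_elt rmulA xyx.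
by apply/gen_ideal_idem => //; [exact: emb_idem|exact: allZ].
Qed.

(** * C*-algebras of real rank 0 *)

Local Open Scope complex_scope.

(** These instances let [non_commutative_ring] prove identities in the rings used here. *)
#[local] Instance pzring_ops (A : pzRingType) : @Ncring.Ring_ops A 0 1 +%R *%R (fun x y => x - y) -%R eq := {}.

#[local] Instance pzring_ring (A : pzRingType) : Ncring.Ring (Ro := pzring_ops A).
Proof.
split; try by [exact: RelationClasses.eq_equivalence | move=> ? ? -> ? ? -> | move=> ? ? ->].
- exact: add0r.
- exact: addrC.
- exact: addrA.
- exact: mul1r.
- exact: mulr1.
- exact: mulrA.
- exact: mulrDl.
- by move=> x y z; exact: mulrDr.
- by [].
- exact: subrr.
Qed.

(* [nle x e] reads: the norm of x is at most e. An algebra and its unitization, whose norm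
   is only given by such bounds, can then be treated alike. *)
Record norm_bound (F : realType) (V : zmodType) (nle : V -> F -> Prop) : Prop := NormBound {
  nleW : forall x e e', nle x e -> e <= e' -> nle x e';
  nleD : forall x y e e', nle x e -> nle y e' -> nle (x + y) (e + e');
  nleN : forall x e, nle x e -> nle (- x) e;
  nle_sep : forall x, (forall e, 0 < e -> nle x e) -> x = 0;
  nle_complete : forall (u : nat -> V) (c r : F), 0 <= r -> r < 1 ->
    (forall n, nle (u n.+1 - u n) (c * r ^+ n)) ->
    exists l, forall e, 0 < e -> exists N, forall n, (N <= n)%N -> nle (u n - l) e
}.

Section Contraction.
Variables (F : realType) (V : zmodType) (nle : V -> F -> Prop).
Hypothesis nb : norm_bound nle.

Definition is_lim (u : nat -> V) (l : V) : Prop :=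
  forall e, 0 < e -> exists n, nle (u n - l) e.

(** The closed set [P] carries over to the fixed point what holds along the iteration, such as
    self-adjointness, a norm bound or commutation; the contraction estimate is asked only inside
    [P]. *)
Lemma contraction_fixpoint (T : V -> V) (P : V -> Prop) (r c : F) :
  0 <= r -> r < 1 -> nle (T 0) c -> P 0 -> (forall x, P x -> P (T x)) ->
  (forall x y e, P x -> P y -> nle (x - y) e -> nle (T x - T y) (r * e)) ->
  (forall u l, (forall n, P (u n)) -> is_lim u l -> P l) ->
  exists2 l, P l & T l = l.
Proof.
move=> r0 r1 Tc P0 PT contr closed.
pose u n := iter n T 0.
have Pu n : P (u n) by elim: n => //= n; exact: PT.
have du n : nle (u n.+1 - u n) (c * r ^+ n).
  elim: n => [|n IH]; first by rewrite /u /= subr0 expr0 mulr1.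
  by rewrite exprS mulrCA; exact: (contr _ _ _ (Pu n.+1) (Pu n) IH).
have [l ul] := nle_complete nb r0 r1 du.
have Pl : P l.
  apply: (closed u l Pu); rewrite /is_lim => e e0; have [N uN] := ul e e0; exists N; exact: (uN _ (leqnn N)).
exists l => //; apply/eqP; rewrite -subr_eq0; apply/eqP/(nle_sep nb) => e e0.
have e2 : 0 < e / 2 by rewrite divr_gt0.
have [N uN] := ul _ e2.
rewrite -(subrK (u N.+1) (T l)) -addrA (splitr e); apply: (nleD nb).
  apply: (nleW nb (e := r * (e / 2))); last by rewrite ler_piMl ?ltW.
  apply: contr => //; rewrite -opprB; apply/(nleN nb)/uN; exact: leqnn.
by apply: uN.
Qed.

End Contraction.

Record cstar_bound (F : realType) (A : algType F[i]) (star : A -> A) (nle : A -> F -> Prop) :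
    Prop := CstarBound {
  cb_norm :> norm_bound nle;
  nle_ge0 : forall x e, nle x e -> 0 <= e;
  nle_bound : forall x, exists e, nle x e;
  nle1 : nle 1 1;
  nleM : forall x y e e', nle x e -> nle y e' -> nle (x * y) (e * e');
  nleZ : forall (t : F) x e, nle x e -> nle (t%:C *: x) (`|t| * e);
  nlei : forall x e, nle x e -> nle ('i%C *: x) e;
  nle_closed : forall x e, (forall d, 0 < d -> nle x (e + d)) -> nle x e;
  nle_star : forall x e, nle x e -> nle (star x) e;
  nle_cstar : forall x e, 0 <= e -> nle (star x * x) (e ^+ 2) -> nle x e;
  cstarK : involutive star;
  cstarD : {morph star : x y / x + y};
  cstarM : forall x y, star (x * y) = star y * star x;
  cstarZ : forall (t : F) x, star (t%:C *: x) = t%:C *: star x;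
  cstari : forall x, star ('i%C *: x) = - ('i%C *: star x)
}.

(** * Square roots, polar decompositions and approximating projections in a unital C*-algebra *)

Section CstarCalculus.
Variables (F : realType) (A : algType F[i]) (star : A -> A) (nle : A -> F -> Prop).
Hypothesis cb : cstar_bound star nle.
Implicit Types (x y z b c d h q s : A) (e t M : F).

Local Notation "t *| x" := (t%:C *: x) (at level 40).
Let nb := cb_norm cb.
Let nleW := nleW nb.
Let nleD := nleD nb.
Let nleN := nleN nb.
Let nleM := nleM cb.
Let nleZ := nleZ cb.

Lemma nleB x y e e' : nle x e -> nle y e' -> nle (x - y) (e + e').
Proof. by move=> xe ye; apply: nleD => //; exact: nleN. Qed.

Lemma nleZp t x e : 0 <= t -> nle x e -> nle (t *| x) (t * e).
Proof. by move=> t0 /(nleZ t); rewrite ger0_norm. Qed.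

Lemma rscaleM t t' x : t *| (t' *| x) = (t * t') *| x.
Proof. by rewrite scalerA rmorphM. Qed.

Lemma rscale1 x : 1 *| x = x.
Proof. by rewrite rmorph1 scale1r. Qed.

Lemma rscaleK t x : t != 0 -> t^-1 *| (t *| x) = x.
Proof. by move=> t0; rewrite rscaleM mulVf// rscale1. Qed.

Lemma rscaleKV t x : t != 0 -> t *| (t^-1 *| x) = x.
Proof. by move=> t0; rewrite rscaleM mulfV// rscale1. Qed.

Lemma rscaleDl t t' x : (t + t') *| x = t *| x + t' *| x.
Proof. by rewrite rmorphD scalerDl. Qed.

Lemma rscale2 x : 2 *| x = x + x.
Proof. by rewrite rmorphMn rmorph1 scaler_nat mulr2n. Qed.

Lemma cstarB x y : star (x - y) = star x - star y.
Proof.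
by apply/eqP; rewrite eq_sym subr_eq -(cstarD cb) subrK.
Qed.

Lemma cstar1 : star 1 = 1.
Proof. by rewrite -[LHS]mulr1 -{2}(cstarK cb 1) -(cstarM cb) mulr1 (cstarK cb). Qed.

Lemma closed_nle u l e : (forall n, nle (u n) e) -> is_lim nle u l -> nle l e.
Proof.
move=> ue ul; apply: (nle_closed cb) => d d0; have [n und] := ul d d0.
by rewrite -(subKr (u n) l); apply: nleB.
Qed.

Lemma closed_sa u l : (forall n, star (u n) = u n) -> is_lim nle u l -> star l = l.
Proof.
move=> us ul; apply/eqP; rewrite -subr_eq0; apply/eqP/(nle_sep nb) => e e0.
have [n und] := ul (e / 2) (divr_gt0 e0 (ltr0Sn _ _)).
rewrite (_ : star l - l = (u n - l) - star (u n - l)).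
  by rewrite (splitr e); apply: nleB => //; exact: (nle_star cb).
by rewrite cstarB us; Ncring_tac.non_commutative_ring.
Qed.

Lemma closed_comm u l c : (forall n, c * u n = u n * c) -> is_lim nle u l -> c * l = l * c.
Proof.
move=> uc ul; apply/eqP; rewrite -subr_eq0; apply/eqP/(nle_sep nb) => e e0.
have [k ck] := nle_bound cb c; have k0 := nle_ge0 cb ck.
have k1 : 0 < 2 * (k + 1) by lra.
pose d := e / (2 * (k + 1)); have d0 : 0 < d by rewrite divr_gt0.
have de : d * (2 * (k + 1)) = e by rewrite divfK// gt_eqF.
have [n und] := ul _ d0.
rewrite (_ : c * l - l * c = (u n - l) * c - c * (u n - l)).
  by apply: (nleW (nleB (nleM und ck) (nleM ck und))); rewrite -de; lra.
by rewrite mulrBl mulrBr uc; Ncring_tac.non_commutative_ring.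
Qed.

(** [s = 1 - l] for the fixed point [l = (z + l^2) / 2], an equation equivalent to
    [(1 - l)^2 = 1 - z]. The ball of radius [e] is preserved and the map contracts it by the factor
    [e]. *)
Lemma sqrt_one_sub z e : nle z e -> e < 1 -> star z = z -> exists s,
  [/\ star s = s, s * s = 1 - z, nle (1 - s) e & forall c, c * z = z * c -> c * s = s * c].
Proof.
move=> ze e1 zs; have e0 := nle_ge0 cb ze.
pose T y := 2^-1 *| (z + y * y).
pose P y := [/\ nle y e, star y = y & forall c, c * z = z * c -> c * y = y * c].
have nle0 : nle 0 e.
  by apply: (nleW (e := 0)) => //; have := nleZ 0 ze; rewrite rmorph0 scale0r normr0 mul0r.
have [|||x y d Px Py xyd|u l Pu ul|l [le ls lc] Tl] := @contraction_fixpoint _ _ _ nb T P e (2^-1 * e) e0 e1.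
- by rewrite /T mulr0 addr0; apply: nleZp.
- split=> //; first by rewrite -(subrr z) cstarB zs.
  by move=> c; rewrite mulr0 mul0r.
- move=> y [ye ys yc]; split.
  + have half : 0 <= 2^-1 :> F by rewrite invr_ge0.
    by apply: (nleW (nleZp half (nleD ze (nleM ye ye)))); nra.
  + by rewrite (cstarZ cb) (cstarD cb) (cstarM cb) zs ys.
  + move=> c cz; rewrite -scalerAr -scalerAl mulrDr mulrDl cz.
    by rewrite mulrA (yc _ cz) -mulrA (yc _ cz) mulrA.
- rewrite /T -scalerBr opprD addrACA subrr add0r.
  rewrite (_ : x * x - y * y = x * (x - y) + (x - y) * y); last first.
    by rewrite mulrBr mulrBl addrA subrK.
  have [xe _ _] := Px; have [ye _ _] := Py.
  have half : 0 <= 2^-1 :> F by rewrite invr_ge0.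
  by apply: (nleW (nleZp half (nleD (nleM xe xyd) (nleM xyd ye)))); lra.
- split.
  + by apply: closed_nle ul => n; case: (Pu n).
  + by apply: closed_sa ul => n; case: (Pu n).
  + by move=> c cz; apply: closed_comm ul => n; case: (Pu n) => _ _; apply.
exists (1 - l); split.
- by rewrite cstarB cstar1 ls.
- have ll : l * l = l + l - z by rewrite -rscale2 -[X in 2 *| X]Tl /T rscaleKV ?[z + _]addrC ?addrK.
  rewrite (_ : _ * _ = 1 - (l + l) + l * l); last by Ncring_tac.non_commutative_ring.
  by rewrite ll; Ncring_tac.non_commutative_ring.
- by rewrite opprB addrCA subrr addr0.
- by move=> c /lc cl; rewrite mulrBl mulrBr cl mul1r mulr1.
Qed.

Lemma neumann z e : nle z e -> e < 1 -> exists v, v = 1 + z * v.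
Proof.
move=> ze e1; have e0 := nle_ge0 cb ze.
have [|||||v _ vE] := @contraction_fixpoint _ _ _ nb (fun v => 1 + z * v) (fun=> True) e 1 e0 e1 => //.
- by rewrite mulr0 addr0; exact: (nle1 cb).
- move=> x y d _ _ xyd; rewrite opprD addrACA subrr add0r -mulrBr.
  exact: nleM.
by exists v.
Qed.

Lemma unitary_nle u : star u * u = 1 -> nle u 1.
Proof. by move=> uu; apply: (nle_cstar cb) => //; rewrite uu expr1n; exact: (nle1 cb). Qed.

Lemma halfE x : 2^-1 *| (x + x) = x.
Proof. by rewrite -rscale2 rscaleK. Qed.

(** [2 q - 1] is a self-adjoint unitary, and [q] is its mean with 1. *)
Lemma proj_nle q : star q = q -> q * q = q -> nle q 1.
Proof.
move=> qs qq; pose u := q + q - 1.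
have us : star u = u by rewrite cstarB (cstarD cb) qs cstar1.
have uu : star u * u = 1.
  pose v := q * q - q; rewrite us (_ : u * u = v + v + v + v + 1).
    by rewrite /v qq subrr !add0r.
  by rewrite /u /v; Ncring_tac.non_commutative_ring.
have -> : q = 2^-1 *| (u + 1) by rewrite /u subrK halfE.
have half : 0 <= 2^-1 :> F by rewrite invr_ge0.
apply: (nleW (nleZp half (nleD (unitary_nle uu) (nle1 cb)))); lra.
Qed.

Lemma ii_scale x : 'i%C *: ('i%C *: x) = - x.
Proof. by rewrite scalerA -expr2 sqr_i scaleN1r. Qed.

(** With [s] the square root of [1 - b^2], the element [u = b + i s] is unitary; hence its imaginary
    part [s] has norm at most 1, and so has [s^2]. *)
Lemma sa_sq_le b e : star b = b -> nle b e -> e < 1 -> nle (1 - b * b) 1.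
Proof.
move=> bs be e1; have e0 := nle_ge0 cb be.
have be2 := nleM be be.
have [||s [ss sE _ sc]] := sqrt_one_sub be2; first by nra.
  by rewrite (cstarM cb) bs.
have bsc : b * s = s * b by apply: sc; rewrite mulrA.
pose u := b + 'i%C *: s.
have us : star u = b - 'i%C *: s by rewrite (cstarD cb) bs (cstari cb) ss.
have uu : star u * u = 1.
  rewrite us mulrDr !mulrBl -!scalerAl -!scalerAr ii_scale bsc sE.
  by Ncring_tac.non_commutative_ring.
have u1 := unitary_nle uu.
have half : 0 <= 2^-1 :> F by rewrite invr_ge0.
have s1 : nle s 1.
  have H := nlei cb (nleZp half (nleB (nle_star cb u1) u1)).
  move: H; rewrite us /u opprD addrACA subrr add0r -opprD scalerN -rscale2 rscaleK // scalerN.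
  rewrite ii_scale opprK => H; apply: (nleW H); lra.
by have := nleM s1 s1; rewrite sE mulr1.
Qed.

(** [sa_sq_le] is applied to [b s] instead of [b], where [s^2 = 1 - mu (c^2 - 1)]. Then
    [1 - (b s)^2 = (1 + mu) (1 - b^2)], and dividing by [1 + mu] gains the strict inequality. *)
Lemma inv_sq_lt1 b c e : star b = b -> b * c = 1 -> c * b = 1 -> nle b e -> e < 1 ->
  exists2 r, r < 1 & nle (1 - b * b) r.
Proof.
move=> bs bc cb1 be e1; have e0 := nle_ge0 cb be.
have cs : star c = c.
  by rewrite -[LHS]mulr1 -bc mulrA -{1}bs -(cstarM cb) bc cstar1 mul1r.
have [k ck] := nle_bound cb (c * c - 1); have k0 := nle_ge0 cb ck.
(* [th] is small enough for [b s], of norm at most [e (1 + th)], to keep norm less than 1; then [mu]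
   is small enough for [z] to have norm at most [th]. *)
pose th := (1 - e) / 2; have th0 : 0 < th by rewrite divr_gt0// subr_gt0.
have the : e * (1 + th) < 1 by rewrite /th; nra.
have th1 : th < 1 by rewrite /th; lra.
pose mu := th / (k + 1); have k1 : 0 < k + 1 by lra.
have mu0 : 0 < mu by rewrite divr_gt0.
have muk : mu * (k + 1) = th by rewrite divfK// gt_eqF.
pose z := mu *| (c * c - 1).
have zth : nle z th by apply: (nleW (nleZp (ltW mu0) ck)); rewrite -muk; nra.
have zs : star z = z by rewrite (cstarZ cb) cstarB (cstarM cb) cs cstar1.
have bz : b * z = z * b.
  rewrite -scalerAl -scalerAr mulrBr mulrBl mulrA bc -mulrA cb1.
  by rewrite !(mul1r, mulr1).
have [s [ss sE s1 sc]] := sqrt_one_sub zth th1 zs.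
have bsc := sc _ bz.
have bb : star (b * s) = b * s by rewrite (cstarM cb) ss bs bsc.
have nbs : nle (b * s) (e * (1 + th)).
  by apply: nleM => //; rewrite -(subKr 1 s); apply: nleB => //; exact: (nle1 cb).
have H := sa_sq_le bb nbs the.
have E : 1 - b * s * (b * s) = (1 + mu) *| (1 - b * b).
  have bbcc : b * b * (c * c) = 1 by rewrite mulrA -(mulrA b b) bc mulr1 bc.
  rewrite mulrA -(mulrA b s b) -bsc mulrA -(mulrA _ s s) sE /z mulrBr mulr1.
  rewrite -scalerAr mulrBr bbcc mulr1 rscaleDl rscale1.
  by Ncring_tac.non_commutative_ring.
have mu1 : 0 < 1 + mu by lra.
exists (1 + mu)^-1; first by rewrite invf_lt1//; lra.
rewrite -(rscaleK (1 - b * b) (lt0r_neq0 mu1)) -E -[X in nle _ X]mulr1.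
by apply: nleZp => //; rewrite invr_ge0 ltW.
Qed.

(** [h] is the absolute value of [b], the square root of [1 - (1 - b^2)], and [s = c h] is the sign
    of [b]. *)
Lemma polar_small b c e : star b = b -> b * c = 1 -> c * b = 1 -> nle b e -> e < 1 ->
  exists s h, [/\ star s = s /\ s * s = 1, star h = h, s * b = h /\ b * s = h,
    s * h = b /\ h * s = b & nle (1 - h) 1].
Proof.
move=> bs bc cb1 be e1; have [r r1 br] := inv_sq_lt1 bs bc cb1 be e1.
have cs : star c = c.
  by rewrite -[LHS]mulr1 -bc mulrA -{1}bs -(cstarM cb) bc cstar1 mul1r.
have zs : star (1 - b * b) = 1 - b * b by rewrite cstarB (cstarM cb) bs cstar1.
have [h [hs hE h1 hc]] := sqrt_one_sub br r1 zs.
have {}hE : h * h = b * b by rewrite hE subKr.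
have bh : b * h = h * b by apply: hc; rewrite mulrBr mulrBl mulr1 mul1r mulrA.
have ch : c * h = h * c.
  by apply: hc; rewrite mulrBr mulrBl mulr1 mul1r mulrA cb1 mul1r -mulrA bc mulr1.
exists (c * h), h; split=> //.
- split; first by rewrite (cstarM cb) hs cs ch.
  by rewrite {2}ch -mulrA (mulrA h h) hE -mulrA bc mulr1 cb1.
- by split; [rewrite -mulrA -bh mulrA cb1 mul1r|rewrite mulrA bc mul1r].
- by split; [rewrite -mulrA hE mulrA cb1 mul1r|rewrite ch mulrA hE -mulrA bc mulr1].
- by apply: (nleW h1); exact: ltW.
Qed.

(** [g = (1 + s) / 2] is the spectral projection of [b] for the positive half-line, and [h] is the
    absolute value, whose positivity is the last bound. The factor [t] brings [b] to norm less than
    1. *)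
Lemma polar b c : star b = b -> b * c = 1 -> c * b = 1 ->
  exists g h M, [/\ star g = g /\ g * g = g, star h = h, g * b = g * h /\ b * g = h * g,
    (1 - g) * b = - ((1 - g) * h) /\ g * h = h * g & nle (M *| 1 - h) M].
Proof.
move=> bs bc cb1; have [m bm] := nle_bound cb b; have m0 := nle_ge0 cb bm.
pose t := (2 * (m + 1))^-1; have m1 : 0 < 2 * (m + 1) by lra.
have t0 : 0 < t by rewrite invr_gt0.
have tn := lt0r_neq0 t0.
have tb1 : t * m < 1 by rewrite mulrC /t ltr_pdivrMr//; lra.
have tb := nleZp (ltW t0) bm.
have [|||s [h [[ss s2] hs [sb bsh] [sh hsb] h1]]] := polar_small _ _ _ tb tb1 (c := t^-1 *| c).
- by rewrite (cstarZ cb) bs.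
- by rewrite -scalerAl -scalerAr bc rscaleKV.
- by rewrite -scalerAl -scalerAr cb1 rscaleK.
pose g := 2^-1 *| (1 + s); pose h' := t^-1 *| h.
have sb' : s * b = h' by rewrite /h' -sb -scalerAr rscaleK.
have bs' : b * s = h' by rewrite /h' -bsh -scalerAl rscaleK.
have sh' : s * h' = b by rewrite /h' -scalerAr sh rscaleK.
have hs' : h' * s = b by rewrite /h' -scalerAl hsb rscaleK.
have g1 x : g * x = 2^-1 *| (x + s * x) by rewrite /g -scalerAl mulrDl mul1r.
have g2 x : x * g = 2^-1 *| (x + x * s) by rewrite /g -scalerAr mulrDr mulr1.
exists g, h', t^-1; split.
- split; first by rewrite (cstarZ cb) (cstarD cb) cstar1 ss.
  by rewrite g1 g2 s2 [s + 1]addrC -/g halfE.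
- by rewrite (cstarZ cb) hs.
- by rewrite !g1 !g2 sb' bs' sh' hs' [b + _]addrC.
- split; last by rewrite g1 g2 sh' hs'.
  rewrite !mulrBl !mul1r !g1 sb' sh' opprB.
  rewrite [h' + b]addrC; set w := _ *| _; apply/eqP; rewrite -subr_eq0.
  rewrite (_ : b - w - (w - h') = b + h' - (w + w)); last by Ncring_tac.non_commutative_ring.
  by rewrite -scalerDr halfE subrr.
- rewrite -scalerBr -[X in nle _ X]mulr1; apply: nleZp => //.
  by rewrite invr_ge0 ltW.
Qed.

(** [d + e q] is [M + e] times [q - z], where [z] has norm at most [M / (M + e)]. The term [e q]
    makes this less than 1, as [sqrt_one_sub] requires. *)
Lemma corner_sqrt q d M e : star q = q -> q * q = q -> star d = d -> q * d = d -> d * q = d ->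
  nle (M *| q - d) M -> 0 < e ->
  exists k, [/\ star k = k, k * k = d + e *| q &
    forall c, c * q = q * c -> c * d = d * c -> c * k = k * c].
Proof.
move=> qs qq ds qd dq dM e0; have M0 := nle_ge0 cb dM.
have Me : 0 < M + e by lra.
have Men := lt0r_neq0 Me.
pose z := (M + e)^-1 *| (M *| q - d).
have iMe : 0 <= (M + e)^-1 by rewrite invr_ge0 ltW.
have zM := nleZp iMe dM; rewrite -/z in zM.
have z1 : (M + e)^-1 * M < 1 by rewrite mulrC ltr_pdivrMr//; lra.
have zs : star z = z by rewrite (cstarZ cb) cstarB (cstarZ cb) qs ds.
have [s [ss sE _ sc]] := sqrt_one_sub zM z1 zs.
have zc c : c * q = q * c -> c * d = d * c -> c * z = z * c.
  by move=> cq cd; rewrite /z -scalerAr -scalerAl mulrBr mulrBl -scalerAr -scalerAl cq cd.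
have qz : q * z = z by rewrite /z -scalerAr mulrBr -scalerAr qq qd.
have qs_c : q * s = s * q by apply/sc/zc => //; rewrite qd dq.
pose t := Num.sqrt (M + e).
have tt : t * t = M + e by rewrite -expr2 sqr_sqrtr// ltW.
exists (t *| (q * s)); split.
- by rewrite (cstarZ cb) (cstarM cb) qs ss qs_c.
- rewrite -scalerAl -scalerAr rscaleM tt mulrA -(mulrA q s q) -qs_c (mulrA q q s) qq -mulrA sE.
  rewrite mulrBr mulr1 qz scalerBr /z rscaleKV // rscaleDl.
  by Ncring_tac.non_commutative_ring.
- move=> c cq cd; rewrite -scalerAl -scalerAr mulrA cq -mulrA (sc _ (zc _ cq cd)).
  by rewrite mulrA.
Qed.

(** The two bounds say that [0 <= d <= N q]. If [k] and [l] are square roots of [d + e q] and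
    [N q - d + e q], then [w = k + i l] has [(star w) w = (N + 2 e) q]. So its real part [k] has
    norm at most the square root of [N + 2 e], and [d = k^2 - e q] has norm at most [N + 3 e]. *)
Lemma corner_bound q d N M M' : star q = q -> q * q = q -> star d = d ->
  q * d = d -> d * q = d -> 0 <= N ->
  nle (M *| q - d) M -> nle (M' *| q - (N *| q - d)) M' -> nle d N.
Proof.
move=> qs qq ds qd dq N0 dM dM'; have q1 := proj_nle qs qq.
apply: (nle_closed cb) => e3 e30; pose e := e3 / 3.
have e0 : 0 < e by rewrite divr_gt0.
pose d' := N *| q - d.
have d's : star d' = d' by rewrite cstarB (cstarZ cb) qs ds.
have qd' : q * d' = d' by rewrite mulrBr -scalerAr qq qd.
have d'q : d' * q = d' by rewrite mulrBl -scalerAl qq dq.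
have [k [ks kE kc]] := corner_sqrt qs qq ds qd dq dM e0.
have [l [ls lE lc]] := corner_sqrt qs qq d's qd' d'q dM' e0.
have kl : k * l = l * k.
  apply/esym/kc.
    by apply/esym/lc => //; rewrite qd' d'q.
  by apply/esym/lc; rewrite ?qd ?dq// /d' mulrBr mulrBl -scalerAr -scalerAl qd dq.
pose w := k + 'i%C *: l.
have ws : star w = k - 'i%C *: l by rewrite (cstarD cb) ks (cstari cb) ls.
have N2 : 0 <= N + 2 * e by lra.
pose t := Num.sqrt (N + 2 * e); have t0 : 0 <= t by exact: sqrtr_ge0.
have tt : t * t = N + 2 * e by rewrite -expr2 sqr_sqrtr.
have ww : star w * w = (N + 2 * e) *| q.
  rewrite ws mulrDr !mulrBl -!scalerAl -!scalerAr ii_scale kl kE lE /d'.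
  rewrite rscaleDl (_ : (2 * e) *| q = e *| q + e *| q); last by rewrite -rscale2 rscaleM.
  by Ncring_tac.non_commutative_ring.
have wt : nle w t.
  apply: (nle_cstar cb) => //; rewrite ww expr2 tt -[X in nle _ X]mulr1.
  exact: nleZp.
have half : 0 <= 2^-1 :> F by rewrite invr_ge0.
have kt : nle k t.
  have H := nleZp half (nleD wt (nle_star cb wt)).
  move: H; rewrite ws /w addrACA subrr addr0 halfE => H; apply: (nleW H); lra.
have := nleB (nleM kt kt) (nleZp (ltW e0) q1); rewrite kE tt addrK => H.
by apply: (nleW H); rewrite /e; lra.
Qed.

Definition sa_invertible_dense : Prop := forall a, star a = a -> forall e, 0 < e ->
  exists b c, [/\ star b = b, b * c = 1, c * b = 1 & nle (a - b) e].

Hypothesis dense : sa_invertible_dense.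

(** [g] is the positive spectral projection of an invertible [b] close to [a^2 - e1]. On the
    complement of [g], [a^2] is at most [e1 + dl], which bounds [(1 - g) a]; on [g] it is at least
    [e1 - dl], so [g a^2 g] is invertible in the corner of [g], and [g] gets the form [u a v]. *)
Lemma sa_approx_proj a e : star a = a -> 0 < e ->
  exists g u v, [/\ star g = g, g * g = g, g = u * a * v & nle ((1 - g) * a) e].
Proof.
(* The constants are chosen so that [e1 + dl <= e^2] and [dl < e1]. *)
move=> as_ e0; pose e1 := e ^+ 2 / 2; have e10 : 0 < e1 by rewrite divr_gt0// exprn_gt0.
pose dl := e1 / 2; have dl0 : 0 < dl by rewrite divr_gt0.
have AAs : star (a * a - e1 *| 1) = a * a - e1 *| 1.
  by rewrite cstarB (cstarM cb) as_ (cstarZ cb) cstar1.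
have [b [c [bs bc cb1 abd]]] := dense AAs dl0.
have [E EE] : {E | E = a * a - e1 *| 1 - b} by exists (a * a - e1 *| 1 - b).
rewrite -EE in abd.
have AE : a * a = e1 *| 1 + b + E by rewrite EE; Ncring_tac.non_commutative_ring.
have [g [h [M [[gs gg] hs [gb bg] [qb gh] hM]]]] := polar bs bc cb1.
have M0 := nle_ge0 cb hM; have g1 := proj_nle gs gg.
have [q qE] : {q | q = 1 - g} by exists (1 - g).
rewrite -qE in qb.
have qs : star q = q by rewrite qE cstarB cstar1 gs.
have qq : q * q = q by rewrite qE mulrBr mulr1 mulrBl mul1r gg subrr subr0.
have q1 := proj_nle qs qq.
have qh : q * h = h * q by rewrite qE mulrBl mulrBr mul1r mulr1 gh.
pose d := q * (a * a) * q.
have ds : star d = d by rewrite /d !(cstarM cb) as_ qs !mulrA.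
have qd : q * d = d by rewrite /d !mulrA qq.
have dq : d * q = d by rewrite /d -!mulrA qq.
have [m am] := nle_bound cb a; have m0 := nle_ge0 cb am.
pose t := (2 * (m + 1))^-1; have m1 : 0 < 2 * (m + 1) by lra.
have t0 : 0 < t by rewrite invr_gt0.
have tm : t * m < 1 by rewrite mulrC /t ltr_pdivrMr//; lra.
have tas : star (t *| a) = t *| a by rewrite (cstarZ cb) as_.
have ta := sa_sq_le tas (nleZp (ltW t0) am) tm.
have t20 : 0 < t * t by rewrite mulr_gt0.
have t2n := lt0r_neq0 t20.
(* Positivity of [d]: [sa_sq_le] gives it for [a^2], after [t] has scaled [a] to norm less than 1,
   and compression by [q] preserves it. *)
have dM : nle ((t * t)^-1 *| q - d) (t * t)^-1.
  have H : nle ((t * t)^-1 *| 1 - a * a) (t * t)^-1.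
    have it : 0 <= (t * t)^-1 by rewrite invr_ge0 ltW.
    have := nleZp it ta.
    by rewrite mulr1 -scalerAl -scalerAr rscaleM scalerBr rscaleK.
  have -> : (t * t)^-1 *| q - d = q * ((t * t)^-1 *| 1 - a * a) * q.
    by rewrite mulrBr mulrBl -scalerAr mulr1 -scalerAl qq.
  by have := nleM (nleM q1 H) q1; rewrite mulr1 mul1r.
have hM2 x : nle x 1 -> nle (x * (M *| 1 - h)) M.
  by move=> x1; have := nleM x1 hM; rewrite mul1r.
have dN : nle d (e1 + dl).
  apply: (@corner_bound q d (e1 + dl) (t * t)^-1 (M + dl) qs qq ds qd dq _ dM); first lra.
  have -> : (M + dl) *| q - ((e1 + dl) *| q - d) = q * (M *| 1 - h) + q * E * q.
    have qbq : q * b * q = - (q * h) by rewrite qb mulNr -mulrA -qh mulrA qq.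
    have dE : d = e1 *| q - q * h + q * E * q.
      by rewrite /d AE !mulrDr !mulrDl qbq -scalerAr mulr1 -scalerAl qq.
    rewrite dE !rscaleDl mulrBr -scalerAr mulr1.
    by Ncring_tac.non_commutative_ring.
  apply: nleD; first exact: hM2.
  by have := nleM (nleM q1 abd) q1; rewrite mul1r mulr1.
have qa : nle (q * a) e.
  have -> : q * a = star (a * q) by rewrite (cstarM cb) qs as_.
  apply/(nle_star cb)/(nle_cstar cb); first exact: ltW.
  rewrite (cstarM cb) qs as_ (_ : q * a * (a * q) = d); last by rewrite /d !mulrA.
  by apply: (nleW dN); rewrite /dl /e1; have := exprn_gt0 2 e0; lra.
pose x := g * (a * a) * g.
have gx : g * x = x by rewrite /x !mulrA gg.
have Me1 : 0 < M + e1 by lra.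
have Me1n := lt0r_neq0 Me1.
pose z := (M + e1)^-1 *| ((M + e1) *| g - x).
have iMe : 0 <= (M + e1)^-1 by rewrite invr_ge0 ltW.
have xM : nle ((M + e1) *| g - x) (M + dl).
  have -> : (M + e1) *| g - x = g * (M *| 1 - h) - g * E * g.
    have gbg : g * b * g = g * h by rewrite gb -mulrA -gh mulrA gg.
    have xE : x = e1 *| g + g * h + g * E * g.
      by rewrite /x AE !mulrDr !mulrDl gbg -scalerAr mulr1 -scalerAl gg.
    rewrite xE !rscaleDl mulrBr -scalerAr mulr1.
    by Ncring_tac.non_commutative_ring.
  apply: nleB; first exact: hM2.
  by have := nleM (nleM g1 abd) g1; rewrite mul1r mulr1.
have zM := nleZp iMe xM; rewrite -/z in zM.
have z1 : (M + e1)^-1 * (M + dl) < 1 by rewrite mulrC ltr_pdivrMr// mul1r ltrD2l /dl; lra.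
(* Multiplying [v = 1 + z v] by [g] turns it into [g = (M + e1)^-1 x v], which inverts [x] in the
   corner of [g]. *)
have [v vE] := neumann zM z1.
have gz : g * z = z by rewrite /z -scalerAr mulrBr -scalerAr gg gx.
have zE : z = g - (M + e1)^-1 *| x by rewrite /z scalerBr rscaleK.
have gv : g = (M + e1)^-1 *| x * v.
  have : g * v = g + z * v by rewrite {1}vE mulrDr mulr1 mulrA gz.
  rewrite zE mulrBl => /eqP; rewrite -subr_eq0 => /eqP H.
  apply/eqP; rewrite -subr_eq0 -oppr_eq0 -H; apply/eqP.
  by Ncring_tac.non_commutative_ring.
exists g, ((M + e1)^-1 *| (g * a)), (g * v); split=> //; last by rewrite -qE.
by rewrite {1}gv /x -!scalerAl !mulrA.
Qed.

(** The self-adjoint case is applied to [x (star x)] with [e^2]; by the C*-identity, the norm of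
    [(1 - g) x] is the square root of that of [(1 - g) x (star x) (1 - g)]. *)
Lemma approx_proj x e : 0 < e ->
  exists g u v, [/\ g * g = g, g = u * x * v & nle (x - g * x) e].
Proof.
move=> e0; have xs : star (x * star x) = x * star x by rewrite (cstarM cb) (cstarK cb).
have [g [u [v [gs gg gE gx]]]] := sa_approx_proj xs (exprn_gt0 2 e0).
exists g, u, (star x * v); split=> //; first by rewrite gE !mulrA.
have -> : x - g * x = star (star ((1 - g) * x)).
  by rewrite (cstarK cb) mulrBl mul1r.
apply/(nle_star cb)/(nle_cstar cb); first exact: ltW.
rewrite (cstarK cb) (cstarM cb) cstarB cstar1 gs.
have qs : star (1 - g) = 1 - g by rewrite cstarB cstar1 gs.
have qq : (1 - g) * (1 - g) = 1 - g by rewrite mulrBr mulr1 mulrBl mul1r gg subrr subr0.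
by have := nleM gx (proj_nle qs qq); rewrite mulr1 !mulrA.
Qed.

End CstarCalculus.

Import numFieldNormedType.Exports.

Lemma cauchy_converges (K : numFieldType) (V : completeNormedModType K) (u : nat -> V) :
  (forall e : K, 0 < e -> exists N, forall n, (N <= n)%N -> `|u N - u n| < e) ->
  exists l, forall e : K, 0 < e -> exists N, forall n, (N <= n)%N -> `|u n - l| < e.
Proof.
move=> cu; have cv : cvg (u @ \oo).
  apply: cauchy_cvg; apply: cauchy_exP => e e0; have [N uN] := cu e e0.
  exists (u N); exists N => // n /= Nn; rewrite -ball_normE /=; exact: uN.
exists (lim (u @ \oo)) => e e0.
have /cvgrPdist_lt/(_ e e0)[N _ HN] := cv.
by exists N => n Nn; rewrite distrC; exact: HN.
Qed.

Lemma geometric_small (F : realType) (c r e : F) : 0 <= r -> r < 1 -> 0 < e ->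
  exists N, c * r ^+ N < e.
Proof.
move=> r0 r1 e0; have c1 : 0 < `|c| + 1 by rewrite ltr_wpDl.
have : (fun n => r ^+ n) @ \oo --> 0 by apply: cvg_expr; rewrite ger0_norm.
move=> /cvgrPdist_lt/(_ _ (divr_gt0 e0 c1))[N _ /(_ N (leqnn _))].
rewrite sub0r normrN normrX (ger0_norm r0) ltr_pdivlMr// => H; exists N.
apply: le_lt_trans H; rewrite mulrC ler_wpM2l ?exprn_ge0//.
by apply: le_trans (ler_norm c) _; rewrite lerDl.
Qed.

Section Subadditive.
Variables (F : realType) (V : zmodType) (nrm : V -> F).
Hypothesis nrmD : forall x y, nrm (x + y) <= nrm x + nrm y.
Hypothesis nrmN : forall x, nrm (- x) = nrm x.
Hypothesis nrm0 : nrm 0 = 0.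
Variables (u : nat -> V) (c r : F).
Hypotheses (r0 : 0 <= r) (r1 : r < 1).
Hypothesis du : forall n, nrm (u n.+1 - u n) <= c * r ^+ n.

Lemma geometric_coef_ge0 : 0 <= c.
Proof.
have nrm_ge0 x : 0 <= nrm x.
  have := nrmD x (- x); rewrite subrr nrm0 nrmN; lra.
by have := du 0; rewrite expr0 mulr1; exact: le_trans.
Qed.

Lemma geometric_tail n m : (n <= m)%N -> nrm (u m - u n) <= c / (1 - r) * r ^+ n.
Proof.
have c0 := geometric_coef_ge0; have r1' : 0 < 1 - r by rewrite subr_gt0.
move=> /subnK <-; set k := (m - n)%N; rewrite addnC.
suff H : nrm (u (n + k)%N - u n) <= c / (1 - r) * (r ^+ n - r ^+ (n + k)).
  apply: (le_trans H); rewrite ler_wpM2l ?divr_ge0 ?(ltW r1')//.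
  by rewrite gerBl exprn_ge0.
elim: k => [|k IH]; first by rewrite addn0 !subrr mulr0 nrm0.
rewrite addnS -(subrK (u (n + k)%N) (u (n + k).+1)) -addrA.
apply: (le_trans (nrmD _ _)); apply: (le_trans (lerD (du _) IH)).
rewrite exprS; set a := r ^+ (n + k); set b := r ^+ n.
have -> : c * a = c / (1 - r) * (a - r * a) by field; rewrite gt_eqF.
by rewrite -mulrDr ler_wpM2l ?divr_ge0 ?(ltW r1')//; lra.
Qed.

End Subadditive.

(** * The norm of a C*-algebra with values in the real field *)

Section Cstar.
Variables (F : realType) (B : cstarType F).
Implicit Types (a b c : B) (l m : F[i]).

(** Norms take values in [F[i]]; being nonnegative, they are real, and the real part loses nothing
    ([nrmE]). *)
Definition nrm a : F := complex.Re `|a|.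

Lemma nrmE a : `|a| = (nrm a)%:C.
Proof. by have := ger0_Im (normr_ge0 a); rewrite /nrm; case: `|a| => x y /= ->. Qed.

Lemma ge0_complex l : 0 <= l -> l = (complex.Re l)%:C.
Proof. by move=> /ger0_Im; case: l => x y /= ->. Qed.

Definition mod l : F := complex.Re `|l|.

Lemma modE l : `|l| = (mod l)%:C.
Proof. exact/ge0_complex. Qed.

Lemma nrm_ge0 a : 0 <= nrm a.
Proof. by have := normr_ge0 a; rewrite nrmE lecR. Qed.

Lemma nrmD a b : nrm (a + b) <= nrm a + nrm b.
Proof. by have := ler_normD a b; rewrite !nrmE -rmorphD /= lecR. Qed.

Lemma nrmN a : nrm (- a) = nrm a.
Proof. by rewrite /nrm normrN. Qed.

Lemma nrmB a b : nrm (a - b) <= nrm a + nrm b.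
Proof. by rewrite -(nrmN b); exact: nrmD. Qed.

Lemma nrm0 : nrm 0 = 0.
Proof. by rewrite /nrm normr0. Qed.

Lemma nrm_eq0 a : nrm a <= 0 -> a = 0.
Proof.
move=> a0; apply/eqP; rewrite -normr_eq0 nrmE eq_complex /= eqxx andbT.
by rewrite eq_le a0 nrm_ge0.
Qed.

Lemma nrmM a b : nrm (a ** b) <= nrm a * nrm b.
Proof. by have := norm_rmul a b; rewrite !nrmE -rmorphM /= lecR. Qed.

Lemma nrmZ l a : nrm (l *: a) = mod l * nrm a.
Proof. by have := normrZ l a; rewrite !nrmE modE -rmorphM => -[]. Qed.

Lemma nrm_cstar a : nrm (star a ** a) = nrm a ^+ 2.
Proof. by have := cstar_identity a; rewrite !nrmE -rmorphXn => -[]. Qed.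

Lemma nrm_star a : nrm (star a) = nrm a.
Proof.
suff H b : nrm b <= nrm (star b).
  by apply/eqP; rewrite eq_le H andbT -{2}(starK a) H.
have := nrmM (star b) b; rewrite nrm_cstar; have := nrm_ge0 b; have := nrm_ge0 (star b).
by nra.
Qed.

Lemma mod_ge0 l : 0 <= mod l.
Proof. by have := normr_ge0 l; rewrite modE lecR. Qed.

Lemma modD l m : mod (l + m) <= mod l + mod m.
Proof. by have := ler_normD l m; rewrite !modE -rmorphD /= lecR. Qed.

Lemma modM l m : mod (l * m) = mod l * mod m.
Proof. by have := normrM l m; rewrite !modE -rmorphM => -[]. Qed.

Lemma mod_real (t : F) : mod t%:C = `|t|.
Proof. by rewrite /mod normc_def /= expr0n addr0 sqrtr_sqr. Qed.

Lemma mod_eq0 l : mod l <= 0 -> l = 0.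
Proof.
move=> l0; apply/eqP; rewrite -normr_eq0 modE eq_complex /= eqxx andbT.
by rewrite eq_le l0 mod_ge0.
Qed.

Lemma mod_conj l : mod (Num.conj l) = mod l.
Proof. by rewrite /mod norm_conjC. Qed.

Definition nrm_le a (e : F) : Prop := nrm a <= e.

Lemma geometric_limit (u : nat -> B) (c r : F) : 0 <= r -> r < 1 ->
  (forall n, nrm (u n.+1 - u n) <= c * r ^+ n) ->
  exists x : B, forall n, nrm (u n - x) <= c / (1 - r) * r ^+ n.
Proof.
move=> r0 r1 du; have tail := geometric_tail nrmD nrmN nrm0 r0 r1 du.
have small (e : F[i]) : 0 < e -> exists2 e' : F, 0 < e' & e = e'%:C.
  by move=> e0; exists (complex.Re e); [move: e0; rewrite ltcE => /andP[]|apply/ge0_complex/ltW].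
have [|l ul] := @cauchy_converges _ B u.
  move=> _ /small[e e0 ->]; have [N HN] := geometric_small (c / (1 - r)) r0 r1 e0.
  exists N => n Nn; rewrite distrC nrmE ltcR; exact: le_lt_trans (tail _ _ Nn) HN.
exists l => n; apply/ler_addgt0Pr => e e0.
have [|N uN] := ul e%:C; first by rewrite ltcR.
have := uN (maxn N n) (leq_maxl _ _); rewrite nrmE ltcR => /ltW H.
rewrite -(subrK (u (maxn N n)) (u n)) -addrA; apply: le_trans (nrmD _ _) (lerD _ H).
by rewrite -nrmN opprB; apply: tail; exact: leq_maxr.
Qed.

Lemma nrm_le_bound : norm_bound nrm_le.
Proof.
split; rewrite /nrm_le.
- by move=> x e e'; exact: le_trans.
- by move=> x y e e' xe ye; apply: le_trans (nrmD _ _) _; exact: lerD.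
- by move=> x e; rewrite nrmN.
- move=> x H; apply: nrm_eq0; apply/ler_addgt0Pr => e e0; rewrite add0r; exact: H.
- move=> u c r r0 r1 du; have [l ul] := geometric_limit r0 r1 du; exists l => e e0.
  have [N HN] := geometric_small (c / (1 - r)) r0 r1 e0; exists N => n Nn.
  apply: (le_trans (ul n)); apply: le_trans (ltW HN).
  rewrite ler_wpM2l//; last by rewrite ler_wiXn2l// ltW.
  rewrite divr_ge0 ?subr_ge0 ?(ltW r1)//.
  exact: (geometric_coef_ge0 nrmD nrmN nrm0 du).
Qed.

End Cstar.

(** * The unitization as a unital C*-algebra *)

Definition unitz (F : realType) (B : cstarType F) : Type := (B * F[i])%type.

Section Unitz.
Variables (F : realType) (B : cstarType F).
Local Notation U := (unitz B).
Implicit Types (x y z : U) (a b c : B).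

HB.instance Definition _ := GRing.Zmodule.copy U (B * F[i])%type.
HB.instance Definition _ := GRing.Lmodule.copy U (B * F[i]^o)%type.

Definition umul : U -> U -> U := @unitz_mul F B.
Definition ustar : U -> U := @unitz_star F B.
Definition uone : U := (0, 1).

Lemma unitz_eq x y : x.1 = y.1 -> x.2 = y.2 -> x = y.
Proof. by case: x y => [a l] [b m] /= -> ->. Qed.

Lemma umulA : associative umul.
Proof.
move=> [a l] [b m] [c n]; apply: unitz_eq => /=; last exact: mulrA.
rewrite !(rmulDl, rmulDr, scalerDr, rmulZl, rmulZr, rmulA) !scalerA.
rewrite [n * l]mulrC [n * m]mulrC !addrA.
by rewrite [LHS](ACl (1*3*5*2*4*6*7)%AC).
Qed.

Lemma umul1x : left_id uone umul.
Proof.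
by move=> [a l]; apply: unitz_eq; rewrite /= ?mul1r// rmul0l scaler0 scale1r !add0r.
Qed.

Lemma umulx1 : right_id uone umul.
Proof.
by move=> [a l]; apply: unitz_eq; rewrite /= ?mulr1// rmul0r scaler0 scale1r add0r addr0.
Qed.

Lemma umulDl : left_distributive umul +%R.
Proof.
move=> [a l] [b m] [c n]; apply: unitz_eq => /=; last exact: mulrDl.
rewrite rmulDl scalerDr scalerDl.
by rewrite !addrA [LHS](ACl (1*3*5*2*4*6)%AC).
Qed.

Lemma umulDr : right_distributive umul +%R.
Proof.
move=> [a l] [b m] [c n]; apply: unitz_eq => /=; last exact: mulrDr.
rewrite rmulDr scalerDr scalerDl.
by rewrite !addrA [LHS](ACl (1*3*5*2*4*6)%AC).
Qed.

Lemma uone_neq0 : uone != 0.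
Proof. by apply/eqP => -[/eqP]; rewrite oner_eq0. Qed.

HB.instance Definition _ := GRing.Zmodule_isNzRing.Build U umulA umul1x umulx1
  umulDl umulDr uone_neq0.

Lemma unitz_scaleAl (l : F[i]) x y : l *: (x * y) = l *: x * y.
Proof.
case: x y => [a m] [b n]; apply: unitz_eq => /=; last exact: mulrA.
by rewrite !scalerDr rmulZl !scalerA [n * l]mulrC.
Qed.
HB.instance Definition _ := GRing.Lmodule_isLalgebra.Build F[i] U unitz_scaleAl.

Lemma unitz_scaleAr (l : F[i]) x y : l *: (x * y) = x * (l *: y).
Proof.
case: x y => [a m] [b n]; apply: unitz_eq => /=; last exact: mulrCA.
by rewrite !scalerDr rmulZr !scalerA [m * l]mulrC.
Qed.
HB.instance Definition _ := GRing.Lalgebra_isAlgebra.Build F[i] U unitz_scaleAr.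

Lemma umulE x y : x * y = (x.1 ** y.1 + y.2 *: x.1 + x.2 *: y.1, x.2 * y.2).
Proof. by []. Qed.

Definition uact x b : B := x.1 ** b + x.2 *: b.

(** The unitization is formed even when [B] has a unit [u]. In that case [(-u, 1)] acts as 0 on [B],
    and the bound on the scalar part is what separates it from 0; when [B] has no unit, [mod_le_act]
    supplies this bound. *)
Definition ule x (e : F) : Prop :=
  mod x.2 <= e /\ forall b, nrm (uact x b) <= e * nrm b.

Lemma uactM x y b : uact (x * y) b = uact x (uact y b).
Proof.
case: x y => [a l] [c m]; rewrite /uact /=.
rewrite !(rmulDl, rmulDr, scalerDr, rmulZl, rmulZr, rmulA) !scalerA -!addrA.
by congr (_ + _); rewrite addrCA.
Qed.

Lemma uactD x y b : uact (x + y) b = uact x b + uact y b.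
Proof. by rewrite /uact /= rmulDl scalerDl addrACA. Qed.

Lemma uactZ (l : F[i]) x b : uact (l *: x) b = l *: uact x b.
Proof. by rewrite /uact /= rmulZl scalerDr scalerA. Qed.

Lemma uact_star x a b : star (uact (ustar x) a) ** b = star a ** uact x b.
Proof.
case: x => [c l]; rewrite /uact /= starD starM starK starZ conjCK.
by rewrite rmulDl rmulDr rmulA rmulZl rmulZr.
Qed.

Lemma ule_ge0 x e : ule x e -> 0 <= e.
Proof. by case=> H _; exact: le_trans (mod_ge0 _) H. Qed.

(** [x] sends [star x.1] to [x.1 ** star x.1 + x.2 *: star x.1], whose first term has norm
    [nrm x.1 ^+ 2]. This bound makes the first components of a Cauchy sequence converge in [B]. *)
Lemma ule_nrm x e : ule x e -> nrm x.1 <= 2 * e.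
Proof.
move=> xe; have e0 := ule_ge0 xe; case: xe => l2 /(_ (star x.1)).
rewrite nrm_star /uact => H.
have : nrm x.1 ^+ 2 <= 2 * e * nrm x.1.
  rewrite -{1}(nrm_star x.1) -nrm_cstar starK.
  rewrite -(addrK (x.2 *: star x.1) (x.1 ** star x.1)).
  apply: le_trans (nrmB _ _) _; rewrite nrmZ nrm_star.
  have := ler_wpM2r (nrm_ge0 x.1) l2; lra.
have := nrm_ge0 x.1; nra.
Qed.

Lemma ule_emb a e : ule ((a, 0) : U) e -> nrm a <= e.
Proof.
move=> ae; have e0 := ule_ge0 ae; case: ae => _ /(_ (star a)).
rewrite /uact /= scale0r addr0 -{1}(starK a) nrm_cstar nrm_star.
have := nrm_ge0 a; nra.
Qed.

Lemma ule_complete (u : nat -> U) (c r : F) : 0 <= r -> r < 1 ->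
  (forall n, ule (u n.+1 - u n) (c * r ^+ n)) ->
  exists l, forall e, 0 < e -> exists N, forall n, (N <= n)%N -> ule (u n - l) e.
Proof.
move=> r0 r1 du.
have du1 n : nrm ((u n.+1).1 - (u n).1) <= 2 * c * r ^+ n.
  by rewrite -mulrA; exact: (ule_nrm (du n)).
have [l ul] := geometric_limit r0 r1 du1.
have part (f : F[i] -> F) : (forall v w, f (v - w) = f v - f w) ->
    (forall w, `|f w| <= mod w) ->
    exists t : F, forall e, 0 < e -> exists N, forall n, (N <= n)%N -> `|f (u n).2 - t| < e.
  move=> fB fz; have df n : `|f (u n.+1).2 - f (u n).2| <= c * r ^+ n.
    by rewrite -fB; apply: le_trans (fz _) _; case: (du n).
  apply: (@cauchy_converges _ F) => e e0.
  have [N HN] := geometric_small (c / (1 - r)) r0 r1 e0.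
  exists N => n Nn; rewrite distrC; apply: le_lt_trans HN.
  exact: (@geometric_tail F F Num.norm (@ler_normD _ _) (@normrN _ _) (normr0 _) (fun n => f (u n).2)).
have [[? ?] [? ?]//|w|t1 ut1] := part (@complex.Re F).
  by rewrite /mod normc_def /= -[leLHS]sqrtr_sqr ler_sqrt ?addr_ge0 ?sqr_ge0// lerDl sqr_ge0.
have [[? ?] [? ?]//|w|t2 ut2] := part (@complex.Im F).
  by rewrite /mod normc_def /= -[leLHS]sqrtr_sqr ler_sqrt ?addr_ge0 ?sqr_ge0// lerDr sqr_ge0.
exists ((l, t1 +i* t2)%C : U) => e e0.
have e3 : 0 < e / 3 by rewrite divr_gt0.
have [N1 H1] := ut1 _ e3; have [N2 H2] := ut2 _ e3.
have [N3 H3] := geometric_small (2 * c / (1 - r)) r0 r1 e3.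
exists (maxn (maxn N1 N2) N3) => n; rewrite !geq_max => /andP[/andP[n1 n2] n3].
have Hl : mod ((u n).2 - (t1 +i* t2)%C) <= 2 * (e / 3).
  have := H1 n n1; have := H2 n n2; set z := (u n).2.
  move=> /ltW h2 /ltW h1; rewrite (_ : z - _ = (complex.Re z - t1)%:C + 'i%C * (complex.Im z - t2)%:C).
    apply: le_trans (modD _ _) _; rewrite modM !mod_real.
    rewrite (_ : mod 'i%C = 1); first lra.
    by rewrite /mod normc_def /= expr0n expr1n add0r sqrtr1.
  by case: z {h1 h2} => p q; apply/eqP; rewrite eq_complex /=; apply/andP; split; apply/eqP; ring.
have Hu : nrm ((u n).1 - l) <= e / 3.
  apply: (le_trans (ul n)); apply: le_trans (ltW H3).
  rewrite ler_wpM2l//; last by rewrite ler_wiXn2l// ltW.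
  rewrite divr_ge0 ?subr_ge0 ?(ltW r1)//.
  exact: (geometric_coef_ge0 (u := fun n => (u n).1) (@nrmD _ _) (@nrmN _ _) (@nrm0 _ _) du1).
split=> [|b] /=; first by lra.
apply: le_trans (nrmD _ _) _; rewrite nrmZ.
apply: (@le_trans _ _ (e / 3 * nrm b + 2 * (e / 3) * nrm b)); last by lra.
apply: lerD; last by rewrite ler_wpM2r// nrm_ge0.
by apply: le_trans (nrmM _ _) _; rewrite ler_wpM2r// nrm_ge0.
Qed.

Lemma unitz_norm_bound : norm_bound ule.
Proof.
split.
- move=> x e e' [l2 H] ee; split; first exact: le_trans ee.
  by move=> b; apply: le_trans (H b) _; rewrite ler_wpM2r// nrm_ge0.
- move=> x y e e' [l2 H] [l2' H']; split.
    by apply: le_trans (modD _ _) _; exact: lerD.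
  by move=> b; rewrite uactD mulrDl; apply: le_trans (nrmD _ _) _; exact: lerD.
- move=> x e [l2 H]; rewrite -scaleN1r; split.
    by rewrite /= modM (_ : mod (-1) = 1) ?mul1r// /mod normrN1.
  by move=> b; rewrite uactZ scaleN1r nrmN.
- move=> x H; apply: unitz_eq.
    apply: nrm_eq0; apply/ler_addgt0Pr => e e0; rewrite add0r.
    have e2 : 0 < e / 2 by rewrite divr_gt0.
    by apply: (le_trans (ule_nrm (H _ e2))); lra.
  by apply: mod_eq0; apply/ler_addgt0Pr => e e0; rewrite add0r; case: (H e e0).
- exact: ule_complete.
Qed.

Lemma unitz_cstar_bound : cstar_bound ustar ule.
Proof.
split.
- exact: unitz_norm_bound.
- exact: ule_ge0.
- move=> x; exists (nrm x.1 + mod x.2); split; first by rewrite lerDr nrm_ge0.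
  by move=> b; rewrite mulrDl; apply: le_trans (nrmD _ _) _; rewrite nrmZ lerD// nrmM.
- split; first by rewrite /= /mod normr1.
  by move=> b; rewrite /uact /= rmul0l scale1r add0r mul1r.
- move=> x y e e' xe ye; have e0 := ule_ge0 xe; case: xe ye => [l2 H] [l2' H']; split.
    by rewrite /= modM ler_pM// mod_ge0.
  move=> b; rewrite uactM; apply: le_trans (H _) _.
  by rewrite -mulrA ler_wpM2l.
- move=> t x e [l2 H]; split; first by rewrite /= modM mod_real ler_wpM2l.
  by move=> b; rewrite uactZ nrmZ mod_real -mulrA ler_wpM2l.
- move=> x e [l2 H]; have i1 : mod ('i%C : F[i]) = 1.
    by rewrite /mod normc_def /= expr0n expr1n add0r sqrtr1.
  split; first by rewrite /= modM i1 mul1r.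
  by move=> b; rewrite uactZ nrmZ i1 mul1r.
- move=> x e H; split; first by apply/ler_addgt0Pr => d d0; case: (H d d0).
  move=> b; apply/ler_addgt0Pr => d d0.
  have b1 : 0 < nrm b + 1 by rewrite ltr_wpDl// nrm_ge0.
  have [_ /(_ b) Hb] := H _ (divr_gt0 d0 b1).
  apply: (le_trans Hb); rewrite mulrDl lerD2l mulrAC ler_pdivrMr//.
  by rewrite ler_wpM2l ?ltW//; lra.
- move=> x e [l2 H]; split; first by rewrite /= mod_conj.
  move=> b; set w := uact _ b.
  have : nrm w ^+ 2 <= e * nrm b * nrm w.
    rewrite -nrm_cstar uact_star; apply: le_trans (nrmM _ _) _; rewrite nrm_star.
    by rewrite mulrC mulrAC ler_wpM2r// nrm_ge0.
  have : 0 <= e * nrm b by rewrite mulr_ge0 ?nrm_ge0// (le_trans (mod_ge0 _) l2).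
  have := nrm_ge0 w; set p := e * nrm b; set q := nrm w => q0 p0 qp.
  by case: (lerP q p) => // pq; nra.
- move=> x e e0 [l2 H]; split.
    move: l2; rewrite /= modM mod_conj; have := mod_ge0 x.2; nra.
  move=> b; set w := uact x b.
  have : nrm w ^+ 2 <= (e * nrm b) ^+ 2.
    have xx : ustar (ustar x) = x by apply: unitz_eq; rewrite /= ?starK ?conjCK.
    rewrite -nrm_cstar /w -{1}xx uact_star -uactM.
    apply: le_trans (nrmM _ _) _; rewrite nrm_star exprMn.
    by have := ler_wpM2l (nrm_ge0 b) (H b); rewrite [nrm b ^+ 2]expr2 mulrCA.
  by rewrite ler_sqr ?nnegrE ?mulr_ge0 ?nrm_ge0.
- by move=> x; apply: unitz_eq; rewrite /= ?starK ?conjCK.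
- by move=> x y; apply: unitz_eq; rewrite /= ?starD ?rmorphD.
- move=> [a l] [b m]; apply: unitz_eq.
    change (star (a ** b + m *: a + l *: b)
      = star b ** star a + Num.conj l *: star b + Num.conj m *: star a).
    by rewrite !starD starM !starZ addrAC.
  change (Num.conj (l * m) = Num.conj m * Num.conj l).
  by rewrite rmorphM mulrC.
- move=> t [a l]; have tc : Num.conj t%:C = t%:C :> F[i] by exact: conjc_real.
  apply: unitz_eq; first by change (star (t%:C *: a) = t%:C *: star a); rewrite starZ tc.
  by change (Num.conj (t%:C * l) = t%:C * Num.conj l); rewrite rmorphM; congr (_ * _).
- move=> [a l]; have ic : Num.conj 'i%C = - 'i%C :> F[i].
    by apply/eqP; rewrite eq_complex /= oppr0 !eqxx.
  apply: unitz_eq.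
    by change (star ('i%C *: a) = - ('i%C *: star a)); rewrite starZ ic scaleNr.
  by change (Num.conj ('i%C * l) = - ('i%C * Num.conj l)); rewrite rmorphM -mulNr; congr (_ * _).
Qed.

End Unitz.

Section RealRank.
Variables (F : realType) (B : cstarType F).
Local Notation U := (unitz B).

Lemma unit_star (u : B) : is_unit u -> star u = u.
Proof. by move=> uu; rewrite -[LHS](uu _).2 -{2}(starK u) -starM (uu _).2 starK. Qed.

(* Scaled to have scalar part 1, an element acting with norm less than 1 would have a
   fixed point d y = d, making y a unit. *)
Lemma mod_le_act (x : U) (e : F) : (~ exists u : B, is_unit u) -> 0 <= e ->
  (forall b, nrm (uact x b) <= e * nrm b) -> mod x.2 <= e.
Proof.
move=> nou e0 xe; rewrite leNgt; apply/negP => lx; apply: nou.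
have l0 : 0 < mod x.2 by exact: le_lt_trans lx.
have x2n : x.2 != 0.
  by apply: contraTneq l0 => ->; rewrite /mod normr0 ltxx.
pose d := x.2^-1 *: x.1.
have dE b : d ** b + b = x.2^-1 *: uact x b.
  by rewrite /d /uact scalerDr scalerA mulVf// scale1r rmulZl.
pose r := e / mod x.2.
have r0 : 0 <= r by rewrite divr_ge0// ltW.
have r1 : r < 1 by rewrite ltr_pdivrMr// mul1r.
have db b : nrm (d ** b + b) <= r * nrm b.
  rewrite dE nrmZ (_ : mod x.2^-1 = (mod x.2)^-1).
    by rewrite /r mulrAC mulrC ler_wpM2r// invr_ge0 ltW.
  have : mod x.2^-1 * mod x.2 = 1 by rewrite -modM mulVf// /mod normr1.
  by move=> h; rewrite -[RHS]mul1r -h mulfK// gt_eqF.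
have [|||||y _ yE] := @contraction_fixpoint _ _ _ (nrm_le_bound B) (fun y => - d + (d ** y + y))
    (fun=> True) r (nrm (- d)) r0 r1 => //.
- by rewrite rmul0r !addr0; exact: lexx.
- move=> a b t _ _ ab; rewrite /nrm_le opprD addrACA subrr add0r opprD addrACA -rmulBr.
  by apply: le_trans (db _) _; rewrite ler_wpM2l.
have dy : d ** y = d.
  by move/eqP: yE; rewrite addrA -subr_eq0 addrK addrC subr_eq0 => /eqP.
have yl c : y ** c = c.
  apply/eqP; rewrite -subr_eq0; apply/eqP/nrm_eq0.
  have := db (y ** c - c); rewrite rmulBr rmulA dy subrr add0r.
  have := nrm_ge0 (y ** c - c); nra.
have ys : star y = y by rewrite -[LHS]yl -{1}(starK y) -starM yl starK.
by exists y => a; split=> //; rewrite -[LHS]starK starM ys yl starK.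
Qed.

(** With a unit [u], the unitization is the product of [B] and the scalars through
    [(a, l) |-> (a + l u, l)], and the two components are approximated separately, a zero scalar
    being replaced by [e]. *)
Lemma unitz_dense : real_rank_0 B -> sa_invertible_dense (@ustar F B) (@ule F B).
Proof.
move=> [unital nonunital] x xs e e0; have eC : 0 < e%:C :> F[i] by rewrite ltcR.
have [[u uu]|nou] := pselect (exists u : B, is_unit u); last first.
  have [y [z [ys yz zy xy]]] := nonunital nou x xs e%:C eC.
  exists y, z; split=> //.
  have act b : nrm (uact (x - y) b) <= e * nrm b.
    by have := xy b; rewrite /= !nrmE -rmorphM /= lecR.
  by split=> //; apply: mod_le_act => //; exact: ltW.
have us := unit_star uu.
have x1s : star x.1 = x.1 by case: (x) xs => [a l] [].
have x2s : Num.conj x.2 = x.2 by case: (x) xs => [a l] [].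
have as_ : star (x.1 + x.2 *: u) = x.1 + x.2 *: u by rewrite starD starZ x1s x2s us.
have [b [c [bs bc cb xb]]] := unital u uu _ as_ _ eC.
have [m [m0 ms xm]] : exists m : F[i], [/\ m != 0, Num.conj m = m & mod (x.2 - m) <= e].
  have [x20|x2n] := eqVneq x.2 0.
    exists e%:C; rewrite x20 sub0r; split.
    - by rewrite gt_eqF.
    - exact: conjc_real.
    - by rewrite /mod normrN -/(mod _) mod_real gtr0_norm.
  by exists x.2; split=> //; rewrite subrr /mod normr0 ltW.
exists ((b - m *: u, m) : U), ((c - m^-1 *: u, m^-1) : U); split.
- apply: unitz_eq; last exact: ms.
  by change (star (b - m *: u) = b - m *: u); rewrite -scaleNr starD bs starZ us rmorphN /= ms.
- apply: unitz_eq; last exact: mulfV.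
  change ((b - m *: u) ** (c - m^-1 *: u) + m^-1 *: (b - m *: u) + m *: (c - m^-1 *: u) = 0).
  rewrite !(rmulBl, rmulBr) !rmulZl !rmulZr bc !(uu _).1 !(uu _).2 !scalerBr !scalerA.
  rewrite mulfV// mulVf// scale1r opprB.
  rewrite !addrA (ACl ((1*8)*(2*5)*(3*6)*(4*7)))/=.
  by rewrite !subrr !(addNr, subrr, addr0).
- apply: unitz_eq; last exact: mulVf.
  change ((c - m^-1 *: u) ** (b - m *: u) + m *: (c - m^-1 *: u) + m^-1 *: (b - m *: u) = 0).
  rewrite !(rmulBl, rmulBr) !rmulZl !rmulZr cb !(uu _).1 !(uu _).2 !scalerBr !scalerA.
  rewrite mulfV// mulVf// scale1r opprB.
  rewrite !addrA (ACl ((1*8)*(2*5)*(3*6)*(4*7)))/=.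
  by rewrite !subrr !(addNr, subrr, addr0).
- split; first exact: xm.
  move=> v; have -> : uact (x - (b - m *: u, m)) v = (x.1 + x.2 *: u - b) ** v.
    change ((x.1 - (b - m *: u)) ** v + (x.2 - m) *: v = (x.1 + x.2 *: u - b) ** v).
    rewrite !(rmulBl, rmulDl) !rmulZl (uu _).1 scalerBl.
    rewrite opprB !addrA; set p := x.1 ** v; set q := b ** v; set s := m *: v; set t := _ *: v.
    by rewrite (ACl (1*4*3*(2*5)))/= subrr addr0.
  apply: le_trans (nrmM _ _) _; rewrite ler_wpM2r ?nrm_ge0//.
  by move: xb; rewrite nrmE lecR.
Qed.

End RealRank.

(** * Idempotents and closed ideals in real rank 0, and matrices over such an algebra *)

Section Approximable.
Variables (F : realType) (B : cstarType F).

Lemma nrm_sum I (r : seq I) (f : I -> B) (k : F) :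
  (forall i, nrm (f i) <= k) -> nrm (\sum_(i <- r) f i) <= (size r)%:R * k.
Proof.
move=> fk; elim: r => [|i r IH]; first by rewrite big_nil nrm0 mul0r.
rewrite big_cons /= -natr1 mulrDl mul1r [leRHS]addrC.
by apply: le_trans (nrmD _ _) _; exact: lerD.
Qed.

Definition mx_le (n : nat) (m : Minf B) (e : F) : Prop :=
  (forall i j, (n <= i)%N || (n <= j)%N -> m i j = 0) /\ forall i j, nrm (m i j) <= e.

Lemma Minf_oppE (m : Minf B) i j : (- m) i j = - m i j.
Proof. by []. Qed.

Lemma Minf_subE (m m' : Minf B) i j : (m - m') i j = m i j - m' i j.
Proof. by []. Qed.

Lemma mx_le_bound n : norm_bound (mx_le n).
Proof.
split.
- by move=> x e e' [sx xe] ee; split=> // i j; exact: le_trans (xe i j) ee.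
- move=> x y e e' [sx xe] [sy ye]; split=> i j; first by move=> h; rewrite Minf_addE sx ?sy// addr0.
  by rewrite Minf_addE; apply: le_trans (nrmD _ _) _; exact: lerD.
- move=> x e [sx xe]; split=> i j; first by move=> h; rewrite Minf_oppE sx// oppr0.
  by rewrite Minf_oppE nrmN.
- move=> x H; apply: Minf_ext => i j; apply: nrm_eq0.
  by apply/ler_addgt0Pr => e e0; rewrite add0r; case: (H e e0) => _.
move=> u c r r0 r1 du.
have lim i j : {l | forall k, nrm (u k i j - l) <= c / (1 - r) * r ^+ k}.
  apply: cid; apply: geometric_limit => // k.
  by rewrite -Minf_subE; case: (du k).
have supp i j k : (n <= i)%N || (n <= j)%N -> u k i j = u 0%N i j.
  move=> h; elim: k => // k <-; apply/eqP; rewrite -subr_eq0 -Minf_subE.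
  by case: (du k) => + _ => ->.
(* Only the differences of consecutive terms are supported in the block of size [n]; outside it the
   sequence is constantly [u 0]. *)
have Lfin : (fun i j => if (n <= i)%N || (n <= j)%N then u 0%N i j else sval (lim i j)) \in @fin_mx B.
  apply/asboolP; have [p up] := Minf_bound (u 0%N); exists (maxn n p) => i j h.
  have -> : (n <= i)%N || (n <= j)%N by move: h; rewrite !geq_max => /orP[]/andP[-> _]; rewrite ?orbT.
  by apply: up; move: h; rewrite !geq_max => /orP[]/andP[_ ->]; rewrite ?orbT.
exists (MkMinf Lfin) => e e0.
have [N HN] := geometric_small (c / (1 - r)) r0 r1 e0.
have c0 : 0 <= c.
  have [_ /(_ 0%N 0%N)] := du 0%N; rewrite expr0 mulr1; exact: le_trans (nrm_ge0 _).
exists N => k Nk; split=> i j; first by move=> h; rewrite Minf_subE /= h supp// subrr.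
rewrite Minf_subE /=; case: ifP => h; first by rewrite supp// subrr nrm0 ltW.
apply: (le_trans (svalP (lim i j) k)); apply: le_trans (ltW HN).
rewrite ler_wpM2l//; last by rewrite ler_wiXn2l// ltW.
by rewrite divr_ge0 ?subr_ge0 ?(ltW r1).
Qed.

Lemma mx_leM n x y e e' : mx_le n x e -> mx_le n y e' -> mx_le n (x ** y) (n%:R * (e * e')).
Proof.
move=> [sx xe] [sy ye]; split=> i k.
  move=> h; rewrite (rmulmE (n := 0%N)) ?big_ord0// => j _.
  by case/orP: h => h; [rewrite sx ?h// rmul0l|rewrite (sy j k) ?h ?orbT// rmul0r].
rewrite (rmulmE (n := n)); last by move=> j nj; rewrite sx ?nj ?orbT// rmul0l.
have := @nrm_sum _ (index_enum 'I_n) (fun j => x i j ** y j k) (e * e').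
rewrite [size _](_ : _ = n); last by rewrite /index_enum -enumT size_enum_ord.
apply=> j; apply: le_trans (nrmM _ _) _; apply: ler_pM; rewrite ?nrm_ge0//.
Qed.

Hypothesis rr0 : real_rank_0 B.

(** The idempotent is found in the unitization. Being of the form [u x v] it has scalar part 0,
    hence lies in [B], and replacing [u], [v] by [g u], [v g] brings the factors into [B] as
    well. *)
Lemma approx_idem (x : B) (e : F) : 0 < e -> exists g : B,
  [/\ idempotent_elt g, exists u v, g = u ** x ** v & nrm (x - g ** x) <= e].
Proof.
move=> e0.
have [g [u [v [gg gE gx]]]] := approx_proj (unitz_cstar_bound B) (unitz_dense rr0)
  ((x, 0) : unitz B) e0.
have g2 : g.2 = 0 by rewrite gE !umulE /= mulr0 mul0r.
exists g.1.
have emb1 (w : unitz B) : g * w = ((g * w).1, 0) /\ w * g = ((w * g).1, 0).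
  by split; apply: unitz_eq; rewrite ?umulE //= g2 ?mul0r ?mulr0.
split.
- by have /(congr1 fst) := gg; rewrite umulE /= g2 !scale0r !addr0.
- exists (g * u).1, (v * g).1.
  have : g = g * u * (x, 0) * (v * g) by rewrite -{1}gg -{1}gg {2}gE !mulrA.
  rewrite (emb1 u).1 (emb1 v).2 => /(congr1 fst).
  by rewrite !umulE /= !(scale0r, mul0r) !addr0.
- apply: ule_emb; rewrite (_ : (_, _) = (x, 0) - g * (x, 0) :> unitz B)//.
  by apply: unitz_eq; rewrite umulE /= g2 ?mul0r ?subr0// !scale0r !addr0.
Qed.

Definition closed_gen_ideal (Z : V B -> Prop) (x : B) : Prop :=
  forall e : F, 0 < e -> exists2 y, gen_ideal Z (emb y) & nrm (x - y) <= e.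

(** An idempotent that is close enough to an element [y] of an ideal belongs to it: [p y p] is
    invertible in the corner of [p], and solving [v = p + (p - p y p) v] gives [p = p y p v]. *)
Lemma closed_gen_ideal_idem Z (p : B) : oideal Z -> idempotent_elt p ->
  closed_gen_ideal Z p -> Z (cl (emb p)).
Proof.
move=> oZ pp Jp; have k0 := nrm_ge0 p; set k := nrm p in k0.
pose e := (2 * (k * k + 1))^-1; have k1 : 0 < 2 * (k * k + 1) by have := mulr_ge0 k0 k0; lra.
have e0 : 0 < e by rewrite invr_gt0.
have [y Iy py] := Jp e e0.
pose d := p - p ** y ** p.
have pd : p ** d = d by rewrite rmulBr !rmulA !pp.
have dn : nrm d <= 2^-1.
  have -> : d = p ** (p - y) ** p by rewrite rmulBr rmulBl !pp.
  apply: le_trans (nrmM _ _) _.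
  apply: (@le_trans _ _ (k * e * k)).
    rewrite ler_wpM2r//; apply: le_trans (nrmM _ _) _; exact: ler_wpM2l.
  rewrite mulrAC /e -[_ * _^-1]/(_ / _) ler_pdivrMr//; have := mulr_ge0 k0 k0; lra.
have h0 : 0 <= 2^-1 :> F by rewrite invr_ge0.
have h1 : 2^-1 < 1 :> F by rewrite invf_lt1 ?ltr1n.
have [|||||v _ vE] := @contraction_fixpoint _ _ _ (nrm_le_bound B) (fun v => p + d ** v)
    (fun=> True) 2^-1 (nrm p) h0 h1 => //.
- by rewrite rmul0r addr0; exact: lexx.
- move=> a b t _ _ ab; rewrite /nrm_le opprD addrACA subrr add0r -rmulBr.
  apply: le_trans (nrmM _ _) _; apply: ler_pM => //; exact: nrm_ge0.
have pE : p = p ** y ** p ** v.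
  have : p ** v = p + d ** v by rewrite -{1}vE rmulDr pp rmulA pd.
  rewrite /d rmulBl => /eqP; rewrite addrCA -subr_eq0 opprD addrA subrr add0r.
  by rewrite oppr_eq0 subr_eq0 => /eqP.
apply/(gen_ideal_idem oZ (emb_idem pp)); rewrite pE !embM.
by do 2 apply: gen_idealMr; apply: gen_idealMl.
Qed.

(** The argument of [closed_gen_ideal_idem] in matrices, with [Y] an entrywise approximation of [a]
    whose entries lie in the ideal. *)
Lemma all_idem_generate Z : oideal Z -> (forall e : B, idempotent_elt e -> Z (cl (emb e))) ->
  forall v, Z v.
Proof.
move=> oZ allZ v; have [a aa ->] := cl_surj v.
have [n an] := Minf_bound a.
have [k [k0 ak]] : exists k : F, 0 <= k /\ mx_le n a k.
  exists (\sum_(i < n) \sum_(j < n) nrm (a i j)); split.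
    by apply: sumr_ge0 => i _; apply: sumr_ge0 => j _; exact: nrm_ge0.
  split=> // i j.
  have s0 (P : pred 'I_n) (f : 'I_n -> B) : 0 <= \sum_(j < n | P j) nrm (f j).
    by apply: sumr_ge0 => j' _; exact: nrm_ge0.
  have [ni|ni] := ltnP i n; last by rewrite an ?ni// nrm0; apply: sumr_ge0 => i' _; exact: s0.
  have [nj|nj] := ltnP j n; last by rewrite an ?nj ?orbT// nrm0; apply: sumr_ge0 => i' _; exact: s0.
  rewrite (bigD1 (Ordinal ni))//= (bigD1 (Ordinal nj))//= -addrA lerDl addr_ge0//.
  by apply: sumr_ge0 => i' _; exact: s0.
pose N := n%:R : F; have N0 : 0 <= N by exact: ler0n.
(* Each product of matrices of size [n] costs a factor [N], and three occur in [d ** v] with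
   [d = a ** (a - Y) ** a]. This [e] makes [v |-> a + d ** v] a contraction by one half. *)
pose e := (2 * (N * N * N * k * k + 1))^-1.
have k1 : 0 < 2 * (N * N * N * k * k + 1) by have := mulr_ge0 (mulr_ge0 (mulr_ge0 (mulr_ge0 N0 N0) N0) k0) k0; lra.
have e0 : 0 < e by rewrite invr_gt0.
have approx i j : {y : B | [/\ a i j = 0 -> y = 0, gen_ideal Z (emb y) & nrm (a i j - y) <= e]}.
  apply: cid; have [g [gg _ ge]] := approx_idem (a i j) e0.
  exists (g ** a i j); split=> //; first by move=> ->; rewrite rmul0r.
  by rewrite embM; apply/gen_idealMr/(gen_ideal_idem oZ (emb_idem gg)); exact: allZ.
have Yfin : (fun i j => sval (approx i j)) \in @fin_mx B.
  apply/asboolP; exists n => i j h; case: (svalP (approx i j)) => + _ _; apply; exact: an.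
pose Y := MkMinf Yfin.
have IY : gen_ideal Z Y.
  by apply: gen_ideal_entries => // i j; case: (svalP (approx i j)).
have aY : mx_le n (a - Y) e.
  split=> i j; last by case: (svalP (approx i j)).
  move=> h; rewrite Minf_subE an//=; case: (svalP (approx i j)) => -> //; last exact: an.
  by rewrite subrr.
pose d := a - a ** Y ** a.
have ad : a ** d = d by rewrite rmulBr !rmulA !aa.
have dn : mx_le n d (N * (N * (k * e) * k)).
  have -> : d = a ** (a - Y) ** a by rewrite rmulBr rmulBl !aa.
  by apply: mx_leM => //; exact: mx_leM.
have h0 : 0 <= 2^-1 :> F by rewrite invr_ge0.
have h1 : 2^-1 < 1 :> F by rewrite invf_lt1 ?ltr1n.
have [|||||w _ wE] := @contraction_fixpoint _ _ _ (mx_le_bound n) (fun v => a + d ** v)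
    (fun=> True) 2^-1 k h0 h1 => //.
- by rewrite rmul0r addr0.
- move=> x y t _ _ xy; rewrite opprD addrACA subrr add0r -rmulBr.
  apply: (nleW (mx_le_bound n) (mx_leM dn xy)).
  have t0 : 0 <= t by case: xy => _ /(_ 0%N 0%N); exact: le_trans (nrm_ge0 _).
  rewrite -/N mulrA ler_wpM2r//.
  have -> : N * (N * (N * (k * e) * k)) = (N * N * N * k * k) * e by ring.
  rewrite /e ler_pdivrMr//.
  have := mulr_ge0 (mulr_ge0 (mulr_ge0 (mulr_ge0 N0 N0) N0) k0) k0; lra.
have aE : a = a ** Y ** a ** w.
  have : a ** w = a + d ** w by rewrite -{1}wE rmulDr aa rmulA ad.
  rewrite /d rmulBl => /eqP; rewrite addrCA -subr_eq0 opprD addrA subrr add0r.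
  by rewrite oppr_eq0 subr_eq0 => /eqP.
apply/(gen_ideal_idem oZ aa); rewrite aE.
by do 2 apply: gen_idealMr; apply: gen_idealMl.
Qed.

Lemma real_rank_0_approximable : approximable B.
Proof.
exists closed_gen_ideal; split.
  move=> x.
  have pos n : 0 < n.+1%:R^-1 :> F by rewrite invr_gt0.
  pose g n := cid (approx_idem x (pos n)).
  exists (fun n => sval (g n)); split=> [n|Z oZ Zg e e0].
    by case: (svalP (g n)).
  have [n ne] : exists n, n.+1%:R^-1 <= e.
    by have [n _ /(_ n (leqnn n))] := near_infty_natSinv_lt (PosNum e0); exists n; exact: ltW.
  exists (sval (g n) ** x); last by case: (svalP (g n)) => _ _ h; exact: le_trans h ne.
  rewrite embM; apply/gen_idealMr/(gen_ideal_idem oZ _); last exact: Zg.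
  by apply: emb_idem; case: (svalP (g n)).
move=> Z oZ; split.
- move=> x y Jx Jy e e0; have e2 : 0 < e / 2 by rewrite divr_gt0.
  have [x' Ix xx] := Jx _ e2; have [y' Iy yy] := Jy _ e2.
  exists (x' - y').
    rewrite (_ : emb (x' - y') = emb x' - emb y').
      by apply: gen_idealD => //; exact: gen_idealN.
    by apply/esym/eqP; rewrite subr_eq -embD subrK.
  rewrite opprD addrACA -opprD; apply: le_trans (nrmB _ _) _; lra.
- move=> x y Jx; have y1 : 0 < nrm y + 1 by rewrite ltr_wpDl// nrm_ge0.
  split=> e e0; have [z Iz xz] := Jx _ (divr_gt0 e0 y1); [exists (y ** z)|exists (z ** y)].
  + by rewrite embM; exact: gen_idealMl.
  + rewrite -rmulBr; apply: le_trans (nrmM _ _) _.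
    apply: le_trans (ler_wpM2l (nrm_ge0 _) xz) _.
    by rewrite mulrCA ler_piMr ?(ltW e0)// ler_pdivrMr// mul1r lerDl.
  + by rewrite embM; exact: gen_idealMr.
  + rewrite -rmulBl; apply: le_trans (nrmM _ _) _.
    apply: le_trans (ler_wpM2r (nrm_ge0 _) xz) _.
    by rewrite mulrAC -mulrA ler_piMr ?(ltW e0)// ler_pdivrMr// mul1r lerDl.
- move=> e ee; split; first exact: closed_gen_ideal_idem.
  move=> Ze t t0; exists e; last by rewrite subrr nrm0 ltW.
  by apply/(gen_ideal_idem oZ _) => //; exact: emb_idem.
- exact: all_idem_generate.
Qed.

End Approximable.

(** * Subalgebras and direct limits *)

Local Close Scope complex_scope.

Definition lrmorphism_of (K : fieldType) (A B : algType K) (f : A -> B)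
    (lf : linear f) (mf : monoid_morphism f) : {lrmorphism A -> B} :=
  HB.pack f (GRing.isLinear.Build K A B *:%R f lf) (GRing.isMonoidMorphism.Build A B f mf).

Definition fun_alg (Z : pointedType) (K : fieldType) (M : algType K) : Type := Z -> M.

Section FunAlg.
Variables (Z : pointedType) (K : fieldType) (M : algType K).
Local Notation A := (fun_alg Z M).
HB.instance Definition _ := GRing.NzRing.copy A (Z -> M).
HB.instance Definition _ := GRing.Lmodule.copy A (Z -> M).

Lemma fun_alg_scaleAl (a : K) (x y : A) : a *: (x * y) = a *: x * y.
Proof. by apply/funext => z; exact: scalerAl. Qed.
HB.instance Definition _ := GRing.Lmodule_isLalgebra.Build K A fun_alg_scaleAl.

Lemma fun_alg_scaleAr (a : K) (x y : A) : a *: (x * y) = x * (a *: y).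
Proof. by apply/funext => z; exact: scalerAr. Qed.
HB.instance Definition _ := GRing.Lalgebra_isAlgebra.Build K A fun_alg_scaleAr.

Lemma fun_algD (x y : A) z : (x + y) z = x z + y z. Proof. by []. Qed.
Lemma fun_algM (x y : A) z : (x * y) z = x z * y z. Proof. by []. Qed.
Lemma fun_algZ a (x : A) z : (a *: x) z = a *: x z. Proof. by []. Qed.
End FunAlg.

Section SubAlg.
Variables (K : fieldType) (A : algType K).

Record subalg := SubAlg { subalg_pred :> {pred A}; subalgP : subalg_closed subalg_pred }.

Record sub_of (H : subalg) := SubOf { sub_val :> A; _ : sub_val \in subalg_pred H }.

Section Inst.
Variable H : subalg.
HB.instance Definition _ := [isSub for @sub_val H].
HB.instance Definition _ := [Choice of sub_of H by <:].
HB.instance Definition _ := GRing.isSubalgClosed.Build K A (subalg_pred H)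
  (GRing.subalg_closed_semi (subalgP H)).
HB.instance Definition _ := [SubChoice_isSubAlgebra of sub_of H by <:].
End Inst.

Lemma sub_inj (H : subalg) (x y : sub_of H) : (x : A) = y -> x = y.
Proof. exact: val_inj. Qed.

Lemma sub_valP (H : subalg) (x : sub_of H) : (x : A) \in subalg_pred H.
Proof. exact: valP. Qed.

Lemma sub_valD (H : subalg) (x y : sub_of H) : sub_val (x + y) = sub_val x + sub_val y.
Proof. by []. Qed.
Lemma sub_valM (H : subalg) (x y : sub_of H) : sub_val (x * y) = sub_val x * sub_val y.
Proof. by []. Qed.
Lemma sub_valZ (H : subalg) a (x : sub_of H) : sub_val (a *: x) = a *: sub_val x.
Proof. by []. Qed.
Lemma sub_val1 (H : subalg) : sub_val (1 : sub_of H) = 1.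
Proof. by []. Qed.

Section Inclusion.
Variables (H H' : subalg) (sHH' : {subset H <= H'}).

Definition incl_fun (x : sub_of H) : sub_of H' := SubOf (sHH' (sub_valP x)).

Lemma incl_linear : linear incl_fun.
Proof. by move=> a x y; exact: sub_inj. Qed.

Lemma incl_monoid : monoid_morphism incl_fun.
Proof. by split=> [|x y]; exact: sub_inj. Qed.

Definition incl : {lrmorphism sub_of H -> sub_of H'} :=
  lrmorphism_of incl_linear incl_monoid.

End Inclusion.

Section Union.
Variables (d : Order.disp_t) (I : porderType d) (H : I -> subalg) (G : subalg).
Hypothesis mono : forall i j : I, (i <= j)%O -> {subset H i <= H j}.
Hypothesis directed : forall i j : I, exists k : I, (i <= k)%O /\ (j <= k)%O.
Hypothesis inhI : inhabited I.
Hypothesis HG : forall i, {subset H i <= G}.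
Hypothesis cover : forall x, x \in G -> exists i, x \in H i.

Definition union_map i j (ij : (i <= j)%O) := incl (@mono i j ij).
Definition union_cocone i := incl (@HG i).

Lemma union_direct_system : direct_system union_map.
Proof.
split=> //; first by move=> i h x; exact: sub_inj.
by move=> i j k ij jk ik x; exact: sub_inj.
Qed.

(** The induced map evaluates an element in any stage that contains it; by directedness the choice
    of the stage is immaterial. *)
Lemma union_direct_limit : is_direct_limit union_map union_cocone.
Proof.
split; first by move=> i j ij x; exact: sub_inj.
move=> S g gco.
have pick (x : sub_of G) : {i | (x : A) \in H i} by apply/cid/cover/sub_valP.
pose h (x : sub_of G) : S := g (sval (pick x)) (SubOf (svalP (pick x))).
have hE (x : sub_of G) i (xi : (x : A) \in H i) : h x = g i (SubOf xi).
  have [k [ik jk]] := directed i (sval (pick x)).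
  rewrite /h -(gco _ _ ik) -(gco _ _ jk); congr (g k _); exact: sub_inj.
have two (x y : sub_of G) : exists i, (x : A) \in H i /\ (y : A) \in H i.
  have [k [ik jk]] := directed (sval (pick x)) (sval (pick y)).
  by exists k; split; [exact: (mono ik (svalP (pick x)))|exact: (mono jk (svalP (pick y)))].
have lh : linear h.
  move=> a x y; have [i [xi yi]] := two x y.
  have xyi : sub_val (a *: x + y) \in H i by rewrite sub_valD sub_valZ rpredD ?rpredZ.
  rewrite (hE _ _ xi) (hE _ _ yi) -linearZ -raddfD (hE _ i xyi).
  by congr (g i _); exact: sub_inj.
have mh : monoid_morphism h.
  split.
    have [k] := inhI; have k1 : sub_val (1 : sub_of G) \in H k by rewrite sub_val1 rpred1.
    rewrite (hE _ k k1) -(rmorph1 (g k)); congr (g k _); exact: sub_inj.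
  move=> x y; have [i [xi yi]] := two x y.
  have xyi : sub_val (x * y) \in H i by rewrite sub_valM rpredM.
  rewrite (hE _ _ xi) (hE _ _ yi) -rmorphM (hE _ i xyi).
  by congr (g i _); exact: sub_inj.
exists (lrmorphism_of lh mh); split.
  move=> i x; rewrite [LHS](hE (union_cocone i x) i (sub_valP x)); congr (g i _); exact: sub_inj.
move=> h' h'g x; rewrite [RHS](hE x _ (svalP (pick x))) -h'g.
by congr (h' _); exact: sub_inj.
Qed.

End Union.
End SubAlg.

Lemma cross_mul (F : fieldType) (p q p' q' s : F) : q != 0 -> q' != 0 ->
  p / q = s * (p' / q') -> p * q' = s * (p' * q).
Proof.
move=> q0 q0' E; have -> : p * q' = (p / q) * (q * q') by field.
by rewrite E; field.
Qed.

Lemma inv2_identities (F : fieldType) (a b c d : F) (D := a * d - b * c) : D != 0 ->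
  [/\ a * (D^-1 * d) + b * (D^-1 * - c) = 1, a * (D^-1 * - b) + b * (D^-1 * a) = 0,
      c * (D^-1 * d) + d * (D^-1 * - c) = 0 & c * (D^-1 * - b) + d * (D^-1 * a) = 1] /\
  [/\ D^-1 * d * a + D^-1 * - b * c = 1, D^-1 * d * b + D^-1 * - b * d = 0,
      D^-1 * - c * a + D^-1 * a * c = 0 & D^-1 * - c * b + D^-1 * a * d = 1].
Proof. by rewrite /D => D0; do 2 split; field. Qed.

(** * The local ring K(t)_(0), its maximal ideal, and invertibility in C_K *)

Section Local.
Variable K : fieldType.
Local Notation L := (ratfun K).
Local Notation M := (M2ratfun K).
Local Notation O := (@ratfun_loc0 K).
Local Notation t := (t_ratfun K).
Implicit Types (x y z : L) (A B : M).

(** The maximal ideal of K(t)_(0). *)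
Definition max_loc0 x : Prop := exists2 y, O y & x = t * y.
Local Notation tO := max_loc0.

Lemma loc0_0 : O 0.
Proof. by rewrite -(rmorph0 (@ratfun_of_poly K)); exact: loc0_poly. Qed.

Lemma loc0_1 : O 1.
Proof. by rewrite -(rmorph1 (@ratfun_of_poly K)); exact: loc0_poly. Qed.

Lemma loc0_t : O t.
Proof. exact: loc0_poly. Qed.

Lemma loc0N x : O x -> O (- x).
Proof.
move=> Ox; rewrite -mulN1r; apply: loc0M => //.
by rewrite -(rmorph1 (@ratfun_of_poly K)) -rmorphN; exact: loc0_poly.
Qed.

Lemma max_loc0W x : tO x -> O x.
Proof. by move=> [y Oy ->]; apply: loc0M => //; exact: loc0_t. Qed.

Lemma max_loc0_0 : tO 0.
Proof. by exists 0; [exact: loc0_0|rewrite mulr0]. Qed.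

Lemma max_loc0D x y : tO x -> tO y -> tO (x + y).
Proof. by move=> [a Oa ->] [b Ob ->]; exists (a + b); [exact: loc0D|rewrite mulrDr]. Qed.

Lemma max_loc0N x : tO x -> tO (- x).
Proof. by move=> [a Oa ->]; exists (- a); [exact: loc0N|rewrite mulrN]. Qed.

Lemma max_loc0M x y : O x -> tO y -> tO (x * y).
Proof. by move=> Ox [b Ob ->]; exists (x * b); [exact: loc0M|rewrite mulrCA]. Qed.

Lemma max_loc0Mr x y : tO x -> O y -> tO (x * y).
Proof. by move=> tx Oy; rewrite mulrC; exact: max_loc0M. Qed.

Lemma tofrac_neq0 (p : {poly K}) : p != 0 -> ratfun_of_poly p != 0.
Proof. by rewrite /ratfun_of_poly tofrac_eq0. Qed.

Lemma ratfun_of_poly_inj : injective (@ratfun_of_poly K).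
Proof. by move=> p q /eqP; rewrite /ratfun_of_poly tofrac_eq => /eqP. Qed.

Lemma t_neq0 : t != 0.
Proof. by apply: tofrac_neq0; rewrite polyX_eq0. Qed.

Lemma max_loc0_1 : ~ tO 1.
Proof.
move=> [_ [p [q [q0 ->]]]] E; have qn := ratfun_of_poly_neq0 q0.
have : ratfun_of_poly q = ratfun_of_poly ('X * p).
  by rewrite rmorphM -[LHS]mul1r E -mulrA divfK.
move/ratfun_of_poly_inj => qE; case/negP: q0; by rewrite qE hornerM hornerX mul0r.
Qed.

Lemma loc0_dich x : O x -> ~ tO x -> x != 0 /\ O x^-1.
Proof.
move=> [p [q [q0 ->]]] ntx; have qn := ratfun_of_poly_neq0 q0.
have [p0|p0] := eqVneq p.[0] 0.
  case: ntx; move/eqP: p0 => /factor_theorem[p' ->].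
  exists (ratfun_of_poly p' / ratfun_of_poly q); first by exists p', q.
  by rewrite polyC0 subr0 rmorphM mulrA [_ * t]mulrC.
have pn := ratfun_of_poly_neq0 p0.
split; first exact: (mulf_neq0 pn (invr_neq0 qn)).
by exists q, p; rewrite invf_div.
Qed.

Lemma max_loc0_unitM x y : O x -> O y -> ~ tO x -> ~ tO y -> ~ tO (x * y).
Proof.
move=> Ox Oy nx ny xy; have [x0 Oxi] := loc0_dich Ox nx.
by apply: ny; rewrite -(mulKf x0 y); exact: max_loc0M.
Qed.

Lemma max_loc0_unitD x y : ~ tO x -> tO y -> ~ tO (x + y).
Proof. by move=> nx ty xy; apply: nx; rewrite -(addrK y x); apply: max_loc0D xy (max_loc0N ty). Qed.

Lemma max_loc0_sub1 x : tO x -> ~ tO (1 - x).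
Proof. by move=> tx; apply: max_loc0_unitD; [exact: max_loc0_1|exact: max_loc0N]. Qed.

(** Denominators are prime to t, and a nonzero polynomial [p] is not divisible by t to the power
    [size p]. *)
Lemma loc0_infinite_order x : (forall k, exists2 y, O y & x = t ^+ k * y) -> x = 0.
Proof.
move=> H; have [_ [p [q [q0 ->]]] xE] := H 0%N; rewrite expr0 mul1r in xE; subst x.
suff -> : p = 0 by rewrite rmorph0 mul0r.
have qn := ratfun_of_poly_neq0 q0.
apply/eqP; apply: contraT => p0.
have [_ [p' [q' [q0' ->]]] E] := H (size p).
have qn' := ratfun_of_poly_neq0 q0'.
have /ratfun_of_poly_inj E' : ratfun_of_poly (p * q') = ratfun_of_poly ('X^(size p) * (p' * q)).
  by rewrite !rmorphM rmorphXn; exact: cross_mul qn qn' E.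
have dv : 'X^(size p) %| p.
  have co : coprimep 'X^(size p) q' by rewrite coprimep_expl // coprimep_sym coprimepX.
  by rewrite -(Gauss_dvdpl p co) E' dvdp_mulr.
have := dvdp_leq p0 dv; by rewrite size_polyXn ltnn.
Qed.

Lemma I2P (i : 'I_2) : i = 0 \/ i = 1.
Proof. by case: i => [[|[|i]] hi]; [left|right|]; try exact: val_inj. Qed.

Definition mk (a b c d : L) : M :=
  \matrix_(i, j) if i == 0 then if j == 0 then a else b else if j == 0 then c else d.

Lemma M2_ext A B : A 0 0 = B 0 0 -> A 0 1 = B 0 1 -> A 1 0 = B 1 0 -> A 1 1 = B 1 1 -> A = B.
Proof.
by move=> h00 h01 h10 h11; apply/matrixP => i j; case: (I2P i) (I2P j) => -> [] ->.
Qed.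

Lemma M2_mulE A B i j : (A * B) i j = A i 0 * B 0 j + A i 1 * B 1 j.
Proof.
rewrite [LHS]mxE big_ord_recl big_ord1; congr (_ * _ + A _ _ * B _ _); exact: val_inj.
Qed.

Lemma M2_addE A B i j : (A + B) i j = A i j + B i j. Proof. exact: mxE. Qed.
Lemma M2_oppE A i j : (- A) i j = - A i j. Proof. exact: mxE. Qed.
Lemma M2_0E i j : (0 : M) i j = 0. Proof. exact: mxE. Qed.
Lemma M2_1E i j : (1 : M) i j = (i == j)%:R. Proof. exact: mxE. Qed.
Lemma M2_scaleE (a : K) A i j : (a *: A) i j = ratfun_of_poly a%:P * A i j.
Proof. by rewrite [LHS]mxE; congr (_ * _); exact: mulr1. Qed.

Lemma mkE a b c d : (mk a b c d 0 0 = a) * (mk a b c d 0 1 = b)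
  * (mk a b c d 1 0 = c) * (mk a b c d 1 1 = d).
Proof. by rewrite !mxE. Qed.

Definition M2E := (M2_mulE, M2_addE, M2_oppE, M2_0E, M2_1E, M2_scaleE, mkE).

Lemma mk_mul a b c d a' b' c' d' : mk a b c d * mk a' b' c' d' =
  mk (a * a' + b * c') (a * b' + b * d') (c * a' + d * c') (c * b' + d * d').
Proof. by apply: M2_ext; rewrite !M2E. Qed.

Lemma mk1 : mk 1 0 0 1 = 1.
Proof. by apply: M2_ext; rewrite !M2E. Qed.

Lemma CKP A : A \in @CK_pred K <-> [/\ O (A 0 0), O (A 1 1), tO (A 0 1) & tO (A 1 0)].
Proof.
split; first by move=> /asboolP H; split; [exact: (H 0 0)|exact: (H 1 1)|exact: (H 0 1)|exact: (H 1 0)].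
by move=> [h00 h11 h01 h10]; apply/asboolP => i j; case: (I2P i) (I2P j) => -> [] ->.
Qed.

Lemma CK_O A i j : A \in @CK_pred K -> O (A i j).
Proof.
move=> /CKP[h00 h11 h01 h10]; case: (I2P i) (I2P j) => -> [] -> //; exact: max_loc0W.
Qed.

(** The off-diagonal entries are divisible by t, so the determinant is a unit when the diagonal
    entries are, and the cofactor formula stays in C_K. *)
Lemma CK_inv A : A \in @CK_pred K -> ~ tO (A 0 0) -> ~ tO (A 1 1) ->
  exists2 B, B \in @CK_pred K & A * B = 1 /\ B * A = 1.
Proof.
move=> AC nA0 nA1; have /CKP[h00 h11 h01 h10] := AC.
pose D := A 0 0 * A 1 1 - A 0 1 * A 1 0.
have nD : ~ tO D.
  apply: max_loc0_unitD; first exact: max_loc0_unitM.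
  by apply/max_loc0N/max_loc0M => //; exact: max_loc0W.
have OD : O D.
  by apply: loc0D; [exact: loc0M|apply/loc0N/loc0M; exact: max_loc0W].
have [D0 ODi] := loc0_dich OD nD.
exists (mk (D^-1 * A 1 1) (D^-1 * - A 0 1) (D^-1 * - A 1 0) (D^-1 * A 0 0)).
  by apply/CKP; rewrite !mkE; split; do ?[exact: loc0M|apply: max_loc0M => //; exact: max_loc0N].
have [[e1 e2 e3 e4] [e5 e6 e7 e8]] := inv2_identities D0.
by split; apply: M2_ext; rewrite !M2E.
Qed.

End Local.

(** * The exchange property and stable rank 1 for subrings *)

Section Relative.
Variable A : pzRingType.
Implicit Types (S : A -> Prop).

(** Stated for a subset [S] of an ambient ring, because all vertices of the cube are subalgebras of
    the one ring M_2(K(t)). *)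
Definition exchange_in S : Prop := forall x, S x -> exists e r s,
  [/\ S e, S r & S s] /\ [/\ e * e = e, e = r * x & e = x + s - s * x].

Definition stable_rank_1_in S : Prop := forall a b x y, S a -> S b -> S x -> S y ->
  a * x + b * y = 1 -> exists c u,
    [/\ S c, S u, (a + b * c) * u = 1 & u * (a + b * c) = 1].

Definition subring_pred S : Prop :=
  [/\ S 1, forall x y, S x -> S y -> S (x - y) & forall x y, S x -> S y -> S (x * y)].

Lemma subring_add S x y : subring_pred S -> S x -> S y -> S (x + y).
Proof.
move=> [S1 SB SM] Sx Sy; rewrite -(opprK y) -[- y]sub0r; apply: (SB) => //; apply: (SB) => //.
by rewrite -(subrr 1); exact: SB.
Qed.

Definition unit_regular_in S : Prop := forall x, S x -> exists v w,
  [/\ S v, S w, v * w = 1, w * v = 1 & x * v * x = x].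

(** [g = v x] is an idempotent with [x g = x], so [g + (1 - g) x = g + (1 - g) x g] is idempotent;
    it equals [x + s - s x] for [s = g]. *)
Lemma unit_regular_exchange S : subring_pred S -> unit_regular_in S -> exchange_in S.
Proof.
move=> SS ur x Sx; have [v [w [Sv Sw vw wv xvx]]] := ur x Sx; have [S1 SB SM] := SS.
have Svx := SM _ _ Sv Sx.
exists ((v + 1 - v * x) * x), (v + 1 - v * x), (v * x); split.
  have Sr : S (v + 1 - v * x) by apply: (SB) => //; exact: subring_add.
  by split=> //; exact: SM.
have E : (v + 1 - v * x) * x = x + v * x - v * x * x by Ncring_tac.non_commutative_ring.
split=> //; rewrite E.
have -> : (x + v * x - v * x * x) * (x + v * x - v * x * x) =
  x * x + x * v * x - x * v * x * x + v * x * x + v * (x * v * x) - v * (x * v * x) * x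
    - v * x * x * x - v * x * (x * v * x) + v * x * (x * v * x) * x.
  by Ncring_tac.non_commutative_ring.
by rewrite xvx; Ncring_tac.non_commutative_ring.
Qed.

(** For the idempotent [e = a v], [(1 - e) a = 0] gives [(1 - e) b y = 1 - e]. With
    [c = y (1 - e) w] one gets [(a + b c) v = 1 + n], where [n = e b y (1 - e)] has square 0. *)
Lemma unit_regular_stable_rank_1 S : subring_pred S -> unit_regular_in S -> stable_rank_1_in S.
Proof.
move=> SS ur a b x y Sa Sb Sx Sy abxy.
have [v [w [Sv Sw vw wv ava]]] := ur a Sa; have [S1 SB SM] := SS.
have [e eE] : {e | e = a * v} by exists (a * v).
have ee : e * e = e by rewrite eE mulrA ava.
have ea : e * a = a by rewrite eE ava.
have Se : S e by rewrite eE; exact: SM.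
have Sf : S (1 - e) by exact: SB.
have fby : (1 - e) * (b * y) = 1 - e.
  have : (1 - e) * (a * x + b * y) = 1 - e by rewrite abxy mulr1.
  by rewrite mulrDr mulrBl mul1r mulrA ea subrr add0r.
have [n nE] : {n | n = e * (b * y) * (1 - e)} by exists (e * (b * y) * (1 - e)).
have Sn : S n by rewrite nE; do 2 apply: (SM) => //; exact: SM.
have fe : (1 - e) * e = 0 by rewrite mulrBl mul1r ee subrr.
have nn : n * n = 0 by rewrite nE -!mulrA (mulrA (1 - e) e) fe mul0r !mulr0.
have acv : (a + b * (y * (1 - e) * w)) * v = 1 + n.
  rewrite mulrDl -eE -!mulrA wv mulr1 (mulrA b).
  have -> : b * y * (1 - e) = e * (b * y) * (1 - e) + (1 - e) * (b * y) * (1 - e).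
    by Ncring_tac.non_commutative_ring.
  rewrite -nE fby mulrBr mulr1 mulrBl mul1r ee subrr subr0.
  by Ncring_tac.non_commutative_ring.
have ac : a + b * (y * (1 - e) * w) = (1 + n) * w by rewrite -acv -(mulrA _ v w) vw mulr1.
exists (y * (1 - e) * w), (v * (1 - n)); split.
- by do 2 apply: (SM) => //.
- by apply: (SM) => //; exact: SB.
- rewrite ac -(mulrA (1 + n) w) (mulrA w v) wv mul1r.
  have -> : (1 + n) * (1 - n) = 1 - n * n by Ncring_tac.non_commutative_ring.
  by rewrite nn subr0.
- rewrite ac mulrA -(mulrA v).
  have -> : (1 - n) * (1 + n) = 1 - n * n by Ncring_tac.non_commutative_ring.
  by rewrite nn subr0 mulr1.
Qed.

(** Conjugating [e] by the unit [w] gives the idempotent: [e w = e x] puts it in the left ideal of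
    [x], and [(1 - e) w = (1 - e) (1 - x)] puts its complement in that of [1 - x]. *)
Lemma corner_unit_exchange S x e u : subring_pred S -> S x -> S e -> S u -> e * e = e ->
  (e * x + (1 - e) * (1 - x)) * u = 1 -> u * (e * x + (1 - e) * (1 - x)) = 1 ->
  exists f r s, [/\ S f, S r & S s] /\ [/\ f * f = f, f = r * x & f = x + s - s * x].
Proof.
move=> SS Sx Se Su ee; set w := e * x + _ => wu uw; have [S1 SB SM] := SS.
have Sw : S w by apply: (subring_add SS); [exact: SM|apply: (SM); exact: SB].
have ew : e * w = e * x.
  have -> : e * w = e * e * x + (e - e * e) * (1 - x) by rewrite /w; Ncring_tac.non_commutative_ring.
  by rewrite ee subrr mul0r addr0.
have fw : (1 - e) * w = (1 - e) * (1 - x).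
  have -> : (1 - e) * w = (e - e * e) * x + (1 - e - e + e * e) * (1 - x).
    by rewrite /w; Ncring_tac.non_commutative_ring.
  by rewrite ee subrr mul0r add0r subrK.
clearbody w.
have Sue := SM _ _ Su Se; have Suf : S (u * (1 - e)) by apply: (SM) => //; exact: SB.
exists (u * e * w), (u * e), (1 - u * (1 - e)); split.
  by split=> //; [exact: SM|exact: SB].
split.
- have -> : u * e * w * (u * e * w) = u * e * (w * u) * e * w by rewrite !mulrA.
  by rewrite wu mulr1 -(mulrA u e e) ee.
- by rewrite -!mulrA ew.
have -> : x + (1 - u * (1 - e)) - (1 - u * (1 - e)) * x = 1 - u * ((1 - e) * (1 - x)).
  by Ncring_tac.non_commutative_ring.
by rewrite -fw -[X in X - _]uw; Ncring_tac.non_commutative_ring.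
Qed.

Variables (P Q : A).
Hypotheses (PQ : P * Q = 1) (QP : Q * P = 1).

Definition conj_in S x : Prop := S (Q * x * P).

Lemma conjM x y : Q * (x * y) * P = (Q * x * P) * (Q * y * P).
Proof. by rewrite !mulrA -(mulrA (Q * x) P Q) PQ mulr1. Qed.

Lemma conjK x : Q * (P * x * Q) * P = x.
Proof. by rewrite !mulrA QP mul1r -mulrA QP mulr1. Qed.

Lemma conj_inj x y : Q * x * P = Q * y * P -> x = y.
Proof.
have K z : P * (Q * z * P) * Q = z by rewrite !mulrA PQ mul1r -mulrA PQ mulr1.
by move=> h; rewrite -(K x) h K.
Qed.

Lemma conjD x y : Q * (x + y) * P = Q * x * P + Q * y * P.
Proof. by rewrite mulrDr mulrDl. Qed.

Lemma conjB x y : Q * (x - y) * P = Q * x * P - Q * y * P.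
Proof. by rewrite mulrBr mulrBl. Qed.

Lemma conj1 : Q * 1 * P = 1.
Proof. by rewrite mulr1 QP. Qed.

Lemma conj_exchange S : exchange_in S -> exchange_in (conj_in S).
Proof.
move=> H x /H[e [r [s [[Se Sr Ss] [ee er es]]]]].
exists (P * e * Q), (P * r * Q), (P * s * Q); rewrite /conj_in !conjK; split=> //.
split; apply: conj_inj; rewrite conjK.
- by rewrite (conjM (P * e * Q)) !conjK.
- by rewrite (conjM (P * r * Q)) conjK.
- by rewrite conjB conjD (conjM (P * s * Q)) conjK.
Qed.

Lemma conj_stable_rank_1 S : stable_rank_1_in S -> stable_rank_1_in (conj_in S).
Proof.
move=> H a b x y Sa Sb Sx Sy abxy.
have [|c [u [Sc Su E1 E2]]] := H _ _ _ _ Sa Sb Sx Sy.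
  by rewrite -!conjM -conjD abxy conj1.
exists (P * c * Q), (P * u * Q); rewrite /conj_in !conjK; split=> //; apply: conj_inj; rewrite conj1.
- by rewrite (conjM _ (P * u * Q)) conjD (conjM b (P * c * Q)) !conjK.
- by rewrite (conjM (P * u * Q)) conjD (conjM b (P * c * Q)) !conjK.
Qed.

End Relative.

Lemma mx_unit_regular (F : fieldType) n (x : 'M[F]_n) : exists v w : 'M[F]_n,
  [/\ v *m w = 1%:M, w *m v = 1%:M & x *m v *m x = x].
Proof.
have uL := col_ebase_unit x; have uR := row_ebase_unit x.
exists (invmx (row_ebase x) *m invmx (col_ebase x)), (col_ebase x *m row_ebase x); split.
- by rewrite mulmxA mulmxKV// mulVmx.
- by rewrite mulmxA mulmxK// mulmxV.
rewrite -{1 4}(mulmx_ebase x) !mulmxA mulmxK// mulmxKV//.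
rewrite -(mulmxA (col_ebase x)) pid_mx_id ?rank_leq_row//.
exact: mulmx_ebase.
Qed.

Section LocalAlgebras.
Variable K : fieldType.
Local Notation M := (M2ratfun K).
Local Notation tO := (@max_loc0 K).

Lemma M2_unit_regular : unit_regular_in (fun _ : M => True).
Proof.
move=> x _; have [v [w [vw wv xvx]]] := mx_unit_regular x.
by exists v, w; split.
Qed.

Definition scalar_in (x : M) : Prop := exists c : K, x = c *: 1.

Definition span_in (a x : M) : Prop := exists c d : K, x = c *: a + d *: (1 - a).

Lemma span_inM (a : M) (c d c' d' : K) : a * a = a ->
  (c *: a + d *: (1 - a)) * (c' *: a + d' *: (1 - a)) = (c * c') *: a + (d * d') *: (1 - a).
Proof.
move=> aa; rewrite mulrDl !mulrDr -!scalerAl -!scalerAr !scalerA.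
have -> : a * (1 - a) = 0 by rewrite mulrBr mulr1 aa subrr.
have -> : (1 - a) * a = 0 by rewrite mulrBl mul1r aa subrr.
have -> : (1 - a) * (1 - a) = 1 - a by rewrite mulrBr mulr1 mulrBl mul1r aa subrr subr0.
by rewrite aa !scaler0 addr0 add0r.
Qed.

Lemma span_in1 (a : M) : 1 *: a + 1 *: (1 - a) = 1.
Proof. by rewrite !scale1r addrC subrK. Qed.

Lemma unit_of (c : K) : exists d e, [/\ d * e = 1, e * d = 1 & c * d * c = c].
Proof.
have [->|c0] := eqVneq c 0; first by exists 1, 1; rewrite !mulr1 mul0r.
by exists c^-1, c; rewrite mulfV// mulVf// mul1r.
Qed.

Lemma span_unit_regular a : a * a = a -> unit_regular_in (span_in a).
Proof.
move=> aa x [c [d ->]]; have [c1 [c2 [h1 h2 h3]]] := unit_of c.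
have [d1 [d2 [k1 k2 k3]]] := unit_of d.
exists (c1 *: a + d1 *: (1 - a)), (c2 *: a + d2 *: (1 - a)); split.
- by exists c1, d1.
- by exists c2, d2.
- by rewrite span_inM// h1 k1 span_in1.
- by rewrite span_inM// h2 k2 span_in1.
- by rewrite !span_inM// h3 k3.
Qed.

Lemma scalar_unit_regular : unit_regular_in scalar_in.
Proof.
move=> x [c ->]; have [c1 [c2 [h1 h2 h3]]] := unit_of c.
have E (u v : K) : (u *: 1) * (v *: 1) = (u * v) *: (1 : M).
  by rewrite -scalerAl mul1r scalerA.
exists (c1 *: 1), (c2 *: 1); rewrite !E h1 h2 h3 !scale1r.
by split=> //; [exists c1|exists c2].
Qed.

Local Notation CKin := (fun x : M => x \in @CK_pred K).

Definition is_unit_loc0 (x : ratfun K) : bool := `[< ~ tO x >].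

(** [E] selects the diagonal entries of [x] that are units. Where [x i i] is not a unit, [1 - x i i]
    is, so [E x + (1 - E) (1 - x)] has unit diagonal entries. *)
Lemma CK_exchange : exchange_in CKin.
Proof.
move=> x xC; have /CKP[x00 x11 x01 x10] := xC.
pose ep (z : ratfun K) : ratfun K := (is_unit_loc0 z)%:R.
pose E := mk (ep (x 0 0)) 0 0 (ep (x 1 1)).
have Oep z : ratfun_loc0 (ep z).
  by rewrite /ep; case: is_unit_loc0; [exact: loc0_1|exact: loc0_0].
have EC : E \in @CK_pred K by apply/CKP; rewrite !mkE; split=> //; exact: max_loc0_0.
have epep z : ep z * ep z = ep z by rewrite /ep; case: is_unit_loc0; rewrite ?mulr1 ?mulr0.
have EE : E * E = E by rewrite /E mk_mul !(mul0r, mulr0, addr0, add0r) !epep.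
pose u := E * x + (1 - E) * (1 - x).
have uC : u \in @CK_pred K by rewrite /u rpredD// rpredM// rpredB// rpred1.
have unitd z : ratfun_loc0 z -> ~ tO (ep z * z + (1 - ep z) * (1 - z)).
  move=> Oz; rewrite /ep; case: (asboolP (~ tO z)) => h; rewrite /is_unit_loc0.
    by rewrite asboolT//= mul1r subrr mul0r addr0.
  rewrite asboolF//= mul0r add0r subr0 mul1r; apply: max_loc0_sub1.
  exact: contrapT.
have [||U UC [uU Uu]] := @CK_inv K u uC.
- by rewrite /u !M2E !(mul0r, addr0, oppr0, sub0r) /= ; exact: unitd.
- by rewrite /u !M2E !(mul0r, add0r, oppr0) /= ; exact: unitd.
apply: (@corner_unit_exchange _ CKin x E U _ xC EC UC EE uU Uu).
by split=> [|? ? ? ?|? ? ? ?]; [exact: rpred1|exact: rpredB|exact: rpredM].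
Qed.

(** The diagonal entries satisfy the relation of [a], [b], [x], [y] modulo t. So where [a i i] is
    not a unit, [b i i] is, and [c] adds it exactly there. *)
Lemma CK_stable_rank_1 : stable_rank_1_in CKin.
Proof.
move=> a b x y aC bC xC yC abxy.
have /CKP[a00 a11 a01 a10] := aC; have /CKP[b00 b11 b01 b10] := bC.
have /CKP[x00 x11 x01 x10] := xC; have /CKP[y00 y11 y01 y10] := yC.
pose ep (z : ratfun K) : ratfun K := (~~ is_unit_loc0 z)%:R.
have Oep z : ratfun_loc0 (ep z).
  by rewrite /ep; case: is_unit_loc0; [exact: loc0_0|exact: loc0_1].
pose c := mk (ep (a 0 0)) 0 0 (ep (a 1 1)).
have cC : c \in @CK_pred K by apply/CKP; rewrite !mkE; split=> //; exact: max_loc0_0.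
have acC : a + b * c \in @CK_pred K by rewrite rpredD// rpredM.
have unitd (p q r s w : ratfun K) : ratfun_loc0 q -> ratfun_loc0 s -> p * q + r * s + w = 1 ->
    tO w -> ~ tO (p + r * ep p).
  move=> Oq Os E tw; rewrite /ep /is_unit_loc0; case: (asboolP (~ tO p)) => h.
    by rewrite /= mulr0 addr0.
  rewrite /= mulr1 => pr; have {}h : tO p by exact: contrapT.
  apply: (@max_loc0_1 K); rewrite -E; apply: max_loc0D => //; apply: max_loc0D.
    exact: max_loc0Mr.
  by rewrite -(addKr p r) mulrDl; apply: max_loc0D; apply: max_loc0Mr => //; exact: max_loc0N.
have [||u uC [h1 h2]] := @CK_inv K (a + b * c) acC.
- rewrite !M2E mulr0 addr0; apply: (unitd _ (x 0 0) _ (y 0 0) (a 0 1 * x 1 0 + b 0 1 * y 1 0)) => //.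
    by have := congr1 (fun m : M => m 0 0) abxy; rewrite !M2E addrACA.
  by apply: max_loc0D; apply: max_loc0Mr => //; exact: max_loc0W.
- rewrite !M2E mulr0 add0r; apply: (unitd _ (x 1 1) _ (y 1 1) (a 1 0 * x 0 1 + b 1 0 * y 0 1)) => //.
    by have := congr1 (fun m : M => m 1 1) abxy; rewrite !M2E addrACA addrC.
  by apply: max_loc0D; apply: max_loc0Mr => //; exact: max_loc0W.
by exists c, u.
Qed.

End LocalAlgebras.

(** * The cube of subalgebras of M_2(K(t)) *)

Section FiniteProducts.
Variable K : fieldType.
Implicit Types A : algType K.

Definition joint_iso A (J : Type) (k : J -> RK_index)
    (p : forall j, {lrmorphism A -> RK_member K (k j)}) : Prop :=
  forall y : (forall j, RK_member K (k j)), exists! x : A, forall j, p j x = y j.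

Lemma finite_product_reindex A (J : finType) (k : J -> RK_index)
    (p : forall j, {lrmorphism A -> RK_member K (k j)}) :
  joint_iso p -> finite_product_of_RK A.
Proof.
move=> jp; exists #|J|, (fun i => k (enum_val i)), (fun i => p (enum_val i)) => y.
pose y' j : RK_member K (k j) :=
  eq_rect _ (fun j => RK_member K (k j)) (y (enum_rank j)) _ (enum_rankK j).
have y'1 x j : (forall i, p (enum_val i) x = y i) -> p j x = y' j.
  have gen j1 (e : j1 = j) : p j x = eq_rect j1 (fun j => RK_member K (k j)) (p j1 x) j e.
    by case: _ / e.
  by move=> H; rewrite /y' -H; exact: gen.
have y'2 x i : (forall j, p j x = y' j) -> p (enum_val i) x = y i.
  move=> H; rewrite H /y'; move: (enum_rankK (enum_val i)).
  move: (enum_rank (enum_val i)) (enum_valK i) => i' ii'; subst i' => e.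
  by rewrite (eq_irrelevance e erefl).
have [x [xy' xu]] := jp y'; exists x; split=> [i|x' x'y]; first exact: y'2.
by apply: xu => j; exact: y'1.
Qed.

Lemma finite_product_trans A (J : finType) (T : J -> algType K)
    (q : forall z, {lrmorphism A -> T z}) :
  (forall y : (forall z, T z), exists! x : A, forall z, q z x = y z) ->
  (forall z, finite_product_of_RK (T z)) -> finite_product_of_RK A.
Proof.
move=> jq fp.
pose n z := sval (cid (fp z)).
pose fk z := cid (svalP (cid (fp z))).
pose k z : 'I_(n z) -> RK_index := sval (fk z).
pose fpp z := cid (svalP (fk z)).
pose p z : forall i, {lrmorphism T z -> RK_member K (k z i)} := sval (fpp z).
have jp z : joint_iso (p z) := svalP (fpp z).
apply: (@finite_product_reindex A {z : J & 'I_(n z)} (fun s => k (tag s) (tagged s))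
  (fun s => (p (tag s) (tagged s) \o q (tag s))%FUN)) => y.
pose yz z : T z := sval (cid (jp z (fun i => y (Tagged _ i)))).
have yzP z := svalP (cid (jp z (fun i => y (Tagged (fun z => 'I_(n z)) i)))).
have [x [xq xu]] := jq yz; exists x; split.
  by move=> [z i] /=; rewrite xq; case: (yzP z) => ->.
move=> x' x'y; apply: xu => z; case: (yzP z) => _ yu; apply/esym/yu => i.
exact: (x'y (Tagged (fun z => 'I_(n z)) i)).
Qed.

Lemma finite_product_iso A (k : RK_index) (f : {lrmorphism A -> RK_member K k}) :
  bijective f -> finite_product_of_RK A.
Proof.
move=> [g fg gf].
apply: (@finite_product_reindex A unit (fun=> k) (fun=> f)) => y.
exists (g (y tt)); split=> [[]|x xy]; first exact: gf.
by rewrite -(xy tt) fg.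
Qed.

End FiniteProducts.

Section Vertices.
Variable K : fieldType.
Local Notation M := (M2ratfun K).
Local Notation t := (t_ratfun K).
Local Notation tO := (@max_loc0 K).
Local Notation CKin := (fun x : M => x \in @CK_pred K).

Definition at1 : M := mk 0 0 0 1.
Definition at2 : M := mk 0 0 (-1) 1.
Definition at3 : M := mk 1 (-1) 0 0.

(** Each conjugation brings two of the idempotents into C_K. There [at1] and [at2] are congruent
    modulo t for [P12], [at2] and [at3] for [P23], and [at1] and [1 - at3] for [P13]. *)
Definition P12 : M := mk t 0 0 1.
Definition Q12 : M := mk t^-1 0 0 1.
Definition P23 : M := mk t 1 0 1.
Definition Q23 : M := mk t^-1 (- t^-1) 0 1.
Definition P13 : M := mk 0 1 t 0.
Definition Q13 : M := mk 0 t^-1 1 0.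

Local Notation L := (ratfun K).
Definition mksimp := (@mul0r L, @mulr0 L, @mul1r L, @mulr1 L, @addr0 L, @add0r L, @mulrN L,
  @mulNr L, @opprK L, @oppr0 L, mulfV (t_neq0 K), mulVf (t_neq0 K), @addNr L, @subrr L).

Lemma at1_idem : at1 * at1 = at1.
Proof. by rewrite /at1 mk_mul !mksimp. Qed.
Lemma at2_idem : at2 * at2 = at2.
Proof. by rewrite /at2 mk_mul !mksimp. Qed.
Lemma at3_idem : at3 * at3 = at3.
Proof. by rewrite /at3 mk_mul !mksimp. Qed.

Lemma PQ12 : P12 * Q12 = 1 /\ Q12 * P12 = 1.
Proof. by rewrite /P12 /Q12 !mk_mul !mksimp mk1. Qed.
Lemma PQ23 : P23 * Q23 = 1 /\ Q23 * P23 = 1.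
Proof. by rewrite /P23 /Q23 !mk_mul !mksimp mk1. Qed.
Lemma PQ13 : P13 * Q13 = 1 /\ Q13 * P13 = 1.
Proof. by rewrite /P13 /Q13 !mk_mul !mksimp mk1. Qed.

Lemma at1_12 : Q12 * at1 * P12 = mk 0 0 0 1.
Proof. by rewrite /Q12 /at1 /P12 !mk_mul !mksimp. Qed.
Lemma at2_12 : Q12 * at2 * P12 = mk 0 0 (- t) 1.
Proof. by rewrite /Q12 /at2 /P12 !mk_mul !mksimp. Qed.
Lemma at2_23 : Q23 * at2 * P23 = mk 1 0 (- t) 0.
Proof. by rewrite /Q23 /at2 /P23 !mk_mul !mksimp. Qed.
Lemma at3_23 : Q23 * at3 * P23 = mk 1 0 0 0.
Proof. by rewrite /Q23 /at3 /P23 !mk_mul !mksimp. Qed.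
Lemma at1_13 : Q13 * at1 * P13 = mk 1 0 0 0.
Proof. by rewrite /Q13 /at1 /P13 !mk_mul !mksimp. Qed.
Lemma at3_13 : Q13 * at3 * P13 = mk 0 0 (- t) 1.
Proof. by rewrite /Q13 /at3 /P13 !mk_mul !mksimp. Qed.

Definition coatom12 : M -> Prop := conj_in P12 Q12 CKin.
Definition coatom23 : M -> Prop := conj_in P23 Q23 CKin.
Definition coatom13 : M -> Prop := conj_in P13 Q13 CKin.

Lemma mk_CK a b c d : ratfun_loc0 a -> ratfun_loc0 d -> tO b -> tO c -> CKin (mk a b c d).
Proof. by move=> ? ? ? ?; apply/CKP; rewrite !mkE. Qed.

Lemma tO_Nt : tO (- t).
Proof. by apply/max_loc0N; exists 1; [exact: loc0_1|rewrite mulr1]. Qed.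

Lemma at_coatoms : [/\ coatom12 at1 /\ coatom12 at2, coatom23 at2 /\ coatom23 at3
  & coatom13 at1 /\ coatom13 at3].
Proof.
rewrite /coatom12 /coatom23 /coatom13 /conj_in at1_12 at2_12 at2_23 at3_23 at1_13 at3_13.
have l0 := loc0_0 K; have l1 := loc0_1 K; have m0 := max_loc0_0 K; have mt := tO_Nt.
by split; split; exact: mk_CK.
Qed.

(* The vertices of the cube, as subalgebras of M_2(K(t)): a vertex is a subset of
   {1, 2, 3}. Seen in the Bruhat-Tits tree of GL_2(K(t)) at t, the coatoms are stabilizers
   of paths of length 2 on the three arms of a tripod, and the atoms fix the apartments
   joining two of its ends; along the paths the apartments are oriented alike, except
   that those of 1 and 3 are opposite. *)
Definition vertex (d : bool * bool * bool) : M -> Prop :=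
  match d with
  | (false, false, false) => @scalar_in K
  | (true, false, false) => span_in at1
  | (false, true, false) => span_in at2
  | (false, false, true) => span_in at3
  | (true, true, false) => coatom12
  | (false, true, true) => coatom23
  | (true, false, true) => coatom13
  | (true, true, true) => fun=> True
  end.

Definition subalg_prop (S : M -> Prop) : Prop :=
  [/\ S 1, forall (c : K) x y, S x -> S y -> S (c *: x + y)
    & forall x y, S x -> S y -> S (x * y)].

Lemma span_subalg a : a * a = a -> subalg_prop (span_in a).
Proof.
move=> aa; split.
- by exists 1, 1; rewrite span_in1.
- move=> c _ _ [x1 [x2 ->]] [y1 [y2 ->]]; exists (c * x1 + y1), (c * x2 + y2).
  by rewrite scalerDr !scalerA !scalerDl addrACA.
- by move=> _ _ [x1 [x2 ->]] [y1 [y2 ->]]; rewrite span_inM//; exists (x1 * y1), (x2 * y2).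
Qed.

Lemma scalar_subalg : subalg_prop (@scalar_in K).
Proof.
split.
- by exists 1; rewrite scale1r.
- by move=> c _ _ [x ->] [y ->]; exists (c * x + y); rewrite scalerA scalerDl.
- by move=> _ _ [x ->] [y ->]; exists (x * y); rewrite -scalerAl mul1r scalerA.
Qed.

Lemma conj_subalg (P Q : M) : P * Q = 1 -> Q * P = 1 -> subalg_prop (conj_in P Q CKin).
Proof.
move=> PQ QP; rewrite /conj_in; split.
- by rewrite (conj1 QP) rpred1.
- move=> c x y Cx Cy; rewrite conjD -scalerAr -scalerAl.
  exact: (rpredD (rpredZ c Cx) Cy).
- by move=> x y Cx Cy; rewrite (conjM PQ); exact: (rpredM Cx Cy).
Qed.

Lemma vertex_subalg d : subalg_prop (vertex d).
Proof.
have [[p12 q12] [p23 q23] [p13 q13]] := And3 PQ12 PQ23 PQ13.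
case: d => [[[] []] []].
- by [].
- exact: (conj_subalg p12 q12).
- exact: (conj_subalg p13 q13).
- exact: (span_subalg at1_idem).
- exact: (conj_subalg p23 q23).
- exact: (span_subalg at2_idem).
- exact: (span_subalg at3_idem).
- exact: scalar_subalg.
Qed.

Lemma subalg_subring S : subalg_prop S -> subring_pred S.
Proof.
move=> [S1 SD SM]; split=> // x y Sx Sy.
by rewrite addrC -scaleN1r; exact: SD.
Qed.

Lemma vertex_exchange d : exchange_in (vertex d).
Proof.
have [[p12 q12] [p23 q23] [p13 q13]] := And3 PQ12 PQ23 PQ13.
have R := subalg_subring (vertex_subalg d); move: R.
case: d => [[[] []] []] R.
- exact: (unit_regular_exchange R (@M2_unit_regular K)).
- exact: (conj_exchange p12 q12 (@CK_exchange K)).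
- exact: (conj_exchange p13 q13 (@CK_exchange K)).
- exact: (unit_regular_exchange R (span_unit_regular at1_idem)).
- exact: (conj_exchange p23 q23 (@CK_exchange K)).
- exact: (unit_regular_exchange R (span_unit_regular at2_idem)).
- exact: (unit_regular_exchange R (span_unit_regular at3_idem)).
- exact: (unit_regular_exchange R (@scalar_unit_regular K)).
Qed.

Lemma vertex_stable_rank_1 d : stable_rank_1_in (vertex d).
Proof.
have [[p12 q12] [p23 q23] [p13 q13]] := And3 PQ12 PQ23 PQ13.
have R := subalg_subring (vertex_subalg d); move: R.
case: d => [[[] []] []] R.
- exact: (unit_regular_stable_rank_1 R (@M2_unit_regular K)).
- exact: (conj_stable_rank_1 p12 q12 (@CK_stable_rank_1 K)).
- exact: (conj_stable_rank_1 p13 q13 (@CK_stable_rank_1 K)).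
- exact: (unit_regular_stable_rank_1 R (span_unit_regular at1_idem)).
- exact: (conj_stable_rank_1 p23 q23 (@CK_stable_rank_1 K)).
- exact: (unit_regular_stable_rank_1 R (span_unit_regular at2_idem)).
- exact: (unit_regular_stable_rank_1 R (span_unit_regular at3_idem)).
- exact: (unit_regular_stable_rank_1 R (@scalar_unit_regular K)).
Qed.

Definition dom_le (d d' : bool * bool * bool) : bool :=
  [&& d.1.1 ==> d'.1.1, d.1.2 ==> d'.1.2 & d.2 ==> d'.2].

Lemma vertex_mono d d' x : dom_le d d' -> vertex d x -> vertex d' x.
Proof.
have sc e y : scalar_in y -> vertex e y.
  move=> [c ->]; have [S1 SD _] := vertex_subalg e.
  have S0 : vertex e 0 by have := SD (-1) 1 1 S1 S1; rewrite scaleN1r addNr.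
  by rewrite -[_ *: _]addr0; exact: SD.
have sp e a y : vertex e a -> span_in a y -> vertex e y.
  move=> ea [c1 [c2 ->]]; have [S1 SD _] := vertex_subalg e.
  have S0 : vertex e 0 by have := SD (-1) 1 1 S1 S1; rewrite scaleN1r addNr.
  apply: (SD) => //; rewrite -[_ *: _]addr0; apply: (SD) => //.
  by rewrite addrC -scaleN1r; exact: SD.
have [[c1 c2] [c3 c4] [c5 c6]] := at_coatoms.
have self a : span_in a a by exists 1, 0; rewrite scale1r scale0r addr0.
(* [d'] is written as a join with [d], so that the case analysis meets only pairs with [d] below
   [d']. *)
have up b1 b2 b3 : dom_le (b1, b2, b3) d' ->
    exists c1 c2 c3, d' = (b1 || c1, b2 || c2, b3 || c3).
  case: d' => [[c1' c2'] c3'] /and3P[/implyP/= i1 /implyP/= i2 /implyP/= i3].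
  exists c1', c2', c3'; congr (_, _, _).
  - by case: b1 i1 => //= ->.
  - by case: b2 i2 => //= ->.
  - by case: b3 i3 => //= ->.
case: d => [[b1 b2] b3] /up[e1 [e2 [e3 ->]]] {up d'}.
case: b1 b2 b3 e1 e2 e3 => [] [] [] e1 e2 e3.
- exact.
- by case: e3 => [_|]; [exact: Logic.I|exact].
- by case: e2 => [_|]; [exact: Logic.I|exact].
- apply: (sp _ at1); case: e2 e3 => [] [].
  + exact: Logic.I.
  + exact: c1.
  + exact: c5.
  + exact: self.
- by case: e1 => [_|]; [exact: Logic.I|exact].
- apply: (sp _ at2); case: e1 e3 => [] [].
  + exact: Logic.I.
  + exact: c2.
  + exact: c3.
  + exact: self.
- apply: (sp _ at3); case: e1 e2 => [] [].
  + exact: Logic.I.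
  + exact: c6.
  + exact: c4.
  + exact: self.
- exact: sc.
Qed.

Lemma vertex_pred_closed d : subalg_closed (fun x : M => `[< vertex d x >]).
Proof.
have [S1 SD SM] := vertex_subalg d; split; first exact/asboolP.
- by move=> c x y /asboolP Sx /asboolP Sy; apply/asboolP; exact: SD.
- by move=> x y /asboolP Sx /asboolP Sy; apply/asboolP; exact: SM.
Qed.

Definition vertex_alg d : subalg M := SubAlg (vertex_pred_closed d).

Lemma vertex_algP d x : reflect (vertex d x) (x \in vertex_alg d).
Proof. exact: asboolP. Qed.

Section SpanProduct.
Variables (S : subalg M) (a : M).
Hypothesis SE : forall x, reflect (span_in a x) (x \in S).
Hypotheses (aa : a * a = a) (a0 : a != 0) (a1 : 1 - a != 0).

Lemma span_coord_inj (c d c' d' : K) :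
  c *: a + d *: (1 - a) = c' *: a + d' *: (1 - a) -> c = c' /\ d = d'.
Proof.
move=> E; have ca : a * (1 - a) = 0 by rewrite mulrBr mulr1 aa subrr.
have ac : (1 - a) * a = 0 by rewrite mulrBl mul1r aa subrr.
have ff : (1 - a) * (1 - a) = 1 - a by rewrite mulrBr mulr1 mulrBl mul1r aa subrr subr0.
split; apply/eqP; rewrite -subr_eq0.
  have := congr1 (fun x => x * a) E; rewrite !mulrDl -!scalerAl aa ac !scaler0 !addr0.
  by move/eqP; rewrite -subr_eq0 -scalerBl scaler_eq0 (negbTE a0) orbF.
have := congr1 (fun x => x * (1 - a)) E; rewrite !mulrDl -!scalerAl ff ca !scaler0 !add0r.
by move/eqP; rewrite -subr_eq0 -scalerBl scaler_eq0 (negbTE a1) orbF.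
Qed.

Lemma span_coordP (x : sub_of S) : {c : K * K | sub_val x = c.1 *: a + c.2 *: (1 - a)}.
Proof. by apply: cid; have /SE[c [d xE]] := sub_valP x; exists (c, d). Qed.

Definition span_coord (b : bool) (x : sub_of S) : K^o :=
  if b then (sval (span_coordP x)).1 else (sval (span_coordP x)).2.

Lemma span_coordE (x : sub_of S) (c d : K) : sub_val x = c *: a + d *: (1 - a) ->
  span_coord true x = c /\ span_coord false x = d.
Proof.
move=> xE; rewrite /span_coord; have E := svalP (span_coordP x).
by apply: span_coord_inj; rewrite -xE; exact/esym/E.
Qed.

Lemma span_coord_eta (x : sub_of S) :
  sub_val x = (span_coord true x : K) *: a + (span_coord false x : K) *: (1 - a).
Proof. exact: (svalP (span_coordP x)). Qed.

Lemma span_coord_linear b : linear (span_coord b).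
Proof.
move=> c x y.
have [] := @span_coordE (c *: x + y) (c * span_coord true x + span_coord true y)
  (c * span_coord false x + span_coord false y).
  rewrite sub_valD sub_valZ {1}(span_coord_eta x) {1}(span_coord_eta y).
  by rewrite scalerDr !scalerA !scalerDl addrACA.
by case: b.
Qed.

Lemma span_coord_monoid b : monoid_morphism (span_coord b).
Proof.
split=> [|x y].
  by have [] := @span_coordE 1 1 1; [rewrite sub_val1 span_in1|case: b].
have [] := @span_coordE (x * y) (span_coord true x * span_coord true y)
  (span_coord false x * span_coord false y).
  by rewrite sub_valM {1}(span_coord_eta x) {1}(span_coord_eta y) span_inM.
by case: b.
Qed.

Lemma span_finite_product : finite_product_of_RK (sub_of S).
Proof.
apply: (@finite_product_reindex K (sub_of S) bool (fun=> RK_field)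
  (fun b => lrmorphism_of (span_coord_linear b) (span_coord_monoid b))) => y.
pose x : M := (y true : K) *: a + (y false : K) *: (1 - a).
have xS : x \in S by apply/SE; exists (y true), (y false).
have [e1 e2] := @span_coordE (SubOf xS) _ _ erefl.
exists (SubOf xS); split=> [[]//|x' x'y].
have e3 : span_coord true x' = y true := x'y true.
have e4 : span_coord false x' = y false := x'y false.
by apply: sub_inj; rewrite (span_coord_eta x') e3 e4.
Qed.

End SpanProduct.

Section ScalarProduct.
Variable S : subalg M.
Hypothesis SE : forall x, reflect (scalar_in x) (x \in S).

Lemma scalar_coord_inj (c d : K) : c *: (1 : M) = d *: 1 -> c = d.
Proof.
move=> /eqP; rewrite -subr_eq0 -scalerBl scaler_eq0 oner_eq0 orbF subr_eq0.
by move/eqP.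
Qed.

Lemma scalar_coordP (x : sub_of S) : {c : K | sub_val x = c *: 1}.
Proof. by apply: cid; have /SE[c xE] := sub_valP x; exists c. Qed.

Definition scalar_coord (x : sub_of S) : K^o := sval (scalar_coordP x).

Lemma scalar_coordE (x : sub_of S) (c : K) : sub_val x = c *: 1 -> scalar_coord x = c.
Proof.
by move=> xE; apply: scalar_coord_inj; rewrite -xE; exact/esym/(svalP (scalar_coordP x)).
Qed.

Lemma scalar_coord_eta (x : sub_of S) : sub_val x = (scalar_coord x : K) *: 1.
Proof. exact: (svalP (scalar_coordP x)). Qed.

Lemma scalar_coord_linear : linear scalar_coord.
Proof.
move=> c x y; apply: (@scalar_coordE _ (c * scalar_coord x + scalar_coord y)).
by rewrite sub_valD sub_valZ {1}(scalar_coord_eta x) {1}(scalar_coord_eta y) scalerA scalerDl.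
Qed.

Lemma scalar_coord_monoid : monoid_morphism scalar_coord.
Proof.
split=> [|x y]; first by apply: scalar_coordE; rewrite sub_val1 scale1r.
apply: (@scalar_coordE _ (scalar_coord x * scalar_coord y)).
by rewrite sub_valM {1}(scalar_coord_eta x) {1}(scalar_coord_eta y) -scalerAl mul1r scalerA.
Qed.

Lemma scalar_finite_product : finite_product_of_RK (sub_of S).
Proof.
apply: (@finite_product_iso K (sub_of S) RK_field
  (lrmorphism_of scalar_coord_linear scalar_coord_monoid)).
have cS (c : K) : c *: (1 : M) \in S by apply/SE; exists c.
exists (fun c : K => SubOf (cS c)) => [x|c] /=.
  by apply: sub_inj; rewrite /= -scalar_coord_eta.
exact: scalar_coordE.
Qed.

End ScalarProduct.

Section ConjProduct.
Variables (S : subalg M) (P Q : M).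
Hypotheses (PQ : P * Q = 1) (QP : Q * P = 1).
Hypothesis SE : forall x, reflect (conj_in P Q CKin x) (x \in S).

Lemma conj_coordP (x : sub_of S) : Q * sub_val x * P \in @CK_pred K.
Proof. by have /SE := sub_valP x. Qed.

Definition conj_coord (x : sub_of S) : CK K := MkCK (conj_coordP x).

Lemma conj_coord_linear : linear conj_coord.
Proof.
by move=> c x y; apply: val_inj => /=; rewrite conjD -scalerAr -scalerAl.
Qed.

Lemma conj_coord_monoid : monoid_morphism conj_coord.
Proof.
by split=> [|x y]; apply: val_inj => /=; [rewrite conj1|rewrite conjM].
Qed.

Lemma conj_finite_product : finite_product_of_RK (sub_of S).
Proof.
apply: (@finite_product_iso K (sub_of S) RK_C
  (lrmorphism_of conj_coord_linear conj_coord_monoid)).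
have cS (c : CK K) : P * CK_val c * Q \in S.
  by apply/SE; rewrite /conj_in conjK//; exact: valP.
exists (fun c : CK K => SubOf (cS c)) => [x|c] /=.
  by apply: sub_inj => /=; rewrite !mulrA PQ mul1r -mulrA PQ mulr1.
by apply: val_inj => /=; rewrite conjK.
Qed.

End ConjProduct.

Lemma full_finite_product (S : subalg M) : (forall x, x \in S) -> finite_product_of_RK (sub_of S).
Proof.
move=> ST; have lf : linear (@sub_val _ _ S : sub_of S -> M2ratfun K) by [].
have mf : monoid_morphism (@sub_val _ _ S : sub_of S -> M2ratfun K) by [].
apply: (@finite_product_iso K (sub_of S) RK_M2 (lrmorphism_of lf mf)).
by exists (fun x => SubOf (ST x)) => [x|//]; exact: sub_inj.
Qed.

Lemma vertex_finite_product d : finite_product_of_RK (sub_of (vertex_alg d)).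
Proof.
have [[p12 q12] [p23 q23] [p13 q13]] := And3 PQ12 PQ23 PQ13.
have n1 : at1 != 0 /\ 1 - at1 != 0.
  by split; apply/eqP => /(congr1 (fun m : M => (m 0 0, m 1 1))) []; rewrite !M2E ?subr0;
    [move=> _|move=> + _] => /eqP; rewrite oner_eq0.
have n2 : at2 != 0 /\ 1 - at2 != 0.
  by split; apply/eqP => /(congr1 (fun m : M => (m 0 0, m 1 1))) []; rewrite !M2E ?subr0;
    [move=> _|move=> + _] => /eqP; rewrite oner_eq0.
have n3 : at3 != 0 /\ 1 - at3 != 0.
  by split; apply/eqP => /(congr1 (fun m : M => (m 0 0, m 1 1))) []; rewrite !M2E ?subr0;
    [move=> + _|move=> _] => /eqP; rewrite oner_eq0.
have E := @vertex_algP d; move: E; case: d => [[[] []] []] E.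
- by apply: full_finite_product => x; exact/E.
- exact: (conj_finite_product p12 q12 E).
- exact: (conj_finite_product p13 q13 E).
- exact: (span_finite_product E at1_idem n1.1 n1.2).
- exact: (conj_finite_product p23 q23 E).
- exact: (span_finite_product E at2_idem n2.1 n2.2).
- exact: (span_finite_product E at3_idem n3.1 n3.2).
- exact: (scalar_finite_product E).
Qed.

End Vertices.

(** An alias, to carry inclusion as its order. *)
Definition finsubs (T : choiceType) : Type := {fset T}.

(** * The condensate *)

Section FsubOrder.
Variable T : choiceType.
HB.instance Definition _ := Choice.on (finsubs T).
Let fsub_le (A B : finsubs T) : bool := (A `<=` B)%fset.
Let fsub_refl : reflexive fsub_le. Proof. by move=> A; exact: fsubset_refl. Qed.
Let fsub_anti : antisymmetric fsub_le.
Proof. by move=> A B; rewrite /fsub_le -eqEfsubset => /eqP. Qed.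
Let fsub_trans : transitive fsub_le.
Proof. by move=> A B C; exact: fsubset_trans. Qed.
HB.instance Definition _ :=
  Order.Le_isPOrder.Build Order.default_display (finsubs T) fsub_refl fsub_anti fsub_trans.

Lemma fsub_leE (A B : finsubs T) : (A <= B)%O = (A `<=` B)%fset.
Proof. by []. Qed.
End FsubOrder.

Section Condensate.
Variables (K : fieldType) (W : choiceType).
Local Notation M := (M2ratfun K).

(* A point is a partial function from {1, 2, 3} to W. *)
Definition points : Type := (option W * option W * option W)%type.
HB.instance Definition _ := Pointed.copy points (option W * option W * option W)%type.
Implicit Types (S T : {fset W}) (w z : points).

Definition orestr S (o : option W) : option W :=
  if o is Some a then if a \in S then Some a else None else None.

Definition restr S w : points := (orestr S w.1.1, orestr S w.1.2, orestr S w.2).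

Definition pdom w : bool * bool * bool := (isSome w.1.1, isSome w.1.2, isSome w.2).

Lemma orestrI S T o : (S `<=` T)%fset -> orestr S (orestr T o) = orestr S o.
Proof.
move=> /fsubsetP ST; case: o => //= a; have := ST a.
by case aT : (a \in T) => //=; case: ifP => // aS /(_ isT).
Qed.

Lemma restrI S T w : (S `<=` T)%fset -> restr S (restr T w) = restr S w.
Proof. by move=> ST; rewrite /restr /= !orestrI. Qed.

Lemma restrK S w : restr S (restr S w) = restr S w.
Proof. by rewrite restrI. Qed.

Lemma pdom_restr S w : dom_le (pdom (restr S w)) (pdom w).
Proof.
have H o : isSome (orestr S o) ==> isSome o by case: o => [a|] //=; rewrite implybT.
by rewrite /dom_le /= !H.
Qed.

(** As [r w] equals [r (restr S w)], it even lies in the algebra of the smaller domain. An element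
    of the stage thus amounts to independent choices at the finitely many points with values in
    [S]. *)
Definition stage_prop S (r : fun_alg points M) : Prop :=
  forall w, r w = r (restr S w) /\ vertex (pdom w) (r w).

Definition stage_pred S : {pred fun_alg points M} := fun r => `[< stage_prop S r >].

Lemma stage_closed S : subalg_closed (stage_pred S).
Proof.
split.
- by apply/asboolP => w; split=> //; case: (vertex_subalg K (pdom w)).
- move=> c x y /asboolP Sx /asboolP Sy; apply/asboolP => w.
  have [x1 x2] := Sx w; have [y1 y2] := Sy w; rewrite !fun_algD !fun_algZ -x1 -y1; split=> //.
  by case: (vertex_subalg K (pdom w)) => _ + _; apply.
- move=> x y /asboolP Sx /asboolP Sy; apply/asboolP => w.
  have [x1 x2] := Sx w; have [y1 y2] := Sy w; rewrite !fun_algM -x1 -y1; split=> //.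
  by case: (vertex_subalg K (pdom w)) => _ _; apply.
Qed.

Definition stage (S : finsubs W) : subalg (fun_alg points M) := SubAlg (stage_closed S).

Lemma stageP S r : reflect (stage_prop S r) (r \in stage S).
Proof. exact: asboolP. Qed.

Lemma stage_mono (S T : finsubs W) : (S <= T)%O -> {subset stage S <= stage T}.
Proof.
rewrite fsub_leE => ST r /stageP Sr; apply/stageP => w; split; last by case: (Sr w).
by rewrite (Sr w).1 (Sr (restr T w)).1 restrI.
Qed.

Lemma stage_upper (S T : finsubs W) : exists U : finsubs W, (S <= U)%O /\ (T <= U)%O.
Proof. by exists (S `|` T)%fset; rewrite !fsub_leE fsubsetUl fsubsetUr. Qed.

Definition condensate_pred : {pred fun_alg points M} := fun r => `[< exists S, r \in stage S >].

Lemma condensate_closed : subalg_closed condensate_pred.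
Proof.
split.
- by apply/asboolP; exists fset0; exact: rpred1.
- move=> c x y /asboolP[S Sx] /asboolP[T Ty]; have [U [SU TU]] := stage_upper S T.
  apply/asboolP; exists U; apply: rpredD; first apply: rpredZ.
    exact: stage_mono Sx.
  exact: stage_mono Ty.
- move=> x y /asboolP[S Sx] /asboolP[T Ty]; have [U [SU TU]] := stage_upper S T.
  apply/asboolP; exists U; apply: rpredM.
    exact: stage_mono Sx.
  exact: stage_mono Ty.
Qed.

Definition condensate : subalg (fun_alg points M) := SubAlg condensate_closed.

Lemma condensateP r : reflect (exists S, stage_prop S r) (r \in condensate).
Proof.
apply: (iffP (asboolP _)) => -[S Sr]; exists S; first exact/stageP.
exact/stageP.
Qed.

Lemma stage_condensate (S : finsubs W) : {subset stage S <= condensate}.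
Proof. by move=> r Sr; apply/asboolP; exists S. Qed.

Definition RK : algType K := sub_of condensate.
Implicit Types (x y r : RK).

Definition ev w r : M := sub_val r w.

Lemma evD w x y : ev w (x + y) = ev w x + ev w y. Proof. by []. Qed.
Lemma evB w x y : ev w (x - y) = ev w x - ev w y. Proof. by []. Qed.
Lemma evM w x y : ev w (x * y) = ev w x * ev w y. Proof. by []. Qed.
Lemma ev1 w : ev w 1 = 1. Proof. by []. Qed.
Lemma ev0 w : ev w 0 = 0. Proof. by []. Qed.

Lemma ev_inj x y : (forall w, ev w x = ev w y) -> x = y.
Proof. by move=> xy; apply/sub_inj/funext. Qed.

Lemma ev_vertex w x : vertex (pdom w) (ev w x).
Proof. by have /condensateP[S /(_ w)[]] := sub_valP x. Qed.

Lemma ev_support x : exists S, forall w, ev w x = ev (restr S w) x.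
Proof. by have /condensateP[S Sx] := sub_valP x; exists S => w; case: (Sx w). Qed.

Lemma ev_support_mono S T x : (S `<=` T)%fset -> (forall w, ev w x = ev (restr S w) x) ->
  forall w, ev w x = ev (restr T w) x.
Proof. by move=> ST Sx w; rewrite Sx (Sx (restr T w)) restrI. Qed.

Lemma ev_supports (s : seq RK) : exists S, forall x, x \in s -> forall w, ev w x = ev (restr S w) x.
Proof.
elim: s => [|x s [S Ss]]; first by exists fset0.
have [T Tx] := ev_support x; exists (S `|` T)%fset => y.
rewrite inE => /orP[/eqP->|/Ss Sy]; first exact: ev_support_mono (fsubsetUr _ _) Tx.
exact: ev_support_mono (fsubsetUl _ _) Sy.
Qed.

(** Pointwise choices become an element of the algebra once they are read at [restr S w]. If [S]
    supports the given elements, what can be solved at every point can thus be solved in [RK]. *)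
Lemma stage_lift_proof S (g : points -> M) : (forall w, vertex (pdom w) (g w)) ->
  ((fun w => g (restr S w)) : fun_alg points M) \in condensate.
Proof.
move=> gv; apply/condensateP; exists S => w; rewrite restrK; split=> //.
exact: vertex_mono (pdom_restr S w) (gv _).
Qed.

Definition stage_lift S g (gv : forall w, vertex (pdom w) (g w)) : RK := SubOf (stage_lift_proof S gv).

Lemma ev_stage_lift S g gv w : ev w (@stage_lift S g gv) = g (restr S w).
Proof. by []. Qed.

Lemma RK_exchange : exchange_ring (rng_of RK).
Proof.
move=> x; have [S Sx] := ev_support x.
have loc w : {t : M * M * M | [/\ vertex (pdom w) t.1.1, vertex (pdom w) t.1.2 & vertex (pdom w) t.2]
    /\ [/\ t.1.1 * t.1.1 = t.1.1, t.1.1 = t.1.2 * ev w x & t.1.1 = ev w x + t.2 - t.2 * ev w x]}.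
  by apply: cid; have [e [r [s H]]] := vertex_exchange (ev_vertex w x); exists (e, r, s).
have v1 w : vertex (pdom w) (sval (loc w)).1.1 by case: (svalP (loc w)) => -[].
have v2 w : vertex (pdom w) (sval (loc w)).1.2 by case: (svalP (loc w)) => -[].
have v3 w : vertex (pdom w) (sval (loc w)).2 by case: (svalP (loc w)) => -[].
exists (stage_lift S v1), (stage_lift S v2), (stage_lift S v3); split; apply: ev_inj => w.
- by rewrite [LHS]evM !ev_stage_lift; case: (svalP (loc (restr S w))) => _ [].
- by rewrite [RHS]evM !ev_stage_lift (Sx w); case: (svalP (loc (restr S w))) => _ [].
- by rewrite [RHS]evB evD evM !ev_stage_lift (Sx w); case: (svalP (loc (restr S w))) => _ [].
Qed.

Lemma RK_stable_rank_1 : stable_rank_1 RK.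
Proof.
move=> a b [x [y abxy]].
have [S Ss] := ev_supports [:: a; b].
have Sa : forall w, ev w a = ev (restr S w) a by apply: Ss; rewrite !inE eqxx.
have Sb : forall w, ev w b = ev (restr S w) b by apply: Ss; rewrite !inE eqxx orbT.
have loc w : {t : M * M | [/\ vertex (pdom w) t.1, vertex (pdom w) t.2,
    (ev w a + ev w b * t.1) * t.2 = 1 & t.2 * (ev w a + ev w b * t.1) = 1]}.
  apply: cid; have [|c [u H]] := vertex_stable_rank_1 (ev_vertex w a) (ev_vertex w b)
    (ev_vertex w x) (ev_vertex w y); last by exists (c, u).
  by rewrite -!evM -evD abxy.
have v1 w : vertex (pdom w) (sval (loc w)).1 by case: (svalP (loc w)).
have v2 w : vertex (pdom w) (sval (loc w)).2 by case: (svalP (loc w)).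
exists (stage_lift S v1), (stage_lift S v2); split; apply: ev_inj => w.
  by rewrite !(evM, evD) !ev_stage_lift (Sa w) (Sb w); case: (svalP (loc (restr S w))).
by rewrite !(evM, evD) !ev_stage_lift (Sa w) (Sb w); case: (svalP (loc (restr S w))).
Qed.

(** An invertible [A] cannot be nilpotent; for a singular one, Cayley-Hamilton makes [A ^+ 2] the
    trace times [A], and [A ^+ 3 = 0] forces the trace or [A] to vanish. *)
Lemma M2_nilpotent (A : M) : A ^+ 3 = 0 -> A ^+ 2 = 0.
Proof.
move=> A3; have A3' : A * A * A = 0 by move: A3; rewrite !exprS expr0 mulr1 mulrA.
have [D0|D0] := eqVneq (A 0 0 * A 1 1 - A 0 1 * A 1 0) 0; last first.
  have [[e1 e2 e3 e4] _] := inv2_identities D0.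
  set Di := _^-1 in e1 e2 e3 e4.
  have AB : A * mk (Di * A 1 1) (Di * - A 0 1) (Di * - A 1 0) (Di * A 0 0) = 1.
    by apply: M2_ext; rewrite !M2E.
  by rewrite expr2 -[A * A]mulr1 -AB mulrA A3' mul0r.
pose tr := A 0 0 + A 1 1.
have cayley i j : (A * A) i j = tr * A i j.
  have D1 : A 0 0 * A 1 1 = A 0 1 * A 1 0 by apply/eqP; rewrite -subr_eq0 D0.
  case: (I2P i) (I2P j) => -> [] ->; rewrite M2_mulE /tr mulrDl.
  - by rewrite [A 1 1 * _]mulrC D1.
  - by rewrite [A 1 1 * _]mulrC.
  - by rewrite [A 1 0 * A 0 0]mulrC.
  - by rewrite D1 [A 1 0 * A 0 1]mulrC.
have cube i j : tr * (tr * A i j) = 0.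
  have : (A * A * A) i j = 0 by rewrite A3' M2_0E.
  by rewrite M2_mulE !cayley -!mulrA -mulrDr -M2_mulE cayley.
have sq i j : (A * A) i j = 0.
  rewrite cayley; have /eqP := cube i j; rewrite !mulf_eq0 => /orP[/eqP->|/orP[/eqP->|/eqP->]];
    by rewrite ?mul0r ?mulr0.
by rewrite expr2; apply: M2_ext; rewrite !sq M2_0E.
Qed.

Hypothesis a0 : W.

Lemma RK_nilpotence_index : has_nilpotence_index RK 2.
Proof.
have evX w x n : ev w (x ^+ n) = ev w x ^+ n.
  by elim: n => [|n IH]; rewrite ?expr0 ?ev1// !exprS evM IH.
split.
  move=> x x3; apply: ev_inj => w; rewrite evX; apply: M2_nilpotent.
  by rewrite -evX x3.
have one_neq0 : (1 : RK) <> 0.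
  by move=> /(congr1 (ev point)); rewrite ev1 ev0 => /eqP; rewrite oner_eq0.
case=> [|[|m]] // H; first by case: one_neq0; have := H 0; rewrite expr1 expr0; exact.
pose w0 : points := (Some a0, Some a0, Some a0).
(* A matrix unit of square 0 at one total point shows that the index is not 1. *)
pose g w : M := if w == w0 then mk 0 1 0 0 else 0.
have gv w : vertex (pdom w) (g w).
  rewrite /g; case: eqP => [->|_] //.
  by have R := subalg_subring (vertex_subalg K (pdom w)); case: R => R1 RB _; rewrite -(subrr 1); exact: RB.
pose x := stage_lift [fset a0]%fset gv.
have x2 : x ^+ 2 = 0.
  apply: ev_inj => w; rewrite evX ev_stage_lift /g expr2; case: eqP => _; last by rewrite mul0r.
  by rewrite mk_mul !mksimp; apply: M2_ext; rewrite !M2E.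
have := H x x2; rewrite expr1 => /(congr1 (ev w0)).
have r0 : restr [fset a0]%fset w0 = w0 by rewrite /restr /= inE eqxx.
rewrite ev_stage_lift r0 /g eqxx ev0 => /(congr1 (fun m : M => m 0 1)); rewrite !M2E.
by move/eqP; rewrite oner_eq0.
Qed.

Section Limit.
Variable S : finsubs W.

Definition spoint : Type :=
  (option (S : {fset W}) * option (S : {fset W}) * option (S : {fset W}))%type.
HB.instance Definition _ := Finite.copy spoint
  (option (S : {fset W}) * option (S : {fset W}) * option (S : {fset W}))%type.

Definition spoint_val (z : spoint) : points :=
  (omap val z.1.1, omap val z.1.2, omap val z.2).

Lemma spoint_val_inj : injective spoint_val.
Proof.
have oi : injective (omap (val : (S : {fset W}) -> W)).
  by move=> [a|] [b|] //= [/val_inj ->].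
by move=> [[a b] c] [[a' b'] c'] [/oi -> /oi -> /oi ->].
Qed.

Lemma spoint_restr w : {z | spoint_val z = restr S w}.
Proof.
have o_ o : {z : option (S : {fset W}) | omap val z = orestr S o}.
  apply: cid; case: o => [a|] /=; last by exists None.
  case: ifP => aS; last by exists None.
  by exists (Some [` aS]%fset).
case: w => [[a b] c]; exists (sval (o_ a), sval (o_ b), sval (o_ c)).
by rewrite /spoint_val /restr /= (svalP (o_ a)) (svalP (o_ b)) (svalP (o_ c)).
Qed.

Lemma restr_spoint (z : spoint) : restr S (spoint_val z) = spoint_val z.
Proof.
have oE (o : option (S : {fset W})) : orestr S (omap val o) = omap val o.
  by case: o => //= a; rewrite (valP a).
by rewrite /restr /= !oE.
Qed.

Lemma stage_ev_vertex (r : sub_of (stage S)) z : sub_val r z \in vertex_alg K (pdom z).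
Proof. by apply/vertex_algP; have /stageP/(_ z)[] := sub_valP r. Qed.

Definition stage_ev z (r : sub_of (stage S)) : sub_of (vertex_alg K (pdom z)) :=
  SubOf (stage_ev_vertex r z).

Lemma stage_ev_linear z : linear (stage_ev z).
Proof. by move=> c x y; exact: sub_inj. Qed.

Lemma stage_ev_monoid z : monoid_morphism (stage_ev z).
Proof. by split=> [|x y]; exact: sub_inj. Qed.

Lemma stage_finite_product : finite_product_of_RK (sub_of (stage S)).
Proof.
apply: (@finite_product_trans K (sub_of (stage S)) spoint
  (fun z : spoint => sub_of (vertex_alg K (pdom (spoint_val z))))
  (fun z : spoint => lrmorphism_of (@stage_ev_linear (spoint_val z)) (@stage_ev_monoid (spoint_val z)))).
  move=> y; pose r w : M := sub_val (y (sval (spoint_restr w))).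
  have rS : (r : fun_alg points M) \in stage S.
    apply/stageP => w; split.
      rewrite /r; congr (sub_val (y _)); apply: spoint_val_inj.
      by rewrite (svalP (spoint_restr w)) (svalP (spoint_restr (restr S w))) restrK.
    have /vertex_algP := sub_valP (y (sval (spoint_restr w))).
    apply: vertex_mono; rewrite (svalP (spoint_restr w)); exact: pdom_restr.
  have sr (z : spoint) : sval (spoint_restr (spoint_val z)) = z.
    by apply: spoint_val_inj; rewrite (svalP (spoint_restr _)) restr_spoint.
  exists (SubOf rS); split=> [z|r' r'y].
    by apply: sub_inj; rewrite /= /r sr.
  apply/sub_inj/funext => w; have /stageP/(_ w)[-> _] := sub_valP r'.
  have -> : sub_val (SubOf rS) w = sub_val (y (sval (spoint_restr w))) by [].
  by rewrite -(r'y _) /= (svalP (spoint_restr w)).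
by move=> z; exact: vertex_finite_product.
Qed.

End Limit.

Lemma RK_direct_limit : has_card_aleph 3 (finsubs W) ->
  exists (d : Order.disp_t) (I : porderType d) (A : I -> algType K)
         (f : forall i j : I, (i <= j)%O -> {lrmorphism A i -> A j})
         (c : forall i : I, {lrmorphism A i -> RK}),
    has_card_aleph 3 I /\ (forall i : I, finite_product_of_RK (A i)) /\
    direct_system f /\ is_direct_limit f c.
Proof.
move=> W3; exists _, (finsubs W), (fun S => sub_of (stage S)), (union_map stage_mono),
  (union_cocone stage_condensate); split=> //.
split; first exact: stage_finite_product.
have inh : inhabited (finsubs W) by exists; exact: fset0.
split; first exact: (union_direct_system stage_mono stage_upper inh).
apply: (union_direct_limit stage_mono stage_upper inh stage_condensate).
by move=> x /asboolP.
Qed.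

End Condensate.

Lemma entry_sandwich (R : rngType) (i j : nat) (a b : R) (m : Minf R) :
  entry 0 i a ** m ** entry j 0 b = emb (a ** m i j ** b).
Proof.
apply: Minf_ext => k l.
have E k' l' : (entry 0 i a ** m) k' l' = if k' == 0%N then a ** m i l' else 0.
  rewrite (rmulmE (n := i.+1)) => [|p ip]; last first.
    by rewrite entryE (gtn_eqF ip) andbF rmul0l.
  rewrite (bigD1 ord_max)// big1 ?addr0 => [|p pi].
    by rewrite entryE eqxx andbT; case: k' => [|k'] /=; rewrite ?rmul0l !addr0.
  have {}pi : (p : nat) != i by apply: contra pi => /eqP pi; apply/eqP/val_inj.
  by rewrite entryE (negbTE pi) andbF rmul0l.
rewrite (rmulmE (n := j.+1)) => [|p jp]; last first.
  by rewrite entryE (gtn_eqF jp) rmul0r.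
rewrite (bigD1 ord_max)// big1 ?addr0 => [|p pj].
  by rewrite E entryE eqxx andTb ?addr0; case: k => [|k]; case: l => [|l]; rewrite /= ?rmul0l ?rmul0r ?addr0.
have {}pj : (p : nat) != j by apply: contra pj => /eqP pj; apply/eqP/val_inj.
by rewrite entryE (negbTE pj) rmul0r.
Qed.

(** * The obstruction *)

Section Evaluation.
Variables (K : fieldType) (W : choiceType).
Local Notation M := (M2ratfun K).
Local Notation RK := (RK K W).
Local Notation R := (rng_of RK).
Local Notation tO := (@max_loc0 K).
Implicit Types (w u : points W).

Definition vanish w (x : R) : Prop := ev w x = 0.

Lemma vanish_ideal w : ideal_pred (vanish w).
Proof.
split; rewrite /vanish.
- exact: ev0.
- by move=> x y x0 y0; rewrite evD x0 y0 addr0.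
- by move=> x y x0; rewrite [LHS]evM x0 mulr0.
- by move=> x y x0; rewrite [LHS]evM x0 mul0r.
Qed.

Section Coatom.
Variables (u : points W) (P Q : M).
Hypothesis PQ : P * Q = 1.
Hypothesis uPQ : forall x, vertex (pdom u) x -> conj_in P Q (fun x => x \in @CK_pred K) x.

Definition loc (x : R) : M := Q * ev u x * P.

Lemma loc_CK x : loc x \in @CK_pred K.
Proof. exact: (uPQ (ev_vertex u x)). Qed.

Lemma locM (x y : R) : loc (x ** y) = loc x * loc y.
Proof. by rewrite /loc -conjM. Qed.

Lemma locD (x y : R) : loc (x + y) = loc x + loc y.
Proof. by rewrite /loc evD conjD. Qed.

Lemma loc0 : loc 0 = 0.
Proof. by rewrite /loc ev0 mulr0 mul0r. Qed.

(** The kernel of one of the two residue maps from C_K to K at t = 0, one for each diagonal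
    entry. *)
Definition residue0 (c : 'I_2) (x : R) : Prop := tO (loc x c c).

(** Modulo t, the diagonal entries of a product in C_K are the products of the diagonal entries,
    since the off-diagonal ones are divisible by t. *)
Lemma residue0_ideal c : ideal_pred (residue0 c).
Proof.
have off (A : M) (i j : 'I_2) : A \in @CK_pred K -> i != j -> tO (A i j).
  by move=> /CKP[_ _ h01 h10]; case: (I2P i) (I2P j) => -> [] ->; rewrite ?eqxx.
have prod (A A' : M) : A \in @CK_pred K -> A' \in @CK_pred K -> tO (A c c) \/ tO (A' c c) ->
    tO ((A * A') c c).
  move=> AC AC' H; rewrite M2_mulE.
  have S (d : 'I_2) : tO (A c d * A' d c).
    have [<-|cd] := eqVneq c d; last by apply: max_loc0Mr; [exact: off|exact: CK_O].
    by case: H => h; [apply: max_loc0Mr => //; exact: CK_O|apply: max_loc0M => //; exact: CK_O].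
  exact: max_loc0D (S 0) (S 1).
split; rewrite /residue0.
- by rewrite loc0 M2_0E; exact: max_loc0_0.
- by move=> x y x0 y0; rewrite locD M2_addE; exact: max_loc0D.
- by move=> x y x0; rewrite locM; apply: prod; [exact: loc_CK|exact: loc_CK|right].
- by move=> x y x0; rewrite locM; apply: prod; [exact: loc_CK|exact: loc_CK|left].
Qed.

(* An idempotent with entries in t M_2(O) lies in every t^k M_2(O). *)
Lemma residue0_vanish (g : Minf R) : idempotent_elt g ->
  (forall c, null_mx (residue0 c) g) -> null_mx (vanish u) g.
Proof.
move=> gg g0.
have tM i j (a b : 'I_2) : tO (loc (g i j) a b).
  have /CKP[_ _ h01 h10] := loc_CK (g i j).
  by case: (I2P a) (I2P b) => -> [] -> //; exact: g0.
pose pw k (x : ratfun K) := exists2 y, ratfun_loc0 y & x = t_ratfun K ^+ k * y.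
have pw0 k : pw k 0 by exists 0; [exact: loc0_0|rewrite mulr0].
have pwD k x y : pw k x -> pw k y -> pw k (x + y).
  by move=> [a Oa ->] [b Ob ->]; exists (a + b); [exact: loc0D|rewrite mulrDr].
have pwS k i j (a b : 'I_2) : pw k (loc (g i j) a b).
  elim: k i j a b => [|k IH] i j a b.
    by exists (loc (g i j) a b); [apply: CK_O; exact: loc_CK|rewrite expr0 mul1r].
  have [n gn] := Minf_bound g.
  have -> : g i j = \sum_(l < n) g i l ** g l j.
    rewrite -[in LHS]gg; apply: rmulmE => l nl; by rewrite gn ?nl ?orbT// rmul0l.
  elim/big_ind: _ => [|x y|l _]; first by rewrite loc0 M2_0E.
    by rewrite locD M2_addE; exact: pwD.
  have prod (d : 'I_2) : pw k.+1 (loc (g i l) a d * loc (g l j) d b).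
    have [y Oy ->] := IH i l a d; have [z Oz ->] := tM l j d b.
    by exists (y * z); [exact: loc0M|rewrite exprSr -!mulrA; congr (_ * _); rewrite mulrCA].
  by rewrite locM M2_mulE; exact: pwD.
move=> i j; rewrite /vanish; apply: (conj_inj PQ (P := P) (Q := Q)).
rewrite mulr0 mul0r; apply: M2_ext; rewrite M2_0E; apply: loc0_infinite_order => k;
  exact: pwS.
Qed.

End Coatom.
End Evaluation.

Lemma nullV_emb (R : rngType) (N : R -> Prop) (x : R) : ideal_pred N -> idempotent_elt x ->
  nullV N (cl (emb x)) <-> N x.
Proof.
move=> idN xx; rewrite (nullV_cl idN (emb_idem xx)); split=> [/(_ 0%N 0%N)//|Nx i j].
by rewrite /=; case: ifP => // _; case: idN.
Qed.

Section Negative.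
Variables (K : fieldType) (W : choiceType).
Local Notation M := (M2ratfun K).
Local Notation RK := (RK K W).
Local Notation R := (rng_of RK).
Local Notation tO := (@max_loc0 K).
Implicit Types (w u : points W) (S : {fset W}).

Definition pnone : points W := (None, None, None).

Lemma vertex0 d : vertex d (0 : M).
Proof.
by have [S1 SB _] := subalg_subring (vertex_subalg K d); rewrite -(subrr 1); exact: SB.
Qed.

Lemma vertex1 d : vertex d (1 : M).
Proof. by case: (vertex_subalg K d). Qed.

Lemma cyl_vertex S w : vertex (pdom w) (if w == pnone then 1 else 0 : M).
Proof. by case: ifP => _; [exact: vertex1|exact: vertex0]. Qed.

Definition cyl S : RK := stage_lift S (cyl_vertex S).

Lemma ev_cyl S w : ev w (cyl S) = if restr S w == pnone then 1 else 0.
Proof. by []. Qed.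

Lemma cyl_idem S : idempotent_elt (cyl S : R).
Proof. by apply: ev_inj => w; rewrite [LHS]evM ev_cyl; case: ifP => _; rewrite ?mulr1 ?mulr0. Qed.

(* A nonzero entry of g at the empty point is a scalar, and takes that value at all points
   avoiding its support, where it can be inverted. *)
Lemma cyl_le (g : Minf R) : idempotent_elt g -> ~ null_mx (vanish pnone) g ->
  exists S v, cl g = cl (emb (cyl S : R)) + v.
Proof.
move=> gg /existsNP[i /existsNP[j gij]].
have [S Sg] := ev_support (g i j : RK).
have [c cE] : scalar_in (ev pnone (g i j)) by exact: (ev_vertex pnone (g i j : RK)).
have c0 : c != 0 by apply/eqP => c0; apply: gij; rewrite /vanish cE c0 scale0r.
pose cS : R := c^-1 *: cyl S : RK.
exists S; apply: (@cl_factor R g (emb (cyl S : R)) (entry 0 i cS) (entry j 0 (cyl S : R)) gg).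
  exact/emb_idem/cyl_idem.
rewrite entry_sandwich; congr emb; apply: ev_inj => w.
rewrite [RHS]evM evM ev_cyl; case: ifP => [/eqP wS|]; last by rewrite mulr0.
have -> : ev w cS = c^-1 *: ev w (cyl S) by [].
rewrite ev_cyl wS eqxx Sg wS cE mulr1 -scalerAl mul1r scalerA mulVf// scale1r //.
Qed.

Section Coordinate.
Variables (pi : points W -> option W) (d : bool * bool * bool).
Hypothesis pi_restr : forall S w, pi (restr S w) = orestr S (pi w).
Hypothesis pi_dom : forall w, isSome (pi w) -> dom_le d (pdom w).

Lemma atom_vertex S al (a : M) (da : vertex d a) w :
  vertex (pdom w) (if (restr S w == pnone) && (pi w == Some al) then a else 0).
Proof.
case: ifP => [/andP[_ /eqP wal]|_]; last exact: vertex0.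
by apply: vertex_mono da; apply: pi_dom; rewrite wal.
Qed.

Definition atom S al a (da : vertex d a) : RK := stage_lift (al |` S)%fset (atom_vertex S al da).

Lemma ev_atom S al a (da : vertex d a) w : ev w (atom S al da) =
  if (restr S w == pnone) && (pi w == Some al) then a else 0.
Proof.
rewrite /atom ev_stage_lift restrI ?fsubsetUr// pi_restr; congr (if _ && _ then _ else _).
case: (pi w) => //= b; case: ifP => [//|/negbT]; rewrite !inE negb_or => /andP[ba _].
by apply/esym/eqP => -[bal]; rewrite bal eqxx in ba.
Qed.

Variables (a : M) (da : vertex d a) (da' : vertex d (1 - a)).
Hypothesis aa : a * a = a.

Lemma atom_idem S al x (dx : vertex d x) : x * x = x -> idempotent_elt (atom S al dx : R).
Proof.
by move=> xx; apply: ev_inj => w; rewrite [LHS]evM ev_atom; case: ifP => _; rewrite ?mulr0.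
Qed.

Definition coatom_rest S al : RK := cyl S - atom S al (vertex1 d).

Lemma ev_coatom_rest S al w : ev w (coatom_rest S al) =
  if (restr S w == pnone) && (pi w != Some al) then 1 else 0.
Proof.
rewrite /coatom_rest evB ev_cyl ev_atom.
by case: (restr S w == pnone); case: (pi w == Some al); rewrite /= ?subrr ?subr0.
Qed.

(** Among the points avoiding [S], those with [pi w = Some al] split their unit into [a] and
    [1 - a]; the others make up the third summand. *)
Lemma cl_cyl S al : cl (emb (cyl S : R)) = cl (emb (atom S al da : R)) +
  (cl (emb (atom S al da' : R)) + cl (emb (coatom_rest S al : R))).
Proof.
have aa' : (1 - a) * (1 - a) = 1 - a by rewrite mulrBr mulr1 mulrBl mul1r aa subrr subr0.
have orth (x y : R) : (forall w, ev w x * ev w y = 0) -> emb x ** emb y = 0.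
  by move=> H; rewrite -embM -(emb0 R); congr emb; apply: ev_inj => w; rewrite [LHS]evM H.
have ii (x : R) : (forall w, ev w x * ev w x = ev w x) -> idempotent_elt (emb x).
  by move=> H; apply: emb_idem; apply: ev_inj => w; rewrite [LHS]evM H.
have ic : idempotent_elt (emb (coatom_rest S al : R)).
  by apply: ii => w; rewrite ev_coatom_rest; case: ifP => _; rewrite ?mulr0 ?mulr1.
have ia : idempotent_elt (emb (atom S al da : R)) by exact/emb_idem/atom_idem.
have ia' : idempotent_elt (emb (atom S al da' : R)) by exact/emb_idem/atom_idem.
have o1 : emb (atom S al da' : R) ** emb (coatom_rest S al : R) = 0.
  apply: orth => w; rewrite ev_coatom_rest ev_atom.
  by case: (restr S w == pnone); case: (pi w == Some al); rewrite /= ?mul0r ?mulr0.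
have o2 : emb (coatom_rest S al : R) ** emb (atom S al da' : R) = 0.
  apply: orth => w; rewrite ev_coatom_rest ev_atom.
  by case: (restr S w == pnone); case: (pi w == Some al); rewrite /= ?mul0r ?mulr0.
have o3 : emb (atom S al da : R) ** (emb (atom S al da' : R) + emb (coatom_rest S al : R)) = 0.
  rewrite -embD; apply: orth => w; rewrite evD ev_coatom_rest !ev_atom.
  case: (restr S w == pnone); case: (pi w == Some al); rewrite /= ?mul0r ?mulr0 //.
  by rewrite addr0 mulrBr mulr1 aa subrr.
have o4 : (emb (atom S al da' : R) + emb (coatom_rest S al : R)) ** emb (atom S al da : R) = 0.
  rewrite -embD; apply: orth => w; rewrite evD ev_coatom_rest !ev_atom.
  case: (restr S w == pnone); case: (pi w == Some al); rewrite /= ?mul0r ?mulr0 //.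
  by rewrite addr0 mulrBl mul1r aa subrr.
rewrite -clD // -clD //; last exact: idem_add.
congr cl; rewrite -!embD; congr emb; apply: ev_inj => w.
rewrite [RHS]evD [X in _ = _ + X]evD ev_cyl ev_coatom_rest !ev_atom.
by case: (restr S w == pnone); case: (pi w == Some al); rewrite /= ?addr0 ?add0r // addrC subrK.
Qed.

Lemma atom_residue S al x (dx : vertex d x) w P Q c :
  tO ((Q * x * P) c c) -> residue0 w P Q c (atom S al dx).
Proof.
rewrite /residue0 /loc ev_atom; case: ifP => // _ _.
by rewrite mulr0 mul0r M2_0E; exact: max_loc0_0.
Qed.

End Coordinate.

Variables (B : rngType) (f : {additive V B -> V R}).
Hypothesis fV : pre_V_hom f.

Definition null_at w (v : V B) : Prop := nullV (vanish w) (f v).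

Lemma null_at_oideal w : oideal (null_at w).
Proof. exact: oideal_comp (nullV_oideal (@vanish_ideal K W w)). Qed.

Lemma lift_split (e : B) (x y : V R) : idempotent_elt e -> f (cl (emb e)) = x + y ->
  exists a b : B, [/\ e = a + b, idempotent_elt a /\ idempotent_elt b,
    a ** b = 0 /\ b ** a = 0 & f (cl (emb a)) = x /\ f (cl (emb b)) = y].
Proof.
move=> ee /fV[u [v [euv fu fv]]].
have [a [b [eab iab oab [au bv]]]] := cl_split_emb ee euv.
by exists a, b; rewrite au bv.
Qed.

Variable J : (V B -> Prop) -> B -> Prop.
Hypothesis Japprox : forall x, exists g : nat -> B,
    (forall n, idempotent_elt (g n) /\ exists s r, g n = s ** x ** r) /\
    forall Z, oideal Z -> (forall n, Z (cl (emb (g n)))) -> J Z x.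

(** The [g n] factor through both [p] and [q], so their classes are below both. Each residue map at
    [u] kills [x] or [y], hence kills the images [h n], which vanish at [u] by [residue0_vanish].
    Each [h n] has a finite support [Phi n], through which alone it sees [w]. *)
Lemma pair_null (u : points W) (P Q : M) (x y : R) (p q : B) : P * Q = 1 ->
  (forall z, vertex (pdom u) z -> conj_in P Q (fun z => z \in @CK_pred K) z) ->
  idempotent_elt x -> idempotent_elt y ->
  (forall c : 'I_2, residue0 u P Q c x \/ residue0 u P Q c y) ->
  idempotent_elt p -> idempotent_elt q ->
  f (cl (emb p)) = cl (emb x) -> f (cl (emb q)) = cl (emb y) ->
  exists Phi : nat -> {fset W}, forall w,
    (forall n, restr (Phi n) w = restr (Phi n) u) -> J (null_at w) (p ** q).
Proof.
move=> PQ uPQ xx yy xy pp qq fp fq.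
have [g [gP gJ]] := Japprox (p ** q).
have hP n : {h : Minf R | idempotent_elt h /\ f (cl (emb (g n))) = cl h}.
  by apply: cid; have [h hh ->] := cl_surj (f (cl (emb (g n)))); exists h.
pose h n := sval (hP n).
have hh n : idempotent_elt (h n) by case: (svalP (hP n)).
have fh n : f (cl (emb (g n))) = cl (h n) by case: (svalP (hP n)).
have h0 n : null_mx (vanish u) (h n).
  apply: (residue0_vanish PQ uPQ (hh n)) => c.
  have idc := residue0_ideal PQ uPQ c.
  have oc := oideal_comp f (nullV_oideal idc).
  have [gg [s [r gE]]] := gP n.
  apply/(nullV_cl idc (hh n)); rewrite -fh.
  case: (xy c) => [cx|cy].
    apply: (oideal_factor oc (emb_idem pp) (emb_idem gg) (x := emb s) (y := emb (q ** r))).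
      by rewrite -!embM gE !rmulA.
    by rewrite fp; apply/(nullV_emb idc xx).
  apply: (oideal_factor oc (emb_idem qq) (emb_idem gg) (x := emb (s ** p)) (y := emb r)).
    by rewrite -!embM gE !rmulA.
  by rewrite fq; apply/(nullV_emb idc yy).
have supp n : {S | forall i j w, ev w (h n i j : RK) = ev (restr S w) (h n i j : RK)}.
  apply: cid; have [m hm] := Minf_bound (h n).
  have [S HS] := ev_supports [seq (h n i j : RK) | i <- iota 0 m, j <- iota 0 m].
  exists S => i j w; have [im|mi] := ltnP i m; last by rewrite hm ?mi// !ev0.
  have [jm|mj] := ltnP j m; last by rewrite hm ?mj ?orbT// !ev0.
  by apply: HS; apply/allpairsP; exists (i, j); rewrite !mem_iota.
exists (fun n => sval (supp n)) => w wu; apply: gJ; first exact: null_at_oideal.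
move=> n; rewrite /null_at fh; apply/(nullV_cl (@vanish_ideal K W w) (hh n)) => i j.
rewrite /vanish (svalP (supp n) i j w) wu -(svalP (supp n) i j u); exact: h0.
Qed.

Hypothesis Jideal : forall Z, oideal Z ->
  [/\ forall x y, J Z x -> J Z y -> J Z (x - y),
      forall x y, J Z x -> J Z (y ** x) /\ J Z (x ** y),
      forall e, idempotent_elt e -> J Z e <-> Z (cl (emb e)) &
      (forall e : B, idempotent_elt e -> Z (cl (emb e))) -> forall v, Z v].
Hypothesis fsurj : forall v : V R, exists t : V B, f t = v.
Hypothesis free : forall F G H : W -> W -> nat -> seq W, exists a b c,
    [/\ forall n, a \notin F b c n, forall n, b \notin G a c n & forall n, c \notin H a b n].

Lemma emb1_neq0 : ~ vanish pnone (1 : RK).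
Proof. by rewrite /vanish ev1 => /eqP; rewrite oner_eq0. Qed.

(** [B] need not have a unit, and a preimage of the class of 1 is only a class of matrices. The last
    clause on [J] replaces it by an idempotent of [B] not null at the empty point, which [cyl_le]
    and a lifting cut down to [cyl S]. *)
Lemma base_idem : exists S (e : B), idempotent_elt e /\ f (cl (emb e)) = cl (emb (cyl S : R)).
Proof.
have oZ := null_at_oideal pnone; have [_ _ _ Jgen] := Jideal oZ.
have one_idem : idempotent_elt (1 : R) by exact: mulr1.
have [v fv] := fsurj (cl (emb (1 : R))).
have nv : ~ null_at pnone v.
  by rewrite /null_at fv (nullV_emb (@vanish_ideal K W pnone) one_idem); exact: emb1_neq0.
have [e [ee ne]] : exists e : B, idempotent_elt e /\ ~ null_at pnone (cl (emb e)).
  apply: contrapT => H; apply: nv; apply: Jgen => e ee; apply: contrapT => ne.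
  by apply: H; exists e.
have [g gg fe] := cl_surj (f (cl (emb e))).
have [|S [y gE]] := cyl_le gg.
  by move=> g0; apply: ne; rewrite /null_at fe; apply/(nullV_cl (@vanish_ideal K W pnone) gg).
have [a [b [_ [aa _] _ [fa _]]]] := lift_split ee (etrans fe gE).
by exists S, a.
Qed.

Lemma no_surjection : False.
Proof.
have [S [e [ee fe]]] := base_idem.
pose pi1 (w : points W) := w.1.1; pose pi2 (w : points W) := w.1.2; pose pi3 (w : points W) := w.2.
pose d1 := (true, false, false); pose d2 := (false, true, false); pose d3 := (false, false, true).
have r1 T w : pi1 (restr T w) = orestr T (pi1 w) by [].
have r2 T w : pi2 (restr T w) = orestr T (pi2 w) by [].
have r3 T w : pi3 (restr T w) = orestr T (pi3 w) by [].
have m1 w : isSome (pi1 w) -> dom_le d1 (pdom w) by rewrite /dom_le /= => ->.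
have m2 w : isSome (pi2 w) -> dom_le d2 (pdom w) by rewrite /dom_le /= => ->.
have m3 w : isSome (pi3 w) -> dom_le d3 (pdom w) by rewrite /dom_le /= => ->.
have self (a : M) : span_in a a by exists 1, 0; rewrite scale1r scale0r addr0.
have compl (a : M) : span_in a (1 - a) by exists 0, 1; rewrite scale1r scale0r add0r.
have i1 := at1_idem K; have i2 := at2_idem K; have i3 := at3_idem K.
have s1 : vertex d1 (at1 K) := self _; have c1 : vertex d1 (1 - at1 K) := compl _.
have s2 : vertex d2 (at2 K) := self _; have c2 : vertex d2 (1 - at2 K) := compl _.
have s3 : vertex d3 (at3 K) := self _; have c3 : vertex d3 (1 - at3 K) := compl _.
(* The three components of [t] are [p], [q] and a remainder, whose image vanishes at every [w] with
   [pi w = Some al]. *)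
have split3 pi d (rp : forall T w, pi (restr T w) = orestr T (pi w))
    (mp : forall w, isSome (pi w) -> dom_le d (pdom w)) a (sa : vertex d a)
    (ca : vertex d (1 - a)) (ia : a * a = a) al : {t : B * B * B |
    [/\ e = t.1.1 + (t.1.2 + t.2), t.1.1 ** e = t.1.1,
      [/\ idempotent_elt t.1.1, idempotent_elt t.1.2 & idempotent_elt t.2] &
      [/\ f (cl (emb t.1.1)) = cl (emb (atom mp S al sa : R)),
          f (cl (emb t.1.2)) = cl (emb (atom mp S al ca : R)) &
          f (cl (emb t.2)) = cl (emb (coatom_rest mp S al : R))]]}.
  apply: cid; have := fe; rewrite (cl_cyl rp mp sa ca ia S al).
  move=> /(lift_split ee)[p [p' [eE [pp pp'] [pp'0 _] [fp]]]].
  move=> /(lift_split pp')[q [z [p'E [qq zz] _ [fq fz]]]].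
  by exists (p, q, z); split=> //=; [rewrite -p'E|rewrite eE rmulDr pp pp'0 addr0].
pose t1 al := split3 _ _ r1 m1 _ s1 c1 i1 al.
pose t2 al := split3 _ _ r2 m2 _ s2 c2 i2 al.
pose t3 al := split3 _ _ r3 m3 _ s3 c3 i3 al.
pose p1 al := (sval (t1 al)).1.1; pose q1 al := (sval (t1 al)).1.2; pose o1 al := (sval (t1 al)).2.
pose p2 al := (sval (t2 al)).1.1; pose q2 al := (sval (t2 al)).1.2; pose o2 al := (sval (t2 al)).2.
pose p3 al := (sval (t3 al)).1.1; pose q3 al := (sval (t3 al)).1.2; pose o3 al := (sval (t3 al)).2.
have t0 := max_loc0_0 K.
have entry1 a b c z : (1 - mk a b c z : M) 0 0 = 1 - a /\ (1 - mk a b c z : M) 1 1 = 1 - z.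
  by rewrite -mk1 /mk !mxE.
have [[P12 _] [P23 _] [P13 _]] := And3 (PQ12 K) (PQ23 K) (PQ13 K).
have t1P al := svalP (t1 al); have t2P al := svalP (t2 al); have t3P al := svalP (t3 al).
have u12 al be : {Phi : nat -> {fset W} | forall w,
    (forall n, restr (Phi n) w = restr (Phi n) (Some al, Some be, None)) ->
    J (null_at w) (p1 al ** q2 be)}.
  apply: cid; have [_ _ [h1 _ _] [h2 _ _]] := t1P al; have [_ _ [_ h3 _] [_ h4 _]] := t2P be.
  apply: (pair_null P12 _ (atom_idem r1 m1 S al s1 i1) (atom_idem r2 m2 S be c2 _) _ h1 h3 h2 h4) => //.
    by rewrite mulrBr mulr1 mulrBl mul1r i2 subrr subr0.
  move=> c; case: (I2P c) => ->; [left|right]; apply: (atom_residue r1) || apply: (atom_residue r2).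
    by rewrite at1_12 mkE.
  by rewrite conjB (conj1 (PQ12 K).2) at2_12 (entry1 _ _ _ _).2 subrr.
have u23 be ga : {Phi : nat -> {fset W} | forall w,
    (forall n, restr (Phi n) w = restr (Phi n) (None, Some be, Some ga)) ->
    J (null_at w) (p2 be ** q3 ga)}.
  apply: cid; have [_ _ [h1 _ _] [h2 _ _]] := t2P be; have [_ _ [_ h3 _] [_ h4 _]] := t3P ga.
  apply: (pair_null P23 _ (atom_idem r2 m2 S be s2 i2) (atom_idem r3 m3 S ga c3 _) _ h1 h3 h2 h4) => //.
    by rewrite mulrBr mulr1 mulrBl mul1r i3 subrr subr0.
  move=> c; case: (I2P c) => ->; [right|left]; apply: (atom_residue r2) || apply: (atom_residue r3).
    by rewrite conjB (conj1 (PQ23 K).2) at3_23 (entry1 _ _ _ _).1 subrr.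
  by rewrite at2_23 mkE.
have u13 al ga : {Phi : nat -> {fset W} | forall w,
    (forall n, restr (Phi n) w = restr (Phi n) (Some al, None, Some ga)) ->
    J (null_at w) (p1 al ** p3 ga)}.
  apply: cid; have [_ _ [h1 _ _] [h2 _ _]] := t1P al; have [_ _ [h3 _ _] [h4 _ _]] := t3P ga.
  apply: (pair_null P13 _ (atom_idem r1 m1 S al s1 i1) (atom_idem r3 m3 S ga s3 i3) _ h1 h3 h2 h4) => //.
  move=> c; case: (I2P c) => ->; [right|left]; apply: (atom_residue r1) || apply: (atom_residue r3).
    by rewrite at3_13 mkE.
  by rewrite at1_13 mkE.
(* [S] is joined to the exceptional sets so that the triple also avoids it, that is, lies where the
   image of [e] is 1. *)
have [a [b [c [aF bG cH]]]] := free
  (fun b c n => S `|` sval (u23 b c) n)%fset (fun a c n => S `|` sval (u13 a c) n)%fset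
  (fun a b n => S `|` sval (u12 a b) n)%fset.
have nin (x : W) (A C : {fset W}) : x \notin (A `|` C)%fset -> x \notin A /\ x \notin C.
  by rewrite inE negb_or => /andP[].
have [aS _] := nin _ _ _ (aF 0%N); have [bS _] := nin _ _ _ (bG 0%N).
have [cS _] := nin _ _ _ (cH 0%N).
have orN x (A : {fset W}) : x \notin A -> orestr A (Some x) = None by rewrite /= => /negbTE ->.
pose w : points W := (Some a, Some b, Some c).
(* [c] is outside every [Phi n] of the pair, so [w] and its restriction to the first two coordinates
   look the same there; similarly for the other two pairs. *)
have J12 : J (null_at w) (p1 a ** q2 b).
  by apply: (svalP (u12 a b)) => n; rewrite /restr /= (negbTE (nin _ _ _ (cH n)).2).
have J23 : J (null_at w) (p2 b ** q3 c).
  by apply: (svalP (u23 b c)) => n; rewrite /restr /= (negbTE (nin _ _ _ (aF n)).2).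
have J13 : J (null_at w) (p1 a ** p3 c).
  by apply: (svalP (u13 a c)) => n; rewrite /restr /= (negbTE (nin _ _ _ (bG n)).2).
have [Jsub Jmul Jidem _] := Jideal (null_at_oideal w).
have wS : restr S w == pnone by rewrite /restr /= (negbTE aS) (negbTE bS) (negbTE cS).
have vid := @vanish_ideal K W w.
have Jrest pi d (rp : forall T w, pi (restr T w) = orestr T (pi w))
    (mp : forall w, isSome (pi w) -> dom_le d (pdom w)) al o :
    pi w = Some al -> idempotent_elt o -> f (cl (emb o)) = cl (emb (coatom_rest mp S al : R)) ->
    J (null_at w) o.
  move=> wal oo fo; apply/(Jidem _ oo); rewrite /null_at fo; apply/(nullV_emb vid).
    by apply: ev_inj => z; rewrite [LHS]evM ev_coatom_rest//; case: ifP => _; rewrite ?mulr0 ?mulr1.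
  by rewrite /vanish ev_coatom_rest// wal eqxx andbF.
have Jo2 : J (null_at w) (o2 b).
  by have [_ _ [_ _ oo] [_ _ fo]] := t2P b; exact: (Jrest _ _ r2 m2 b _ erefl oo fo).
have Jo3 : J (null_at w) (o3 c).
  by have [_ _ [_ _ oo] [_ _ fo]] := t3P c; exact: (Jrest _ _ r3 m3 c _ erefl oo fo).
have [e2 _ _ _] := t2P b; have [e3 p2e3 _ _] := t3P c.
have [_ p1e [p1p1 _ _] [fp1 _ _]] := t1P a.
have [_ p2e _ _] := t2P b.
have J0 : J (null_at w) 0 by rewrite -(subrr (o2 b)); exact: Jsub.
have JD x y : J (null_at w) x -> J (null_at w) y -> J (null_at w) (x + y).
  by move=> Jx Jy; rewrite -[y]opprK -[- y]add0r; apply: (Jsub) => //; exact: Jsub.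
have split_off e' p x y z : e' = x + (y + z) -> p ** e' = p -> p - p ** x = p ** y + p ** z :> B.
  by move=> -> pe; rewrite -{1}pe !rmulDr addrC addKr.
have s12 := split_off _ _ _ _ _ e2 p1e; have s23 := split_off _ _ _ _ _ e3 p2e.
have Js12 : J (null_at w) (p1 a - p1 a ** p2 b).
  by rewrite s12; apply: (JD) (J12) _; exact: (Jmul _ _ Jo2).1.
have Js23 : J (null_at w) (p2 b - p2 b ** p3 c).
  by rewrite s23; apply: (JD) (J23) _; exact: (Jmul _ _ Jo3).1.
(* Modulo [J (null_at w)]: [p1 = p1 p2 = p1 p2 p3 = p1 p3 = 0]. *)
have Jp1 : J (null_at w) (p1 a).
  rewrite -(subrK (p1 a ** p2 b) (p1 a)); apply: (JD) (Js12) _.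
  rewrite -[p1 a ** p2 b](subrK (p1 a ** (p2 b ** p3 c))) -rmulBr.
  apply: (JD); first exact: (Jmul _ _ Js23).1.
  have -> : p1 a ** (p2 b ** p3 c) = p1 a ** p3 c - (p1 a - p1 a ** p2 b) ** p3 c.
    by rewrite rmulBl rmulA subKr.
  by apply: (Jsub) (J13) _; exact: (Jmul _ _ Js12).2.
have /(nullV_emb vid (atom_idem r1 m1 S a s1 i1)) : nullV (vanish w) (cl (emb (atom m1 S a s1 : R))).
  by rewrite -fp1; exact: (Jidem _ p1p1).1 Jp1.
rewrite /vanish ev_atom// wS eqxx /= /at1 => /matrixP/(_ 1 1).
by rewrite /mk !mxE /= => /eqP; rewrite oner_eq0.
Qed.

End Negative.

(** * Cardinality of R_K and of the index set *)

Section Cardinality.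
Variables (K : fieldType) (W : choiceType).
Hypotheses (sqW : squarable W) (KW : inj_into K W).

Lemma ratfun_inj : inj_into (ratfun K) W.
Proof.
have pK : inj_into {poly K} W.
  apply: inj_into_trans (squarable_seq sqW KW); exists (@polyseq K); exact: poly_inj.
apply: inj_into_trans (squarable_prod sqW pK pK).
exists (fun x : ratfun K => frac (repr x)) => x y /val_inj; exact: (can_inj reprK).
Qed.

(** An element is determined by a finite support together with its values at the finitely many
    points over that support. *)
Lemma RK_inj : inj_into (RK K W) W.
Proof.
have LW := ratfun_inj; have L2 := squarable_prod sqW LW LW.
have MW : inj_into (M2ratfun K) W.
  apply: inj_into_trans (squarable_prod sqW L2 L2).
  exists (fun m : M2ratfun K => ((m 0 0, m 0 1), (m 1 0, m 1 1))) => x y [] *; exact: M2_ext.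
have WW := inj_into_refl W.
apply: inj_into_trans (squarable_prod sqW (squarable_seq sqW WW) (squarable_seq sqW MW)).
pose S (r : RK K W) : {fset W} := sval (cid (ev_support r)).
pose vals (T : {fset W}) (r : RK K W) := [seq ev (spoint_val z) r | z : spoint T].
exists (fun r => (S r : seq W, vals (S r) r)) => x y [SE vE]; apply: ev_inj => w.
have {}SE : S x = S y by apply/fsetP => a; have := congr1 (fun s => a \in s) SE.
move: vE; rewrite -SE /vals => /eq_in_map vE.
have xS z : ev z x = ev (restr (S x) z) x := svalP (cid (ev_support x)) z.
have yS z : ev z y = ev (restr (S x) z) y by rewrite SE; exact: svalP (cid (ev_support y)) z.
by rewrite xS yS; have [z <-] := spoint_restr (S x) w; apply: vE; rewrite mem_enum.
Qed.

Lemma fsub_inj : inj_into (finsubs W) W.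
Proof.
apply: inj_into_trans (squarable_seq sqW (inj_into_refl W)).
exists (fun S : {fset W} => S : seq W) => S T ST.
by apply: (iffLR (@fsetP W S T)) => a; have := congr1 (fun s : seq W => a \in s) ST.
Qed.

End Cardinality.

Lemma bijective_pre_V_hom (M N : nmodType) (g : {additive N -> M}) : bijective g ->
  exists f : {additive M -> N}, pre_V_hom f /\ forall v, exists u, f u = v.
Proof.
move=> [h hg gh].
have h_add : nmod_morphism h.
  by split=> [|x y]; apply: (can_inj hg); rewrite gh ?raddf0 ?raddfD// !gh.
pose hf : {additive M -> N} := GRing.Additive.Pack (GRing.Additive.Class (GRing.isNmodMorphism.Build M N h h_add)).
exists hf; split=> [a b c hc|v]; last by exists (g v); exact: hg.
by exists (g a), (g b); split; [rewrite -raddfD -hc; exact/esym/gh|exact: hg|exact: hg].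
Qed.

Lemma approximable_no_surjection (K : fieldType) (T1 T2 : Type) (W : choiceType) (B : rngType)
    (f : {additive V B -> V (rng_of (RK K W))}) :
  succ_wo nat T1 -> succ_wo T1 T2 -> succ_wo T2 W -> approximable B -> pre_V_hom f ->
  ~ (forall v, exists u, f u = v).
Proof.
move=> s1 s2 s3 [J [Japprox Jideal]] fV fs.
exact: (no_surjection fV Japprox Jideal fs (free_triple s1 s2 s3)).
Qed.

Theorem theorem13p6 (K : fieldType) :
  exists R : algType K,
    exchange_ring (rng_of R) /\
    (has_nilpotence_index R 2 /\ stable_rank_1 R) /\
    (forall (F : realType) (B : cstarType F), real_rank_0 B ->
       forall f : {additive V B -> V (rng_of R)}, pre_V_hom f ->
         ~ (forall v, exists u, f u = v)) /\
    (forall B : rngType, regular_ring B ->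
       forall f : {additive V B -> V (rng_of R)}, pre_V_hom f ->
         ~ (forall v, exists u, f u = v)) /\
    (forall (F : realType) (B : cstarType F), real_rank_0 B ->
       ~ (exists f : {additive V (rng_of R) -> V B}, bijective f)) /\
    (forall B : rngType, regular_ring B ->
       ~ (exists f : {additive V (rng_of R) -> V B}, bijective f)) /\
    (exists (d : Order.disp_t) (I : porderType d) (A : I -> algType K)
            (f : forall i j : I, (i <= j)%O -> {lrmorphism A i -> A j})
            (c : forall i : I, {lrmorphism A i -> R}),
        has_card_aleph 3 I /\
        (forall i : I, finite_product_of_RK (A i)) /\
        direct_system f /\
        is_direct_limit f c) /\
    (card_le_aleph 3 K -> card_le_aleph 3 R).
Proof.
have [T1 [T2 [W [s1 s2 s3]]]] := aleph3_exists.
have sqW : squarable W.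
  exact: succ_wo_squarable (succ_wo_squarable (succ_wo_squarable squarable_nat s1) s2) s3.
have cW : has_card_aleph 3 W.
  have c0 : has_card_aleph 0 nat by exact: card_eqxx.
  exact: succ_wo_aleph (succ_wo_aleph (succ_wo_aleph c0 s1) s2) s3.
have no_surj (B : rngType) : approximable B ->
    forall f : {additive V B -> V (rng_of (RK K W))}, pre_V_hom f ->
    ~ (forall v, exists u, f u = v).
  by move=> aB f; exact: approximable_no_surjection s1 s2 s3 aB.
have no_iso (B : rngType) : approximable B ->
    ~ (exists f : {additive V (rng_of (RK K W)) -> V B}, bijective f).
  by move=> /no_surj H [g /bijective_pre_V_hom[f [fV fs]]]; exact: H fV fs.
exists (RK K W); split; first exact: RK_exchange.
split.
  split; last exact: RK_stable_rank_1.
  by have [_ [h _]] := sqW; exact: RK_nilpotence_index (h 0%N).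
split; first by move=> F B /real_rank_0_approximable; exact: no_surj.
split; first by move=> B /regular_approximable; exact: no_surj.
split; first by move=> F B /real_rank_0_approximable; exact: no_iso.
split; first by move=> B /regular_approximable; exact: no_iso.
split.
  apply: RK_direct_limit; apply: has_card_aleph_bij cW; last exact: fsub_inj.
  by exists (fun a => [fset a]%fset) => a b /fset1_inj.
move=> [U [cU /card_leTP KU]]; exists W; split=> //; apply/card_leTP/RK_inj => //.
apply: inj_into_trans KU _.
(* [K] is bounded by some set [U] of cardinality aleph_3, not by [W]; uniqueness of this cardinal
   injects [U] into [W]. *)
have := aleph_unique_succ (aleph_unique_succ (aleph_unique_succ aleph_unique_nat s1) s2) s3.
by move=> /(_ U cU)[].
Qed.
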